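(* Let $\phi:A^C\to N^2$ be a complex-harmonic morphism from an open subset $A^C$ of $\mathbb{C}^4$ to a Riemann surface, with $d\phi$ nowhere zero. Then there exists a holomorphic foliation $\mathcal{F}$ of $A^C$ by $\alpha$-planes or by $\beta$-planes such that each fibre component of $\phi$ is the union of parallel null planes of $\mathcal{F}$. Further, for any $p\in A^C$, there is a neighbourhood $A^C_1$ of $p$ in $A^C$, and a holomorphic map $\rho:V\to\mathbb{C}\cup\{\infty\}$ from an open subset $V$ of $N^2$, such that $\mu=\rho\circ\phi$ represents $\mathcal{F}$ on $A^C_1$.
   Context: $\mathbb{C}^4=\{(x_0,x_1,x_2,x_3)\}$ with holomorphic metric $dx_0^2+dx_1^2+dx_2^2+dx_3^2$ and standard null coordinates $q_1=x_0+ix_1$, $\widetilde{q}_1=x_0-ix_1$, $q_2=x_2+ix_3$, $\widetilde{q}_2=x_2-ix_3$. A complex-harmonic morphism to $\mathbb{C}$ is a complex-analytic function satisfying $\sum_{i=0}^3\partial^2\phi/\partial x_i^2=0$ and $\sum_{i=0}^3(\partial\phi/\partial x_i)^2=0$; for a map to a Riemann surface these equations are required in any local complex coordinate of the target. A fibre component is a connected component of a fibre. For $p\in\mathbb{C}^4$ identify $T_p\mathbb{C}^4$ with $\mathbb{R}^4\otimes\mathbb{C}$. An $\alpha$-plane (respectively $\beta$-plane) at $p$ is $\mathrm{span}_{\mathbb C}\{e_0+ie_1,e_2+ie_3\}$ with $\{e_0,\dots,e_3\}$ a positively (respectively negatively) oriented orthonormal basis of $\mathbb{R}^4$. A holomorphic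 foliation by $\alpha$-planes (or $\beta$-planes) is a complex-analytic foliation whose tangent spaces are $\alpha$-planes (or $\beta$-planes); its leaves are open pieces of affine planes, called the null planes of $\mathcal{F}$. A function $\mu$ with values in $\mathbb{C}\cup\{\infty\}$ represents a foliation by $\alpha$-planes if its tangent plane has basis $\{\partial/\partial\widetilde{q}_1-\mu\,\partial/\partial q_2,\ \partial/\partial\widetilde{q}_2+\mu\,\partial/\partial q_1\}$ where $\mu\ne\infty$, and $\{\partial/\partial q_2,\partial/\partial q_1\}$ where $\mu=\infty$. For $\beta$-planes the same definition is used with $q_2$ and $\widetilde{q}_2$ interchanged.
   Formalization: The alternative ''by α-planes or by β-planes'' is proved on each connected subset of A^C (so on all of A^C when it is connected); for disconnected A^C the type may change between components, since a single global type can fail there. *)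

(* Defs.v *)
From HB Require Import structures.
From mathcomp Require Import all_boot all_order all_algebra.
From mathcomp Require Import complex.
From mathcomp Require Import all_classical all_reals.
From mathcomp Require Import topology normedtype derive.
Set Implicit Arguments.
Unset Strict Implicit.
Unset Printing Implicit Defensive.
Import Order.TTheory GRing.Theory Num.Theory.
Import numFieldNormedType.Exports.
Local Open Scope classical_set_scope.
Local Open Scope ring_scope.

(* The complex numbers R[i].  The ascription to numFieldType gives the carrier
   the topology of the modulus and its structure of normed space over itself,
   so that [differentiable] and ['D_v] below are complex (Frechet and
   directional) differentiability and derivatives. *)
Definition Cx (R : realType) : numFieldType := R[i]%C.
Definition Ci (R : realType) : Cx R := 'i%C.

(* C^4, a point being the row (x_0, x_1, x_2, x_3). *)
Notation C4 R := 'rV[Cx R]_4.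

Definition std_vec (R : realType) (k : 'I_4) : C4 R := delta_mx 0 k.

(** Riemann surfaces *)

(* [cinv] is meaningful only on the image [cmap @` cdom]. *)
Record chart (R : realType) (N : topologicalType) := Chart {
  cdom : set N;
  cmap : N -> Cx R;
  cinv : Cx R -> N
}.

Definition is_chart (R : realType) (N : topologicalType) (c : chart R N) : Prop :=
  [/\ open (cdom c), open (cmap c @` cdom c),
      (forall y, cdom c y -> cinv c (cmap c y) = y),
      (forall y, cdom c y -> {for y, continuous (cmap c)}) &
      (forall y, cdom c y -> {for cmap c y, continuous (cinv c)})].

(* The change of coordinates from c to d is holomorphic. *)
Definition compatible (R : realType) (N : topologicalType) (c d : chart R N) : Prop :=
  forall y, cdom c y -> cdom d y -> differentiable (cmap d \o cinv c) (cmap c y).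

Definition riemann_surface (R : realType) (N : topologicalType)
    (atlas : set (chart R N)) : Prop :=
  [/\ hausdorff_space N, connected [set: N],
      (forall c, atlas c -> is_chart c),
      (forall y, exists2 c, atlas c & cdom c y) &
      (forall c d, atlas c -> atlas d -> compatible c d)].

(* An arbitrary local complex coordinate, i.e. a chart of the maximal atlas. *)
Definition local_coordinate (R : realType) (N : topologicalType)
    (atlas : set (chart R N)) (c : chart R N) : Prop :=
  is_chart c /\ forall d, atlas d -> compatible c d /\ compatible d c.

(** Complex-harmonic morphisms *)

Definition harmonic_morphism_equations (R : realType) (f : C4 R -> Cx R)
    (p : C4 R) : Prop :=
  \sum_(i < 4) 'D_(std_vec R i) ('D_(std_vec R i) f) p = 0 /\
  \sum_(i < 4) ('D_(std_vec R i) f p) ^+ 2 = 0.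

(* A map on A is a total function whose values outside A are irrelevant: A is
   open, and only germs at the points of A are used.  Complex-analyticity is
   complex differentiability at every point of an open set. *)
Definition complex_harmonic_morphism (R : realType) (N : topologicalType)
    (atlas : set (chart R N)) (A : set (C4 R)) (phi : C4 R -> N) : Prop :=
  forall p, A p ->
    {for p, continuous phi} /\
    forall c, local_coordinate atlas c -> cdom c (phi p) ->
      differentiable (cmap c \o phi) p /\
      harmonic_morphism_equations (cmap c \o phi) p.

Definition differential_nonzero (R : realType) (N : topologicalType)
    (atlas : set (chart R N)) (phi : C4 R -> N) (p : C4 R) : Prop :=
  forall c, local_coordinate atlas c -> cdom c (phi p) ->
    exists v, 'd (cmap c \o phi) p v != 0.

(* The connected component through p of the fibre of phi : A -> N. *)
Definition fibre_component (R : realType) (N : topologicalType)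
    (A : set (C4 R)) (phi : C4 R -> N) (p : C4 R) : set (C4 R) :=
  connected_component (A `&` phi @^-1` [set phi p]) p.

(** Null planes *)

Definition span2 (R : realType) (u v : C4 R) : set (C4 R) :=
  [set w | exists a b : Cx R, w = a *: u + b *: v].

(* The span of e_0 + i e_1 and e_2 + i e_3, where e_j is the j-th row of E. *)
Definition frame_plane (R : realType) (E : 'M[R]_4) : set (C4 R) :=
  let e (k : nat) := row (inord k) E in
  let cplx (u v : 'rV[R]_4) : C4 R := \row_l (u 0 l +i* v 0 l)%C in
  span2 (cplx (e 0%N) (e 1%N)) (cplx (e 2%N) (e 3%N)).

Definition alpha_plane (R : realType) (P : set (C4 R)) : Prop :=
  exists E : 'M[R]_4, [/\ E *m E^T = 1%:M, 0 < \det E & P = frame_plane E].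

Definition beta_plane (R : realType) (P : set (C4 R)) : Prop :=
  exists E : 'M[R]_4, [/\ E *m E^T = 1%:M, \det E < 0 & P = frame_plane E].

(* The coordinate vector fields of q_1 = x_0 + i x_1, q~_1 = x_0 - i x_1,
   q_2 = x_2 + i x_3, q~_2 = x_2 - i x_3, i.e. the basis of C^4 dual to these
   four linear forms. *)
Definition vq1 (R : realType) : C4 R :=
  2^-1 *: (std_vec R (inord 0) - Ci R *: std_vec R (inord 1)).
Definition vqt1 (R : realType) : C4 R :=
  2^-1 *: (std_vec R (inord 0) + Ci R *: std_vec R (inord 1)).
Definition vq2 (R : realType) : C4 R :=
  2^-1 *: (std_vec R (inord 2) - Ci R *: std_vec R (inord 3)).
Definition vqt2 (R : realType) : C4 R :=
  2^-1 *: (std_vec R (inord 2) + Ci R *: std_vec R (inord 3)).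

(* C u {oo}, with [None] for oo. *)
Notation sphere R := (option (Cx R)).

Definition alpha_span (R : realType) (mu : sphere R) : set (C4 R) :=
  if mu is Some m then span2 (vqt1 R - m *: vq2 R) (vqt2 R + m *: vq1 R)
  else span2 (vq2 R) (vq1 R).

Definition beta_span (R : realType) (mu : sphere R) : set (C4 R) :=
  if mu is Some m then span2 (vqt1 R - m *: vqt2 R) (vq2 R + m *: vq1 R)
  else span2 (vqt2 R) (vq1 R).

(** Holomorphic maps to the Riemann sphere *)

Definition holomorphic_on (R : realType) (N : topologicalType)
    (atlas : set (chart R N)) (W : set N) (g : N -> Cx R) : Prop :=
  forall y c, W y -> local_coordinate atlas c -> cdom c y ->
    differentiable (g \o cinv c) (cmap c y).

Definition sphere_inv (R : realType) (w : sphere R) : sphere R :=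
  if w is Some z then (if z == 0 then None else Some z^-1) else Some 0.

(* Near every point, rho is holomorphic in one of the two standard charts
   w and 1/w of the sphere. *)
Definition holomorphic_to_sphere (R : realType) (N : topologicalType)
    (atlas : set (chart R N)) (V : set N) (rho : N -> sphere R) : Prop :=
  forall y, V y -> exists (W : set N) (g : N -> Cx R),
    [/\ open W, W y, W `<=` V, holomorphic_on atlas W g &
        (forall x, W x -> rho x = Some (g x)) \/
        (forall x, W x -> rho x = sphere_inv (Some (g x)))].

(** Holomorphic foliations by surfaces *)

(* A foliation is given by a set of pairs (U, f), where f is a submersion of U
   to C^2 whose level sets are the plaques. *)
Notation foliation_atlas R := (set (set (C4 R) * (C4 R -> 'rV[Cx R]_2))).

(* In the compatibility condition gamma is automatically a local
   biholomorphism: exchange (U, f) and (V, g). *)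
Definition holomorphic_foliation (R : realType) (A : set (C4 R))
    (F : foliation_atlas R) : Prop :=
  [/\ (forall U f, F (U, f) -> open U /\ U `<=` A),
      (forall p, A p -> exists U f, F (U, f) /\ U p),
      (forall U f p, F (U, f) -> U p ->
         differentiable f p /\ forall w, exists v, 'd f p v = w) &
      (forall U f V g p, F (U, f) -> F (V, g) -> U p -> V p ->
         exists gamma : 'rV[Cx R]_2 -> 'rV[Cx R]_2,
           (\forall y \near f p, differentiable gamma y) /\
           (\forall x \near p, g x = gamma (f x)))].

Definition tangent_space (R : realType) (F : foliation_atlas R) (p : C4 R) :
    set (C4 R) :=
  [set v | exists U f, [/\ F (U, f), U p & 'd f p v = 0]].

(* The points reached from p through a finite chain of plaques, i.e. the
   smallest set containing p and, with any of its points, every plaque through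
   that point. *)
Definition leaf (R : realType) (F : foliation_atlas R) (p : C4 R) :
    set (C4 R) :=
  smallest [set S : set (C4 R) | forall U f q, F (U, f) -> U q -> S q ->
              connected_component (U `&` f @^-1` [set f q]) q `<=` S]
           [set p].

(* The dichotomy holds on each connected piece of A, hence on all of A when A
   is connected; for a disconnected open set A the type of the planes may
   change from one component to another. *)
Definition by_alpha_or_by_beta_planes (R : realType) (A : set (C4 R))
    (F : foliation_atlas R) : Prop :=
  forall B, B `<=` A -> connected B ->
    (forall p, B p -> alpha_plane (tangent_space F p)) \/
    (forall p, B p -> beta_plane (tangent_space F p)).

(* L is a leaf of F and an open piece of an affine plane with direction P. *)
Definition null_plane_of (R : realType) (A : set (C4 R))
    (F : foliation_atlas R) (P L : set (C4 R)) : Prop :=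
  (exists2 p, A p & L = leaf F p) /\
  exists (q : C4 R) (O : set (C4 R)),
    open O /\ L = O `&` [set q + v | v in P].

Definition union_of_parallel_null_planes (R : realType) (A : set (C4 R))
    (F : foliation_atlas R) (K : set (C4 R)) : Prop :=
  exists (P : set (C4 R)) (leaves : set (set (C4 R))),
    [/\ alpha_plane P \/ beta_plane P,
        (forall L, leaves L -> null_plane_of A F P L) &
        K = \bigcup_(L in leaves) L].

Definition represents (R : realType) (B : set (C4 R)) (F : foliation_atlas R)
    (mu : C4 R -> sphere R) : Prop :=
  (forall x, B x ->
     alpha_plane (tangent_space F x) /\ tangent_space F x = alpha_span (mu x)) \/
  (forall x, B x ->
     beta_plane (tangent_space F x) /\ tangent_space F x = beta_span (mu x)).

(* Main.v *)
(* Near a point choose a frame (u1, ut1, u2, ut2) of null coordinate vectors with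
   D_u1 f <> 0, where f is phi read in a chart, and put mu = - D_ut2 f / D_u1 f and
   nu = - D_u2 f / D_u1 f.  The two equations say that ker df contains the plane of
   one type with slope mu and the plane of the other type with slope nu, and, the
   second derivatives of mu being symmetric, that
     (D_ut2 mu + mu D_u1 mu) (D_u2 nu + nu D_u1 nu) = 0.
   By the identity theorem one of the factors vanishes identically.  If it is the
   first, d mu is a multiple of df, so mu = rho o f; an estimate of Gronwall type
   along segments shows that f is constant on affine planes of slope mu, and f
   together with the affine function cutting out these planes (with slope depending
   on the point) is a submersion whose level sets are pieces of them.  The type is
   chosen intrinsically: alpha where the alpha-plane is locally a function of phi,
   and beta elsewhere.  Analyticity being given as complex differentiability at
   every point, derivatives are controlled by Goursat's theorem and Cauchy's estimate
   on quadrilaterals. *)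
Require Import Defs.
From HB Require Import structures.
From mathcomp Require Import all_boot all_order all_algebra.
From mathcomp Require Import complex.
From mathcomp Require Import all_classical all_reals.
From mathcomp Require Import topology normedtype landau derive.
From mathcomp Require Import measure lebesgue_measure lebesgue_integral ftc.
From mathcomp Require Import ring lra.
Import Order.TTheory GRing.Theory Num.Theory.
Import numFieldNormedType.Exports.
Local Open Scope classical_set_scope.
Local Open Scope ring_scope.
Set Implicit Arguments.
Unset Strict Implicit.
Unset Printing Implicit Defensive.

(** * Real-valued norm *)

(** Pointwise complex differentiability gives at first neither second derivatives nor an inverse
    function theorem. A Cauchy estimate with explicit constants turns bounds on balls into Lipschitz
    bounds for the differential; difference quotients with halved steps then converge geometrically,
    which differentiates the derivative and makes mixed derivatives symmetric. The inverse function
    theorem is replaced by a shear in one direction, inverted by iterating a scalar contraction. The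
    obstacle to gluing is that both factors of the product may vanish, so a type picked chart by
    chart need not agree on overlaps; hence a test that mentions only [phi] and the planes, whose
    answer the identity theorem makes locally constant. Directions are cut out by equations
    homogeneous in the covector df, so they depend on neither chart nor frame and infinite slopes
    are included. The foliation consists of all submersions whose level sets are the prescribed
    planar pieces; a transition map is one submersion composed with a local section of the other. *)

(* Over [Cx R] the norm [`|x|] of the library is complex-valued. *)
Definition nrm (R : realType) (V : normedModType (Cx R)) (x : V) : R :=
  complex.Re (`|x| : R[i]).

Section Norm.
Variables (R : realType) (V : normedModType (Cx R)).
Implicit Types (x y : V) (a : Cx R).

Lemma normE x : `|x| = ((nrm x)%:C)%C :> Cx R.
Proof.
rewrite /nrm; have := normr_ge0 x; move: (`|x|) => z.
by rewrite lecE /= => /andP[/eqP h _]; case: z h => r i /= ->.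
Qed.

Lemma nrm_ge0 x : 0 <= nrm x.
Proof. by rewrite -(@ler0c R) -normE normr_ge0. Qed.

Lemma nrmD x y : nrm (x + y) <= nrm x + nrm y.
Proof. by rewrite -lecR rmorphD /= -!normE ler_normD. Qed.

Lemma nrmN x : nrm (- x) = nrm x.
Proof. by rewrite /nrm normrN. Qed.

Lemma nrmB x y : nrm (x - y) <= nrm x + nrm y.
Proof. by rewrite -(nrmN y) nrmD. Qed.

Lemma nrmC x y : nrm (x - y) = nrm (y - x).
Proof. by rewrite -nrmN opprB. Qed.

Lemma nrm0 : nrm (0 : V) = 0.
Proof. by rewrite /nrm normr0. Qed.

Lemma nrm_eq0 x : nrm x = 0 -> x = 0.
Proof. by move=> h; apply/normr0_eq0; rewrite normE h. Qed.

Lemma nrm_gt0 x : x != 0 -> 0 < nrm x.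
Proof.
move=> x0; rewrite lt_neqAle nrm_ge0 andbT eq_sym.
by apply: contra x0 => /eqP/nrm_eq0 ->.
Qed.

Lemma nrmZ a x : nrm (a *: x) = nrm a * nrm x.
Proof. by apply: (@complexI R); rewrite rmorphM /= -!normE normrZ. Qed.

Lemma nrm_tri x y z : nrm (x - z) <= nrm (x - y) + nrm (y - z).
Proof. by rewrite -[x - z](subrKA y) nrmD. Qed.

Lemma gt0CE (e : Cx R) : 0 < e -> exists2 r : R, 0 < r & e = (r%:C)%C.
Proof.
case: e => r i; rewrite ltcE /= => /andP[/eqP -> h].
by exists r.
Qed.

Lemma near_nrmP x (P : V -> Prop) :
  (\forall y \near x, P y) <->
  exists2 e : R, 0 < e & forall y, nrm (y - x) < e -> P y.
Proof.
split=> [/nbhs_ballP [e /= e0]|[e e0 he]].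
  have [r r0 ->] := gt0CE e0 => he.
  exists r => // y hy; apply: he; rewrite -ball_normE /=.
  by rewrite normE ltcR nrmC.
apply/nbhs_ballP; exists (e%:C)%C; first by rewrite /= ltcR.
move=> y; rewrite -ball_normE /= normE ltcR nrmC; exact: he.
Qed.

End Norm.

Lemma nrmM (R : realType) (a b : Cx R) : nrm (a * b) = nrm a * nrm b.
Proof. exact: (@nrmZ R (Cx R)). Qed.

Lemma nrm1 (R : realType) : nrm (1 : Cx R) = 1.
Proof. by rewrite /nrm normr1. Qed.

Lemma nrmV (R : realType) (a : Cx R) : nrm a^-1 = (nrm a)^-1.
Proof.
have [->|a0] := eqVneq a 0; first by rewrite invr0 nrm0 invr0.
have n0 : nrm a != 0 by rewrite gt_eqF// nrm_gt0.
by apply: (mulfI n0); rewrite -nrmM !divff // nrm1.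
Qed.

Lemma nrmX (R : realType) (a : Cx R) n : nrm (a ^+ n) = nrm a ^+ n.
Proof. by elim: n => [|n IH]; rewrite ?expr0 ?nrm1 // !exprS nrmM IH. Qed.

Lemma nrmR (R : realType) (r : R) : nrm ((r%:C)%C : Cx R) = `|r|.
Proof. by rewrite /nrm normc_def /= expr0n addr0 sqrtr_sqr. Qed.

Lemma nrm_sqr (R : realType) (a : Cx R) :
  nrm a ^+ 2 = complex.Re a ^+ 2 + complex.Im a ^+ 2.
Proof.
by rewrite /nrm normc_def /= sqr_sqrtr // addr_ge0 // sqr_ge0.
Qed.

Lemma le_Re (R : realType) (a : Cx R) : `|complex.Re a| <= nrm a.
Proof.
rewrite -ler_sqr ?nnegrE ?nrm_ge0 // nrm_sqr real_normK ?num_real //.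
by rewrite lerDl sqr_ge0.
Qed.

Lemma le_Im (R : realType) (a : Cx R) : `|complex.Im a| <= nrm a.
Proof.
rewrite -ler_sqr ?nnegrE ?nrm_ge0 // nrm_sqr real_normK ?num_real //.
by rewrite lerDr sqr_ge0.
Qed.

Lemma nrm_le (R : realType) (a : Cx R) : nrm a <= `|complex.Re a| + `|complex.Im a|.
Proof.
rewrite -ler_sqr ?nnegrE ?nrm_ge0 ?addr_ge0 // nrm_sqr sqrrD !real_normK ?num_real //.
by rewrite addrAC lerDl mulrn_wge0 // mulr_ge0.
Qed.

Section Differentiability.
Variables (R : realType) (V W : normedModType (Cx R)).

Lemma diff_nrm (f : V -> W) p : differentiable f p ->
  forall e : R, 0 < e -> exists2 d : R, 0 < d & forall h, nrm h < d ->
    nrm (f (p + h) - f p - 'd f p h) <= e * nrm h.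
Proof.
move=> df e e0.
have e1 : 0 < ((e%:C)%C : Cx R) by rewrite ltcR.
have := diff_locally df.
move/eqaddoP => /(_ _ e1); rewrite -nbhs_nearE => /(near_nrmP) [d d0 hd].
exists d => // h hh; have := hd h; rewrite subr0 => /(_ hh).
rewrite -[X in X -> _]/(is_true (`|f (h + p) - (f p + 'd f p h)| <= (e%:C)%C * `|h|)).
rewrite !normE -[X in _ <= X]rmorphM lecR.
by rewrite (addrC h) opprD addrA.
Qed.

Lemma nrm_diff (f : V -> W) p (L : {linear V -> W}) (c : R) :
  (forall h, nrm (L h) <= c * nrm h) ->
  (forall e : R, 0 < e -> exists2 d : R, 0 < d & forall h, nrm h < d ->
    nrm (f (p + h) - f p - L h) <= e * nrm h) ->
  differentiable f p /\ 'd f p = L :> (V -> W).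
Proof.
move=> Lc fL.
have Lcont : continuous L.
  move=> x; apply/cvgrPdist_lt => e /gt0CE[r r0 ->].
  have c1 : 0 < `|c| + 1 by rewrite ltr_pwDr.
  apply/near_nrmP; exists (r / (`|c| + 1)); first exact: divr_gt0.
  move=> y hy; rewrite normE ltcR -raddfB.
  apply: le_lt_trans (Lc _) _; rewrite nrmC.
  apply: (@le_lt_trans _ _ ((`|c| + 1) * nrm (y - x))).
    by rewrite ler_wpM2r ?nrm_ge0// (le_trans (ler_norm _)) // lerDl.
  by rewrite mulrC -ltr_pdivlMr.
have H : f \o shift p = cst (f p) + L +o_ 0 id.
  apply/eqaddoP => e /gt0CE[r r0 ->].
  have [d d0 hd] := fL r r0.
  rewrite -nbhs_nearE; apply/near_nrmP; exists d => // y; rewrite subr0 => hy.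
  rewrite -[X in is_true X]/(`|f (y + p) - (f p + L y)| <= (r%:C)%C * `|y|).
  rewrite !normE -[X in _ <= X]rmorphM lecR.
  by rewrite (addrC y) opprD addrA hd.
have dfE := diff_unique Lcont H.
by split=> //; apply/diff_locallyP; rewrite dfE.
Qed.

Lemma diff_bound (f : V -> W) p : differentiable f p ->
  exists2 k : R, 0 < k & forall h, nrm ('d f p h) <= k * nrm h.
Proof.
move=> df; have [_ /gt0CE [r r0 ->] h] := linear_lipschitz (diff_continuous df).
exists r => // x; have := h x.
by rewrite !normE -[X in _ <= X]rmorphM lecR.
Qed.

Lemma cont_nrm (f : V -> W) p : {for p, continuous f} ->
  forall e : R, 0 < e -> exists2 d : R, 0 < d & forall y, nrm (y - p) < d ->
    nrm (f y - f p) < e.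
Proof.
move=> cf e e0; have e1 : 0 < ((e%:C)%C : Cx R) by rewrite ltcR.
have /cvgrPdist_lt /(_ _ e1) /near_nrmP[d d0 hd] : f @ p --> f p by exact: cf.
by exists d => // y /hd; rewrite normE ltcR nrmC.
Qed.

End Differentiability.

Lemma open_nrmP (R : realType) (V : normedModType (Cx R)) (U : set V) :
  open U <-> forall x, U x -> exists2 e : R, 0 < e & forall y, nrm (y - x) < e -> U y.
Proof.
rewrite openE; split=> [h x /h /near_nrmP //|h x /h hx].
by apply/near_nrmP.
Qed.

Lemma ball_open (R : realType) (V : normedModType (Cx R)) (p : V) (r : R) :
  open [set x | nrm (x - p) < r].
Proof.
apply/open_nrmP => x /= xr; exists (r - nrm (x - p)); first by rewrite subr_gt0.
by move=> y hy; have := nrm_tri y x p; lra.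
Qed.

(** * Path integrals and the Cauchy estimate *)

(** The parameter is real and the value complex, so this is a derivative over the reals, distinct
    from the complex differential. The epsilon form passes directly to real and imaginary parts. *)
Definition cder (R : realType) (G : R -> Cx R) (t : R) (l : Cx R) : Prop :=
  forall e : R, 0 < e -> exists2 d : R, 0 < d & forall h, `|h| < d ->
    nrm (G (t + h) - G t - (h%:C)%C * l) <= e * `|h|.

Section RealDerivative.
Variable R : realType.
Implicit Types (g : R -> R) (G H : R -> Cx R) (t : R) (l m : Cx R).

Lemma is_derive_eps g t (l : R) :
  (forall e : R, 0 < e -> exists2 d : R, 0 < d & forall h, `|h| < d ->
    `|g (t + h) - g t - h * l| <= e * `|h|) <-> is_derive t 1 g l.
Proof.
split=> [hg|[dg <-]].
  have cv : (fun h => h^-1 *: ((g \o shift t) (h *: 1) - g t)) @ 0^' --> l.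
    apply/cvgrPdist_le => e e0; have [d d0 hd] := hg e e0.
    rewrite near_withinE; apply/nbhs_ballP; exists d => //= h.
    rewrite /ball /= sub0r normrN => hd' h0; have := hd h hd'.
    rewrite [h%:A]mulr1 (addrC h) => H.
    rewrite distrC -[l](mulKf h0) -[_ *: _]/(_ * _) -mulrBr normrM normfV.
    by rewrite mulrC ler_pdivrMr ?normr_gt0.
  by split; [exact: cvgP cv | exact: cvg_lim cv].
move=> e e0; move/cvgrPdist_le: dg => /(_ e e0).
rewrite near_withinE => /nbhs_ballP[d /= d0 hd]; exists d => // h hh.
have [->|h0] := eqVneq h 0; first by rewrite addr0 subrr mul0r subrr normr0 mulr0.
have := hd h; rewrite /ball /= sub0r normrN => /(_ hh h0).
rewrite -[lim _]/('D_1 g t) [h%:A]mulr1 (addrC h t) distrC.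
rewrite -{1}['D_1 g t](mulKf h0) -[_ *: _]/(_ * _) -mulrBr normrM normfV.
by rewrite mulrC ler_pdivrMr ?normr_gt0.
Qed.

Lemma cder_Re G t l : cder G t l ->
  is_derive t 1 (fun s => complex.Re (G s)) (complex.Re l).
Proof.
move=> hG; apply/is_derive_eps => e /hG[d d0 hd]; exists d => // h /hd.
apply: le_trans; apply: le_trans (le_Re _).
by case: (G (t + h)) (G t) l {hG hd} => a b [c f] [u v] /=; rewrite mul0r subr0.
Qed.

Lemma cder_Im G t l : cder G t l ->
  is_derive t 1 (fun s => complex.Im (G s)) (complex.Im l).
Proof.
move=> hG; apply/is_derive_eps => e /hG[d d0 hd]; exists d => // h /hd.
apply: le_trans; apply: le_trans (le_Im _).
by case: (G (t + h)) (G t) l {hG hd} => a b [c f] [u v] /=; rewrite mul0r addr0.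
Qed.

Lemma cder_ReIm G t l :
  is_derive t 1 (fun s => complex.Re (G s)) (complex.Re l) ->
  is_derive t 1 (fun s => complex.Im (G s)) (complex.Im l) -> cder G t l.
Proof.
move=> /is_derive_eps hr /is_derive_eps hi e e0.
have e2 : 0 < e / 2 by lra.
have [d d0 hd] := hr _ e2; have [c c0 hc] := hi _ e2.
exists (Num.min c d); first by rewrite lt_min c0 d0.
move=> h; rewrite lt_min => /andP[/hc {}hc /hd {}hd].
apply: le_trans (nrm_le _) _.
move: hc hd; case: (G (t + h)) (G t) l {hr hi} => a b [u v] [x y] /=.
by rewrite mul0r subr0 mul0r addr0; lra.
Qed.

Lemma cderD G H t l m : cder G t l -> cder H t m ->
  cder (fun s => G s + H s) t (l + m).
Proof.
move=> hG hH e e0; have e2 : 0 < e / 2 by lra.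
have [d d0 hd] := hG _ e2; have [c c0 hc] := hH _ e2.
exists (Num.min c d); first by rewrite lt_min c0 d0.
move=> h; rewrite lt_min => /andP[/hc {}hc /hd {}hd].
rewrite [X in nrm X](_ : _ = (G (t + h) - G t - (h%:C)%C * l) +
  (H (t + h) - H t - (h%:C)%C * m)); last by ring.
by apply: le_trans (nrmD _ _) _; lra.
Qed.

Lemma cderZ (c : Cx R) G t l : cder G t l -> cder (fun s => c * G s) t (c * l).
Proof.
move=> hG e e0; have c0 := nrm_ge0 c.
have e2 : 0 < e / (nrm c + 1) by rewrite divr_gt0 //; lra.
have [d d0 hd] := hG _ e2; exists d => // h /hd {}hd.
rewrite [X in nrm X](_ : _ = c * (G (t + h) - G t - (h%:C)%C * l)); last by ring.
rewrite nrmM; apply: le_trans (ler_wpM2l c0 hd) _.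
rewrite mulrA ler_wpM2r // mulrCA ler_piMr // ?(ltW e0) //.
by rewrite ler_pdivrMr; lra.
Qed.

Lemma cder_affine (k c : R) G t l : cder G (k * t + c) l ->
  cder (fun s => G (k * s + c)) t ((k%:C)%C * l).
Proof.
move=> hG e e0; have k0 := normr_ge0 k.
have e2 : 0 < e / (`|k| + 1) by rewrite divr_gt0 //; lra.
have [d d0 hd] := hG _ e2; exists (d / (`|k| + 1)); first by rewrite divr_gt0 //; lra.
move=> h; rewrite ltr_pdivlMr; last by lra.
move=> hh; have h0 := normr_ge0 h.
have kh : `|k * h| <= (`|k| + 1) * `|h|.
  by rewrite normrM ler_wpM2r //; lra.
have := hd (k * h); rewrite (le_lt_trans kh) ?(mulrC _ `|h|) // => /(_ isT).
rewrite (_ : k * t + c + k * h = k * (t + h) + c); last by ring.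
rewrite [X in nrm X](_ : _ = G (k * (t + h) + c) - G (k * t + c)
  - (h%:C)%C * ((k%:C)%C * l)); last by rewrite rmorphM /=; ring.
move=> H; apply: le_trans H _.
apply: le_trans (_ : e / (`|k| + 1) * ((`|k| + 1) * `|h|) <= _).
  by rewrite ler_wpM2l // ltW.
have k1 : `|k| + 1 != 0 by rewrite gt_eqF //; lra.
by rewrite mulrA divfK // mulrC.
Qed.

Lemma cder_path (V : normedModType (Cx R)) (f : V -> Cx R) x v t :
  differentiable f (x + (t%:C)%C *: v) ->
  cder (fun s => f (x + (s%:C)%C *: v)) t ('d f (x + (t%:C)%C *: v) v).
Proof.
move=> df e e0; have v0 := nrm_ge0 v.
have e2 : 0 < e / (nrm v + 1) by rewrite divr_gt0 //; lra.
have [d d0 hd] := diff_nrm df e2.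
exists (d / (nrm v + 1)); first by rewrite divr_gt0 //; lra.
move=> h; rewrite ltr_pdivlMr; last by lra.
move=> hh; have h0 := normr_ge0 h.
have kh : nrm ((h%:C)%C *: v) <= `|h| * (nrm v + 1).
  by rewrite nrmZ nrmR ler_wpM2l //; lra.
have := hd _ (le_lt_trans kh hh).
rewrite rmorphD /= scalerDl addrA linearZ /= => /le_trans; apply.
apply: le_trans (_ : e / (nrm v + 1) * (`|h| * (nrm v + 1)) <= _).
  by rewrite ler_wpM2l // ltW.
have v1 : nrm v + 1 != 0 by rewrite gt_eqF //; lra.
by rewrite mulrCA divfK // mulrC.
Qed.

Lemma cder_eq G t l m : cder G t l -> l = m -> cder G t m.
Proof. by move=> + <-. Qed.

Lemma derive_Re_MVT (g dg : R -> R) :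
  (forall t, 0 <= t <= 1 -> is_derive t 1 g (dg t)) ->
  exists2 c, 0 <= c <= 1 & g 1 - g 0 = dg c.
Proof.
move=> hg.
have h1 (x : R) : x \in `]0, 1[%R -> is_derive x 1 g (dg x).
  by rewrite in_itv /= => /andP[x0 x1]; apply: hg; rewrite !ltW.
have h2 : {within `[0, 1], continuous g}.
  apply: derivable_within_continuous => x; rewrite in_itv /= => x01.
  by have [] := hg x x01.
have [c c01 ->] := MVT_segment ler01 h1 h2.
by exists c; rewrite ?subr0 ?mulr1 //; move: c01; rewrite in_itv.
Qed.

(** The real mean value theorem gives different intermediate points for the real and the imaginary
    part; this costs the factor 2, which reappears in all later constants. *)
Lemma cder_mvi G (l : R -> Cx R) (M : R) :
  (forall t, 0 <= t <= 1 -> cder G t (l t)) ->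
  (forall t, 0 <= t <= 1 -> nrm (l t) <= M) -> nrm (G 1 - G 0) <= 2 * M.
Proof.
move=> hG hM.
have [c c1 hc] := derive_Re_MVT (fun t ht => cder_Re (hG t ht)).
have [d d1 hd] := derive_Re_MVT (fun t ht => cder_Im (hG t ht)).
have := hM _ c1; have := hM _ d1.
have := le_trans (le_Re (l c)) (hM _ c1); have := le_trans (le_Im (l d)) (hM _ d1).
rewrite -hc -hd => ? ? _ _; apply: le_trans (nrm_le _) _.
by rewrite !raddfB /=; lra.
Qed.

(** Serves to keep the contour integral of the inverse function away from 0 without computing it. *)
Lemma cder_Im_ge G (l : R -> Cx R) (M : R) :
  (forall t, 0 <= t <= 1 -> cder G t (l t)) ->
  (forall t, 0 <= t <= 1 -> M <= complex.Im (l t)) -> M <= complex.Im (G 1 - G 0).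
Proof.
move=> hG hM.
have [d d1 hd] := derive_Re_MVT (fun t ht => cder_Im (hG t ht)).
by rewrite raddfB /= hd hM.
Qed.

Lemma prim_exists g : continuous g ->
  exists G : R -> R, forall t, 0 <= t <= 1 -> is_derive t 1 G (g t).
Proof.
(* Integrating from -1, inside the interval up to 2, puts 0 and 1 in the interior, so the primitive
   has two-sided derivatives at both ends of the unit segment. *)
move=> cg; exists (fun x => (\int[lebesgue_measure]_(t in `[(-1), x]) g t)%R).
move=> t /andP[t0 t1].
have t2 : t < 2 by lra.
have ig : lebesgue_measure.-integrable `[(-1), 2] (EFin \o g).
  by apply: continuous_compact_integrable; [exact: segment_compact|exact: continuous_subspaceT].
have lt1 : -1 < t by lra.
have [d1] := @continuous_FTC1 R g (BLeft (-1)) t 2 t2 ig lt1 (cg t).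
by rewrite derive1E => d2; split.
Qed.

End RealDerivative.

(** The intervals of radius [2 * c / 2 ^+ n] around [x n], the radius being the tail of the
    geometric series, are nested; the limit is the supremum of their left ends. *)
Lemma real_geometric_cauchy (R : realType) (x : nat -> R) (c : R) :
  (forall n, `|x n.+1 - x n| <= c / 2 ^+ n) ->
  exists l, forall n, `|x n - l| <= 2 * c / 2 ^+ n.
Proof.
move=> hx; pose d n : R := 2 * c / 2 ^+ n.
have dS n : d n.+1 = c / 2 ^+ n.
  rewrite /d exprS invfM -!mulrA [in LHS]mulrCA.
  by rewrite (mulrA 2 2^-1) mulfV ?pnatr_eq0 // mul1r mulrC.
have d2 n : d n = 2 * d n.+1 by rewrite dS /d mulrA.
have c0 : 0 <= c by have := le_trans (normr_ge0 _) (hx 0%N); rewrite expr0 divr1.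
have d0 n : 0 <= d n by rewrite /d divr_ge0 ?exprn_ge0 // mulr_ge0.
have up n m : x n - d n <= x (n + m)%N - d (n + m)%N.
  elim: m => [|m IH]; first by rewrite addn0.
  apply: le_trans IH _; rewrite addnS.
  have := hx (n + m)%N; rewrite -dS (d2 (n + m)%N) ler_norml => /andP[? _]; lra.
have dn n m : x (n + m)%N + d (n + m)%N <= x n + d n.
  elim: m => [|m IH]; first by rewrite addn0.
  apply: le_trans IH; rewrite addnS.
  have := hx (n + m)%N; rewrite -dS (d2 (n + m)%N) ler_norml => /andP[_ ?]; lra.
have cross n m : x n - d n <= x m + d m.
  have [/subnKC <-|/ltnW/subnKC <-] := leqP n m.
    by have := up n (m - n)%N; have := d0 (n + (m - n))%N; lra.
  by have := dn m (n - m)%N; have := d0 (m + (n - m))%N; lra.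
pose S := [set y : R | exists n, y = x n - d n].
have S0 : S !=set0 by exists (x 0%N - d 0%N); exists 0%N.
have Sub m : ubound S (x m + d m) by move=> _ [n ->].
have hs : has_sup S by split=> //; exists (x 0%N + d 0%N).
exists (sup S) => n; rewrite -/(d n) ler_norml.
have h1 : x n - d n <= sup S by apply: sup_upper_bound => //; exists n.
have h2 : sup S <= x n + d n by apply: ge_sup.
by apply/andP; split; lra.
Qed.

Lemma complex_geometric_cauchy (R : realType) (z : nat -> Cx R) (c : R) :
  (forall n, nrm (z n.+1 - z n) <= c / 2 ^+ n) ->
  exists l, forall n, nrm (z n - l) <= 4 * c / 2 ^+ n.
Proof.
move=> hz.
have [n|x hx] := @real_geometric_cauchy R (fun n => complex.Re (z n)) c.
  by rewrite -raddfB; apply: le_trans (le_Re _) (hz n).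
have [n|y hy] := @real_geometric_cauchy R (fun n => complex.Im (z n)) c.
  by rewrite -raddfB; apply: le_trans (le_Im _) (hz n).
exists (x +i* y)%C => n; apply: le_trans (nrm_le _) _; rewrite !raddfB /=.
by have := hx n; have := hy n; lra.
Qed.

Section PathIntegral.
Variable R : realType.
Implicit Types (f : Cx R -> Cx R) (a b c z : Cx R).

(** The integral is the increment of a primitive along the segment, so reversal, bisection and
    linearity become substitutions in the primitive. Measure theory enters only through the
    existence of a primitive. *)
Definition is_segint f a b (I : Cx R) : Prop :=
  exists2 G : R -> Cx R,
    (forall t, 0 <= t <= 1 -> cder G t ((b - a) * f (a + (t%:C)%C * (b - a))))
    & I = G 1 - G 0.

Definition segint f a b : Cx R := xget 0 (is_segint f a b).

Definition seg_cont f a b : Prop :=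
  forall t : R, 0 <= t <= 1 -> {for a + (t%:C)%C * (b - a), continuous f}.

Lemma is_segint_unique f a b I J : is_segint f a b I -> is_segint f a b J -> I = J.
Proof.
move=> [G hG ->] [H hH ->].
pose K s := G s + (-1) * H s.
have hK t : 0 <= t <= 1 -> cder K t 0.
  move=> ht; apply: cder_eq (cderD (hG t ht) (cderZ (-1) (hH t ht))) _; ring.
have := @cder_mvi R K (fun=> 0) 0 hK; rewrite nrm0 mulr0 => /(_ (fun _ _ => lexx 0)) h.
have /nrm_eq0 : nrm (K 1 - K 0) = 0 by apply/le_anti; rewrite h nrm_ge0.
by move=> h2; apply/eqP; rewrite -subr_eq0 -h2 /K; apply/eqP; ring.
Qed.

Lemma segintE f a b I : is_segint f a b I -> segint f a b = I.
Proof.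
move=> h; apply: (is_segint_unique _ h); rewrite /segint.
by case: xgetP => [y ->//|/(_ I)].
Qed.

Lemma is_segint_ex f a b : seg_cont f a b -> is_segint f a b (segint f a b).
Proof.
move=> fc.
(* Continuity is known on the segment only. Clamping the parameter to the unit interval, a
   1-Lipschitz operation, extends the integrand continuously to the whole line. *)
pose cl (t : R) := Num.max 0 (Num.min 1 t).
have cl01 t : 0 <= cl t <= 1.
  by rewrite /cl le_max lexx /= ge_max ler01 ge_min lexx.
have clid t : 0 <= t <= 1 -> cl t = t.
  by move=> /andP[t0 t1]; rewrite /cl min_r // max_r.
have clL s t : `|cl s - cl t| <= `|s - t|.
  have u := ler_norm (s - t); have v := ler_norm (t - s); rewrite distrC in v.
  rewrite ler_norml /cl !minElt !maxElt.
  by case: (ltrP 1 s) => ?; case: (ltrP 1 t) => ?; do 2? case: ltrP => ?;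
    apply/andP; split; lra.
pose g t := (b - a) * f (a + ((cl t)%:C)%C * (b - a)).
have gc t e : 0 < e -> exists2 d : R, 0 < d & forall s, `|s - t| < d -> nrm (g s - g t) < e.
  move=> e0; have n0 := nrm_ge0 (b - a).
  have e2 : 0 < e / (nrm (b - a) + 1) by rewrite divr_gt0 //; lra.
  have [d d0 hd] := cont_nrm (fc _ (cl01 t)) e2.
  exists (d / (nrm (b - a) + 1)); first by rewrite divr_gt0 //; lra.
  move=> s; rewrite ltr_pdivlMr; last by lra.
  move=> hs; rewrite /g -mulrBr nrmM.
  have hh : nrm (f (a + (cl s)%:C%C * (b - a)) - f (a + (cl t)%:C%C * (b - a))) <
      e / (nrm (b - a) + 1).
    apply: hd; rewrite [X in nrm X](_ : _ = ((cl s - cl t)%:C)%C * (b - a)); last first.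
      by rewrite rmorphB /=; ring.
    rewrite nrmM nrmR; apply: le_lt_trans hs.
    by apply: ler_pM => //; lra.
  move: hh; rewrite ltr_pdivlMr; last by lra.
  by have := nrm_ge0 (f (a + (cl s)%:C%C * (b - a)) - f (a + (cl t)%:C%C * (b - a))); nra.
have cr : continuous (fun t => complex.Re (g t)).
  move=> t; apply/cvgrPdist_lt => e /(gc t)[d d0 hd].
  apply/nbhs_ballP; exists d => //= s; rewrite /ball /= distrC => /hd h.
  by rewrite distrC -raddfB (le_lt_trans (le_Re _)).
have ci : continuous (fun t => complex.Im (g t)).
  move=> t; apply/cvgrPdist_lt => e /(gc t)[d d0 hd].
  apply/nbhs_ballP; exists d => //= s; rewrite /ball /= distrC => /hd h.
  by rewrite distrC -raddfB (le_lt_trans (le_Im _)).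
have [G1 h1] := prim_exists cr; have [G2 h2] := prim_exists ci.
have H : is_segint f a b ((G1 1 +i* G2 1)%C - (G1 0 +i* G2 0)%C).
  exists (fun t => (G1 t +i* G2 t)%C : Cx R) => // t ht.
  have -> : (b - a) * f (a + (t%:C)%C * (b - a)) = g t by rewrite /g clid.
  by apply: cder_ReIm; [exact: h1|exact: h2].
by rewrite (segintE H).
Qed.

Lemma segint_opp f a b : seg_cont f a b -> segint f b a = - segint f a b.
Proof.
move=> /is_segint_ex[G hG ->]; apply: segintE.
exists (fun s => G (-1 * s + 1)) => [t /andP[t0 t1]|]; last first.
  by rewrite mulr1 addNr mulr0 add0r opprB.
have ht : 0 <= -1 * t + 1 <= 1 by lra.
apply: cder_eq (cder_affine (hG _ ht)) _.
rewrite rmorphD rmorphM rmorphN /= !rmorph1.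
rewrite [X in f X](_ : _ = b + (t%:C)%C * (a - b)); [ring|ring].
Qed.

Lemma segint_mid f a b : seg_cont f a b ->
  segint f a b = segint f a ((a + b) / 2) + segint f ((a + b) / 2) b.
Proof.
move=> /is_segint_ex[G hG ->].
have h2 : ((2^-1 : R)%:C)%C = 2^-1 :> Cx R by rewrite fmorphV rmorph_nat.
rewrite (@segintE f a ((a + b) / 2) (G 2^-1 - G 0)); last first.
  exists (fun s => G (2^-1 * s + 0)) => [t /andP[t0 t1]|]; last by rewrite mulr1 mulr0 !addr0.
  have ht : 0 <= 2^-1 * t + 0 <= 1 by lra.
  apply: cder_eq (cder_affine (hG _ ht)) _.
  rewrite rmorphD rmorphM /= rmorph0 h2 addr0.
  rewrite [X in f X](_ : _ = a + (t%:C)%C * ((a + b) / 2 - a)); by field; rewrite ?pnatr_eq0.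
rewrite (@segintE f ((a + b) / 2) b (G 1 - G 2^-1)); first by ring.
exists (fun s => G (2^-1 * s + 2^-1)) => [t /andP[t0 t1]|]; last first.
  by rewrite mulr1 mulr0 add0r; congr (G _ - _); lra.
have ht : 0 <= 2^-1 * t + 2^-1 <= 1 by lra.
apply: cder_eq (cder_affine (hG _ ht)) _.
rewrite rmorphD rmorphM /= h2.
rewrite [X in f X](_ : _ = (a + b) / 2 + (t%:C)%C * (b - (a + b) / 2)); by field; rewrite ?pnatr_eq0.
Qed.

Lemma segint_primitive f (A : Cx R -> Cx R) a b :
  (forall t : R, 0 <= t <= 1 -> let z := a + (t%:C)%C * (b - a) in
    differentiable A z /\ 'd A z 1 = f z) -> segint f a b = A b - A a.
Proof.
move=> h; apply: segintE.
exists (fun s => A (a + (s%:C)%C *: (b - a))) => [t ht|]; last first.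
  by rewrite scale1r scale0r addr0 subrKC.
have [d1 d2] := h t ht; apply: cder_eq (cder_path d1) _.
by rewrite -[X in 'd A _ X]mulr1 -[_ * 1]/(_ *: (1 : Cx R)) linearZ /= d2.
Qed.

Lemma segint_lin f g (k : Cx R) a b : seg_cont f a b -> seg_cont g a b ->
  segint (fun z => f z + k * g z) a b = segint f a b + k * segint g a b.
Proof.
move=> /is_segint_ex[F hF ->] /is_segint_ex[G hG ->]; apply: segintE.
exists (fun s => F s + k * G s) => [t ht|]; last by ring.
by apply: cder_eq (cderD (hF t ht) (cderZ k (hG t ht))) _; ring.
Qed.

Lemma segint_bound f a b (M : R) : seg_cont f a b ->
  (forall t : R, 0 <= t <= 1 -> nrm (f (a + (t%:C)%C * (b - a))) <= M) ->
  nrm (segint f a b) <= 2 * (M * nrm (b - a)).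
Proof.
move=> /is_segint_ex[F hF ->] hM; apply: cder_mvi hF _ => t /hM h.
by rewrite nrmM mulrC ler_wpM2r // nrm_ge0.
Qed.

End PathIntegral.

Lemma small_half_pow (R : realType) (c d : R) : 0 < d -> exists n : nat, c / 2 ^+ n < d.
Proof.
move=> d0; exists (Num.bound `|c / d|).
rewrite ltr_pdivrMr ?exprn_gt0 // mulrC -ltr_pdivrMr //.
apply: lt_le_trans (_ : (Num.bound `|c / d|)%:R <= _).
  by apply: le_lt_trans (ler_norm _) _; apply: archi_boundP.
by rewrite -natrX ler_nat ltnW // ltn_expl.
Qed.

Lemma nrm_diff_fun (R : realType) (V W : normedModType (Cx R)) (f L : V -> W) p (c : R) :
  linear L -> (forall h, nrm (L h) <= c * nrm h) ->
  (forall e : R, 0 < e -> exists2 d : R, 0 < d & forall h, nrm h < d ->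
    nrm (f (p + h) - f p - L h) <= e * nrm h) ->
  differentiable f p /\ 'd f p = L :> (V -> W).
Proof.
move=> linL; pose LM := GRing.isLinear.Build _ _ _ _ _ linL.
pose LL : {linear V -> W} := HB.pack L LM.
exact: (@nrm_diff R V W f p LL).
Qed.

Lemma nrm_diff1 (R : realType) (f : Cx R -> Cx R) (z w : Cx R) :
  (forall e : R, 0 < e -> exists2 d : R, 0 < d & forall h, nrm h < d ->
    nrm (f (z + h) - f z - h * w) <= e * nrm h) ->
  differentiable f z /\ 'd f z 1 = w.
Proof.
move=> hf.
have [| |//|d1 d2] := @nrm_diff_fun R (Cx R) (Cx R) f ( *%R^~ w) z (nrm w).
- by move=> a x y; rewrite mulrDl -[a *: x]/(a * x) -mulrA.
- by move=> h; rewrite nrmM mulrC.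
by split=> //; rewrite d2 mul1r.
Qed.

Lemma diff1_quadratic (R : realType) (a b l z : Cx R) :
  let A w := a * w + b * (w - l) ^+ 2 in
  differentiable A z /\ 'd A z 1 = a + 2 * b * (z - l).
Proof.
apply: nrm_diff1 => e e0; have b0 := nrm_ge0 b.
exists (e / (nrm b + 1)); first by rewrite divr_gt0 //; lra.
move=> h; rewrite ltr_pdivlMr; last by lra.
move=> hh; rewrite [X in nrm X](_ : _ = b * h * h); last by ring.
by rewrite !nrmM ler_wpM2r ?nrm_ge0 //; have := nrm_ge0 h; nra.
Qed.

(** * Goursat's theorem for triangles in a closed convex set *)

Section Goursat.
Variables (R : realType) (f : Cx R -> Cx R) (K : set (Cx R)).
Hypothesis Kconv : forall a b (t : R), K a -> K b -> 0 <= t <= 1 ->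
  K (a + (t%:C)%C * (b - a)).
Hypothesis Kclosed : forall z, (forall e : R, 0 < e -> exists2 w, K w & nrm (w - z) < e) -> K z.
Hypothesis fK : forall z, K z -> differentiable f z.
Implicit Types a b c z : Cx R.

Let T a b c := segint f a b + segint f b c + segint f c a.
Let per a b c := nrm (b - a) + nrm (c - b) + nrm (a - c).

Let Ksc a b : K a -> K b -> seg_cont f a b.
Proof. by move=> Ka Kb t t01; apply/differentiable_continuous/fK/Kconv. Qed.

Let nrm_half z : nrm (z / 2) = nrm z / 2.
Proof. by rewrite nrmM nrmV -[2](rmorph_nat (real_complex R)) nrmR normr_nat. Qed.

Let Kmid a b : K a -> K b -> K ((a + b) / 2).
Proof.
move=> Ka Kb; have -> : (a + b) / 2 = a + ((2^-1 : R)%:C)%C * (b - a).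
  by rewrite fmorphV rmorph_nat; field; rewrite ?pnatr_eq0.
by apply: Kconv => //; lra.
Qed.

(** The midpoints cut the triangle into four of half the perimeter, and one of them carries at least
    a quarter of the integral. The last clause makes the successive first vertices a geometric
    Cauchy sequence. *)
Let bisect a b c : K a -> K b -> K c -> exists a' b' c',
  [/\ [/\ K a', K b' & K c'], nrm (T a b c) <= 4 * nrm (T a' b' c'),
      per a' b' c' = per a b c / 2 & nrm (a' - a) <= per a b c].
Proof.
move=> Ka Kb Kc.
pose m1 := (a + b) / 2; pose m2 := (b + c) / 2; pose m3 := (c + a) / 2.
have K1 : K m1 by exact: Kmid.
have K2 : K m2 by exact: Kmid.
have K3 : K m3 by exact: Kmid.
have TE : T a b c = T a m1 m3 + T m1 b m2 + T m3 m2 c + T m1 m2 m3.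
  rewrite /T (segint_mid (Ksc Ka Kb)) (segint_mid (Ksc Kb Kc)) (segint_mid (Ksc Kc Ka)).
  rewrite -/m1 -/m2 -/m3 (segint_opp (Ksc K1 K2)) (segint_opp (Ksc K2 K3)).
  by rewrite (segint_opp (Ksc K3 K1)); ring.
have n2 : (2 : Cx R) != 0 by rewrite pnatr_eq0.
have p1 : per a m1 m3 = per a b c / 2.
  rewrite /per !mulrDl -!nrm_half; congr (_ + _ + _); congr nrm; rewrite /m1 /m3; field => //.
have p2 : per m1 b m2 = per a b c / 2.
  rewrite /per !mulrDl -!nrm_half; congr (_ + _ + _); congr nrm; rewrite /m1 /m2; field => //.
have p3 : per m3 m2 c = per a b c / 2.
  rewrite /per !mulrDl -!nrm_half; congr (_ + _ + _); congr nrm; rewrite /m2 /m3; field => //.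
have p4 : per m1 m2 m3 = per a b c / 2.
  have e1 : nrm (m2 - m1) = nrm ((a - c) / 2).
    by rewrite nrmC; congr nrm; rewrite /m1 /m2; field.
  have e2 : nrm (m3 - m2) = nrm ((b - a) / 2).
    by rewrite nrmC; congr nrm; rewrite /m3 /m2; field.
  have e3 : nrm (m1 - m3) = nrm ((c - b) / 2).
    by rewrite nrmC; congr nrm; rewrite /m3 /m1; field.
  by rewrite /per e1 e2 e3 !nrm_half; ring.
have d1 : nrm (m1 - a) <= per a b c.
  rewrite (_ : m1 - a = (b - a) / 2); last by rewrite /m1; field.
  by rewrite nrm_half /per; have := nrm_ge0 (b - a); have := nrm_ge0 (c - b); have := nrm_ge0 (a - c); lra.
have d3 : nrm (m3 - a) <= per a b c.
  rewrite (_ : m3 - a = - ((a - c) / 2)); last by rewrite /m3; field.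
  by rewrite nrmN nrm_half /per; have := nrm_ge0 (b - a); have := nrm_ge0 (c - b); have := nrm_ge0 (a - c); lra.
have d0 : nrm (a - a) <= per a b c.
  by rewrite subrr nrm0; rewrite /per; have := nrm_ge0 (b - a); have := nrm_ge0 (c - b); have := nrm_ge0 (a - c); lra.
have [h1|h1] := lerP (nrm (T a b c)) (4 * nrm (T a m1 m3)); first by exists a, m1, m3.
have [h2|h2] := lerP (nrm (T a b c)) (4 * nrm (T m1 b m2)); first by exists m1, b, m2.
have [h3|h3] := lerP (nrm (T a b c)) (4 * nrm (T m3 m2 c)); first by exists m3, m2, c.
have [h4|h4] := lerP (nrm (T a b c)) (4 * nrm (T m1 m2 m3)); first by exists m1, m2, m3.
have := nrmD (T a m1 m3 + T m1 b m2 + T m3 m2 c) (T m1 m2 m3).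
have := nrmD (T a m1 m3 + T m1 b m2) (T m3 m2 c); have := nrmD (T a m1 m3) (T m1 b m2).
by rewrite -TE; lra.
Qed.

(** The affine approximation of [f] at [l] has a primitive, so its integral around the triangle is 0
    and only the remainder counts. The first vertex is within 4 perimeters of [l], the others within
    5, the edges within 6; the factor 2 of [segint_bound] turns 6 into 12. *)
Let bound_near a b c l (e d : R) : K a -> K b -> K c -> K l -> 0 < e ->
  (forall h, nrm h < d -> nrm (f (l + h) - f l - 'd f l h) <= e * nrm h) ->
  nrm (a - l) <= 4 * per a b c -> 6 * per a b c < d ->
  nrm (T a b c) <= 12 * e * per a b c ^+ 2.
Proof.
move=> Ka Kb Kc Kl e0 hd al pd.
pose be := 'd f l 1; pose aff z := f l + be * (z - l).
pose A z := f l * z + be / 2 * (z - l) ^+ 2.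
have dA z : differentiable A z /\ 'd A z 1 = aff z.
  have [h1 h2] := diff1_quadratic (f l) (be / 2) l z; split=> //.
  by rewrite h2 /aff; field; rewrite ?pnatr_eq0.
have affint x y : segint aff x y = A y - A x by apply: segint_primitive.
have affc x y : seg_cont aff x y.
  move=> t _; apply: differentiable_continuous; rewrite /aff.
  have [+ _] := diff1_quadratic be 0 0 (x + (t%:C)%C * (y - x)).
  move=> h.
  have -> : (fun z => f l + be * (z - l)) =
    (cst (f l - be * l) + (fun w => be * w + 0 * (w - 0) ^+ 2) : Cx R -> Cx R).
    by apply/funext => z; rewrite -[RHS]/(_ + _) /cst; ring.
  by apply: differentiableD.
pose g z := f z + (-1) * aff z.
have n1 := nrm_ge0 (b - a); have n2 := nrm_ge0 (c - b); have n3 := nrm_ge0 (a - c).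
have bd x y : K x -> K y -> nrm (x - l) <= 5 * per a b c -> nrm (y - x) <= per a b c ->
    nrm (segint g x y) <= 2 * (e * (6 * per a b c) * nrm (y - x)).
  move=> Kx Ky xl yx; apply: segint_bound.
    move=> t t01; apply: continuousD; first exact: Ksc.
    by apply: continuousM; [exact: cst_continuous|exact: affc].
  move=> t /andP[t0 t1]; set z := x + _.
  have zl : nrm (z - l) <= 6 * per a b c.
    rewrite /z addrAC; apply: le_trans (nrmD _ _) _.
    rewrite nrmM nrmR ger0_norm //; have := nrm_ge0 (y - x); nra.
  have := hd (z - l) (le_lt_trans zl pd); rewrite subrKC => H.
  rewrite /g /aff [X in nrm X](_ : _ = f z - f l - 'd f l (z - l)).
    by apply: le_trans H _; rewrite ler_pM2l.
  rewrite -[X in 'd f l X]mulr1 -[(z - l) * 1]/((z - l) *: (1 : Cx R)) linearZ /=.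
  by rewrite -/be -[_ *: be]/(_ * be); ring.
have gE x y : K x -> K y -> segint g x y = segint f x y + (-1) * (A y - A x).
  by move=> Kx Ky; rewrite -affint; apply: segint_lin; [exact: Ksc|exact: affc].
have TE : T a b c = segint g a b + segint g b c + segint g c a.
  rewrite (gE _ _ Ka Kb) (gE _ _ Kb Kc) (gE _ _ Kc Ka) /T.
  move: (A a) (A b) (A c) (segint f a b) (segint f b c) (segint f c a).
  by move=> *; ring.
have al' : nrm (a - l) <= 5 * per a b c by rewrite /per in al *; lra.
have bl : nrm (b - l) <= 5 * per a b c.
  by have := nrm_tri b a l; rewrite /per in al *; lra.
have cl : nrm (c - l) <= 5 * per a b c.
  by have := nrm_tri c a l; rewrite (nrmC c a) /per in al *; lra.
have b1 := bd a b Ka Kb al' _; have b2 := bd b c Kb Kc bl _; have b3 := bd c a Kc Ka cl _.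
have B1 := b1 ltac:(rewrite /per; lra); have B2 := b2 ltac:(rewrite /per; lra).
have B3 := b3 ltac:(rewrite /per; lra).
rewrite TE; apply: le_trans (nrmD _ _) _.
have D := nrmD (segint g a b) (segint g b c).
have -> : 12 * e * per a b c ^+ 2 = 2 * (e * (6 * per a b c) * nrm (b - a)) +
  2 * (e * (6 * per a b c) * nrm (c - b)) + 2 * (e * (6 * per a b c) * nrm (a - c)).
  by rewrite expr2 mulrA -[X in _ * X = _]/(nrm (b - a) + nrm (c - b) + nrm (a - c)); ring.
move: B1 B2 B3; move: (per a b c) => p.
lra.
Qed.

Theorem goursat a b c : K a -> K b -> K c ->
  segint f a b + segint f b c + segint f c a = 0.
Proof.
move=> Ka Kb Kc; apply: nrm_eq0.
pose P (p : Cx R * Cx R * Cx R) := [/\ K p.1.1, K p.1.2 & K p.2].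
pose TT p := nrm (T p.1.1 p.1.2 p.2); pose pp p := per p.1.1 p.1.2 p.2.
have /choice[nx hnx] : forall p, exists q, P p ->
    [/\ P q, TT p <= 4 * TT q, pp q = pp p / 2 & nrm (q.1.1 - p.1.1) <= pp p].
  move=> [[x y] z].
  have [[/= Kx Ky Kz]|nP] := pselect (P (x, y, z)); last by exists (x, y, z) => /nP.
  have [x' [y' [z' [[? ? ?] ? ? ?]]]] := bisect Kx Ky Kz.
  by exists (x', y', z').
pose s n := iter n nx (a, b, c).
have Ps n : P (s n) by elim: n => [//|n IH]; have [] := hnx _ IH.
have ppn n : pp (s n) = per a b c / 2 ^+ n.
  elim: n => [|n IH]; first by rewrite expr0 divr1.
  by have [_ _ -> _] := hnx _ (Ps n); rewrite IH exprS invfM; ring.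
have TTn n : TT (s 0%N) <= 4 ^+ n * TT (s n).
  elim: n => [|n IH]; first by rewrite expr0 mul1r.
  have [_ h _ _] := hnx _ (Ps n); apply: le_trans IH _.
  by rewrite exprSr -mulrA ler_wpM2l // exprn_ge0.
have sS n : nrm ((s n.+1).1.1 - (s n).1.1) <= per a b c / 2 ^+ n.
  by have [_ _ _ h] := hnx _ (Ps n); rewrite -ppn.
have [l hl] := complex_geometric_cauchy sS.
have Kl : K l.
  apply: Kclosed => e e0; have [n hn] := @small_half_pow R (4 * per a b c) e e0.
  by exists (s n).1.1; [have [] := Ps n|apply: le_lt_trans (hl n) hn].
have bnd e : 0 < e -> TT (s 0%N) <= 12 * e * per a b c ^+ 2.
  move=> e0; have [d d0 hd] := diff_nrm (fK Kl) e0.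
  have [n hn] := @small_half_pow R (6 * per a b c) d d0.
  have [K1 K2 K3] := Ps n.
  have h1 : nrm ((s n).1.1 - l) <= 4 * pp (s n) by rewrite ppn mulrA.
  have h2 : 6 * pp (s n) < d by rewrite ppn mulrA.
  have h : TT (s n) <= 12 * e * pp (s n) ^+ 2 := bound_near K1 K2 K3 Kl e0 hd h1 h2.
  apply: le_trans (TTn n) _.
  apply: le_trans (ler_wpM2l (exprn_ge0 _ (ler0n _ _)) h) _.
  (* The factor [4 ^+ n] lost in the bisections cancels against the square of the perimeter, which
     was halved [n] times. *)
  have -> : 4 ^+ n * (12 * e * pp (s n) ^+ 2) = 12 * e * per a b c ^+ 2; last by [].
  rewrite ppn (_ : 4 = 2 ^+ 2 :> R); last by ring.
  rewrite -exprM mulnC exprM; field.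
  by rewrite expf_neq0 // pnatr_eq0.
have -> : segint f a b + segint f b c + segint f c a = T a b c by [].
rewrite -/(TT (s 0%N)); apply/le_anti; rewrite nrm_ge0 andbT.
have p0 := sqr_ge0 (per a b c).
apply/ler_addgt0Pl => e e0; rewrite addr0.
have e1 : 0 < e / (12 * (per a b c ^+ 2 + 1)) by rewrite divr_gt0 //; nra.
apply: le_trans (bnd _ e1) _.
have p1 : 0 < per a b c ^+ 2 + 1 by lra.
have -> : 12 * (e / (12 * (per a b c ^+ 2 + 1))) * per a b c ^+ 2 =
    e * (per a b c ^+ 2 / (per a b c ^+ 2 + 1)).
  by field; rewrite gt_eqF.
by rewrite ler_piMr ?(ltW e0) // ler_pdivrMr //; lra.
Qed.

End Goursat.

(** * Cauchy's estimate for the first derivative, on squares *)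

Section CauchyEstimate.
Variable R : realType.
Implicit Types (f k : Cx R -> Cx R) (a z : Cx R) (s r t M : R).
Local Notation I := (Ci R).

Let Inrm : nrm I = 1.
Proof.
by apply/eqP; rewrite -(@eqrXn2 _ 2) ?nrm_ge0 // nrm_sqr /= expr0n add0r.
Qed.

(* A quadrilateral between two similar edges of the square with vertices i^k a. *)
Let sector a s : set (Cx R) := [set z | let w := z / a in
  [/\ 0 <= complex.Re w, 0 <= complex.Im w,
      s <= complex.Re w + complex.Im w & complex.Re w + complex.Im w <= 1]].

Let sector_conv a s x y t : sector a s x -> sector a s y -> 0 <= t <= 1 ->
  sector a s (x + (t%:C)%C * (y - x)).
Proof.
rewrite /sector /= mulrDl -mulrA (mulrDl y) mulNr.
case: (x / a) (y / a) => x1 x2 [y1 y2] /= [? ? ? ?] [? ? ? ?] /andP[t0 t1].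
by rewrite !mul0r !subr0 !addr0; split; nra.
Qed.

Let sector_closed a s z : a != 0 ->
  (forall e : R, 0 < e -> exists2 w, sector a s w & nrm (w - z) < e) -> sector a s z.
Proof.
move=> a0 hz; have na := nrm_gt0 a0.
(* Each condition defining the sector is a half-plane with coefficients of absolute value at most 1;
   it suffices to pass to the limit in one such inequality. *)
have key (al be c : R) : `|al| <= 1 -> `|be| <= 1 ->
    (forall w, sector a s w -> 0 <= al * complex.Re (w / a) + be * complex.Im (w / a) + c) ->
    0 <= al * complex.Re (z / a) + be * complex.Im (z / a) + c.
  move=> hal hbe H; rewrite leNgt; apply/negP => neg.
  have [|w /H {}H hw] := hz (- (al * complex.Re (z / a) + be * complex.Im (z / a) + c) * nrm a / 2).
    by rewrite divr_gt0 // mulr_gt0 // oppr_gt0.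
  have h2 : nrm ((w - z) / a) < - (al * complex.Re (z / a) + be * complex.Im (z / a) + c) / 2.
    by rewrite nrmM nrmV ltr_pdivrMr // mulrAC.
  have h3 := le_lt_trans (le_Re ((w - z) / a)) h2.
  have h4 := le_lt_trans (le_Im ((w - z) / a)) h2.
  move: h3 h4 {h2 hw}; rewrite mulrBl !raddfB /=.
  move: H neg; move: (complex.Re (w / a)) (complex.Im (w / a)) (complex.Re (z / a)) (complex.Im (z / a)).
  move=> w1 w2 z1 z2 H neg h3 h4.
  have h5 : `|al * (w1 - z1)| < - (al * z1 + be * z2 + c) / 2.
    by rewrite normrM; apply: le_lt_trans h3; rewrite ler_piMl.
  have h6 : `|be * (w2 - z2)| < - (al * z1 + be * z2 + c) / 2.
    by rewrite normrM; apply: le_lt_trans h4; rewrite ler_piMl.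
  by have := le_lt_trans (ler_norm _) h5; have := le_lt_trans (ler_norm _) h6; lra.
have n1 : `|1 : R| <= 1 by rewrite normr1.
have n0 : `|0 : R| <= 1 by rewrite normr0.
have n2 : `|-1 : R| <= 1 by rewrite normrN1.
split.
- have := key 1 0 0 n1 n0; rewrite mul1r mul0r !addr0; apply=> w [? ? ? ?].
  by rewrite mul1r mul0r !addr0.
- have := key 0 1 0 n0 n1; rewrite mul1r mul0r addr0 add0r; apply=> w [? ? ? ?].
  by rewrite mul1r mul0r addr0 add0r.
- rewrite -subr_ge0; have := key 1 1 (- s) n1 n1; rewrite !mul1r; apply=> w [? ? ? ?].
  by rewrite !mul1r subr_ge0.
- rewrite -subr_ge0; have := key (-1) (-1) 1 n2 n2; rewrite !mulN1r addrC -opprD; apply=> w [? ? ? ?].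
  by rewrite !mulN1r addrC -opprD subr_ge0.
Qed.

Let sector_nrm a s z : a != 0 -> 0 < s -> sector a s z -> z != 0 /\ nrm z <= nrm a.
Proof.
move=> a0 s0 [h1 h2 h3 h4]; split.
  by apply: contraTneq h3 => ->; rewrite mul0r /= addr0 leNgt s0.
rewrite -[z](divfK a0) nrmM ler_piMl ?nrm_ge0 //.
by apply: le_trans (nrm_le _) _; rewrite !ger0_norm.
Qed.

Let sector_pt a s (x y : R) : a != 0 -> 0 <= x -> 0 <= y -> s <= x + y -> x + y <= 1 ->
  sector a s ((x +i* y)%C * a).
Proof. by move=> a0 ? ? ? ?; rewrite /sector /= mulfK. Qed.

(** A diagonal divides the quadrilateral between the two edges into two triangles inside the sector,
    which avoids 0; Goursat's theorem applies to both. *)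
Let annulus k a s : a != 0 -> 0 < s -> s <= 1 ->
  (forall z, z != 0 -> nrm z <= nrm a -> differentiable k z) ->
  segint k a (I * a) - segint k ((s%:C)%C * a) (I * ((s%:C)%C * a)) =
  segint k a ((s%:C)%C * a) - segint k (I * a) (I * ((s%:C)%C * a)).
Proof.
move=> a0 s0 s1 dk.
have cK z : sector a s z -> differentiable k z.
  by move=> /(sector_nrm a0 s0)[]; exact: dk.
have cv := @sector_conv a s.
have cl z := @sector_closed a s z a0.
have scont x y : sector a s x -> sector a s y -> seg_cont k x y.
  by move=> Kx Ky t t01; apply/differentiable_continuous/cK/cv.
have K1 : sector a s a by have := @sector_pt a s 1 0 a0; rewrite mul1r; apply; lra.
have K2 : sector a s (I * a) by apply: sector_pt => //; lra.
have K3 : sector a s ((s%:C)%C * a) by apply: sector_pt => //; lra.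
have K4 : sector a s (I * ((s%:C)%C * a)).
  rewrite mulrA (_ : I * _ = (0 +i* s)%C); first by apply: sector_pt => //; lra.
  by rewrite /Ci; apply/eqP; rewrite eq_complex /=; apply/andP; split; apply/eqP; ring.
have g1 := goursat cv cl cK K1 K2 K4; have g2 := goursat cv cl cK K1 K4 K3.
move: g1 g2; rewrite (segint_opp (scont _ _ K1 K4)) (segint_opp (scont _ _ K3 K4)).
rewrite (segint_opp (scont _ _ K1 K3)).
set A := segint k a (I * a); set B := segint k (I * a) _; set C := segint k a (I * _).
set D := segint k ((s%:C)%C * a) _; set E := segint k a _ => g1 g2.
transitivity ((A + B - C) + (C - D - E) + (E - B)); first by ring.
by rewrite g1 g2 add0r add0r.
Qed.

Let contour k a : Cx R := segint k a (I * a) + segint k (I * a) (I * (I * a)) +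
  segint k (I * (I * a)) (I * (I * (I * a))) + segint k (I * (I * (I * a))) a.

Let I4 a : I * (I * (I * (I * a))) = a.
Proof.
transitivity ((I ^+ 2) ^+ 2 * a); first by ring.
by rewrite /Ci sqr_i; ring.
Qed.

(** Summed over the four quarter turns, the radial integrals on the right of [annulus] telescope,
    because [I] to the fourth power is 1. *)
Let contour_scale k a s : a != 0 -> 0 < s -> s <= 1 ->
  (forall z, z != 0 -> nrm z <= nrm a -> differentiable k z) ->
  contour k a = contour k ((s%:C)%C * a).
Proof.
move=> a0 s0 s1 dk.
have I0 : I != 0 by apply/eqP => h; have := Inrm; rewrite h nrm0 => /eqP; rewrite eq_sym oner_eq0.
have b0 : I * a != 0 by rewrite mulf_neq0.
have c0 : I * (I * a) != 0 by rewrite mulf_neq0.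
have d0 : I * (I * (I * a)) != 0 by rewrite mulf_neq0.
have nb : nrm (I * a) = nrm a by rewrite nrmM Inrm mul1r.
have nc : nrm (I * (I * a)) = nrm a by rewrite nrmM Inrm mul1r.
have nd : nrm (I * (I * (I * a))) = nrm a by rewrite nrmM Inrm mul1r.
have h1 := annulus a0 s0 s1 dk.
have h2 : _ := annulus b0 s0 s1; rewrite nb in h2; have {}h2 := h2 k dk.
have h3 : _ := annulus c0 s0 s1; rewrite nc in h3; have {}h3 := h3 k dk.
have h4 : _ := annulus d0 s0 s1; rewrite nd in h4; have {}h4 := h4 k dk.
have sI z : (s%:C)%C * (I * z) = I * ((s%:C)%C * z) by rewrite mulrCA.
move: h1 h2 h3 h4; rewrite !sI !I4 /contour.
set A1 := segint _ _ _; set B1 := segint _ _ _; set E1 := segint _ _ _.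
set E2 := segint _ _ _; set A2 := segint _ _ _; set B2 := segint _ _ _.
set E3 := segint _ _ _; set A3 := segint _ _ _; set B3 := segint _ _ _.
set E4 := segint _ _ _; set A4 := segint _ _ _; set B4 := segint _ _ _.
move=> h1 h2 h3 h4; apply/eqP; rewrite -subr_eq0; apply/eqP.
transitivity ((A1 - B1) + (A2 - B2) + (A3 - B3) + (A4 - B4)); first by ring.
by rewrite h1 h2 h3 h4; ring.
Qed.

Let edge_nrm a t : 0 <= t <= 1 ->
  nrm a / 2 <= nrm (a + (t%:C)%C * (I * a - a)) /\
  nrm (a + (t%:C)%C * (I * a - a)) <= nrm a.
Proof.
move=> /andP[t0 t1].
have -> : a + (t%:C)%C * (I * a - a) = ((1 - t) +i* t)%C * a.
  have -> : ((1 - t) +i* t)%C = 1 + (t%:C)%C * (I - 1).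
    by apply/eqP; rewrite eq_complex /=; apply/andP; split; apply/eqP; ring.
  by ring.
have na := nrm_ge0 a; rewrite nrmM; split.
  have : 1 <= 2 * nrm (((1 - t) +i* t)%C : Cx R); last by nra.
  have /= := le_Re (((1 - t) +i* t)%C : Cx R); have /= := le_Im (((1 - t) +i* t)%C : Cx R).
  by rewrite !ger0_norm; lra.
have /= h := nrm_le (((1 - t) +i* t)%C : Cx R); apply: ler_piMl => //.
by apply: le_trans h _; rewrite !ger0_norm; lra.
Qed.

(** The constant 4 is the factor 2 of [segint_bound] times the bound [2 * nrm a] for the length of
    an edge; [edge_nrm] keeps the edge in the ring where [k] is bounded. *)
Let edge_bound k a M : 0 < nrm a ->
  (forall z, nrm a / 2 <= nrm z -> nrm z <= nrm a -> {for z, continuous k} /\ nrm (k z) <= M) ->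
  nrm (segint k a (I * a)) <= 4 * M * nrm a.
Proof.
move=> a0 hk; have cs : seg_cont k a (I * a).
  by move=> t /(edge_nrm a)[h1 h2]; have [] := hk _ h1 h2.
have M0 : 0 <= M.
  have aa : nrm a / 2 <= nrm a by lra.
  by have [_ h] := hk a aa (lexx _); apply: le_trans h; exact: nrm_ge0.
have := @segint_bound R k a (I * a) M cs.
move=> H; apply: le_trans (H _) _.
  by move=> t /(edge_nrm a)[h1 h2]; have [] := hk _ h1 h2.
have : nrm (I * a - a) <= 2 * nrm a.
  by apply: le_trans (nrmB _ _) _; rewrite nrmM Inrm; lra.
by move: (nrm (I * a - a)) => u hu; nra.
Qed.

Let contour_bound k a M : 0 < nrm a ->
  (forall z, nrm a / 2 <= nrm z -> nrm z <= nrm a -> {for z, continuous k} /\ nrm (k z) <= M) ->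
  nrm (contour k a) <= 16 * M * nrm a.
Proof.
move=> a0 hk.
have nb : nrm (I * a) = nrm a by rewrite nrmM Inrm mul1r.
have nc : nrm (I * (I * a)) = nrm a by rewrite nrmM Inrm mul1r.
have nd : nrm (I * (I * (I * a))) = nrm a by rewrite nrmM Inrm mul1r.
have h1 := @edge_bound k a M a0 hk.
have h2 := @edge_bound k (I * a) M; rewrite nb in h2; have {}h2 := h2 a0 hk.
have h3 := @edge_bound k (I * (I * a)) M; rewrite nc in h3; have {}h3 := h3 a0 hk.
have h4 := @edge_bound k (I * (I * (I * a))) M; rewrite nd I4 in h4; have {}h4 := h4 a0 hk.
rewrite /contour; apply: le_trans (nrmD _ _) _.
apply: le_trans (lerD (le_trans (nrmD _ _) (lerD (nrmD _ _) (lexx _))) (lexx _)) _.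
lra.
Qed.

(** At parameter [t] the integrand is [I - 1] divided by (1 - t) + i t, with imaginary part the
    inverse of (1 - t)^2 + t^2, hence at least 1. Four edges give 4, which is enough in place of the
    exact 2 pi. *)
Let inv_edge a : a != 0 -> 1 <= complex.Im (segint (fun z => z^-1) a (I * a)).
Proof.
move=> a0; have na := nrm_gt0 a0.
have z0 t : 0 <= t <= 1 -> a + (t%:C)%C * (I * a - a) != 0.
  move=> /(edge_nrm a)[h _]; apply/eqP => z0; move: h; rewrite z0 nrm0; lra.
have [|G hG ->] := @is_segint_ex R (fun z => z^-1) a (I * a).
  by move=> t t01; apply/differentiable_continuous/differentiableV => //; exact: z0.
apply: cder_Im_ge hG _ => t t01; have := z0 t t01.
set w := a + _ => w0; set q := _ * _.
have qE : q * ((1 - t) +i* t)%C = I - 1.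
  have wE : w = ((1 - t) +i* t)%C * a.
    have -> : ((1 - t) +i* t)%C = 1 + (t%:C)%C * (I - 1).
      by apply/eqP; rewrite eq_complex /=; apply/andP; split; apply/eqP; ring.
    by rewrite /w; ring.
  have : q * w = (I - 1) * a by rewrite /q divfK //; ring.
  by rewrite wE mulrA => /(mulIf a0).
move: qE t01; case: q => u v /eqP; rewrite eq_complex /= => /andP[/eqP h1 /eqP h2] /andP[t0 t1].
have h3 : v * ((1 - t) ^+ 2 + t ^+ 2) = 1.
  transitivity ((1 - t) * (u * t + v * (1 - t)) - t * (u * (1 - t) - v * t)); first by ring.
  by rewrite h1 h2; ring.
have h4 : (1 - t) ^+ 2 + t ^+ 2 <= 1 by nra.
have h5 : 0 < (1 - t) ^+ 2 + t ^+ 2 by nra.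
have v0 : 0 <= v by rewrite leNgt; apply/negP => v0; nra.
by rewrite -h3 ler_piMr.
Qed.

Let contour_inv a : a != 0 -> 4 <= nrm (contour (fun z => z^-1) a).
Proof.
move=> a0.
have I0 : I != 0 by apply/eqP => h; have := Inrm; rewrite h nrm0 => /eqP; rewrite eq_sym oner_eq0.
have h1 := inv_edge a0.
have b0 : I * a != 0 by rewrite mulf_neq0.
have c0 : I * (I * a) != 0 by rewrite mulf_neq0.
have d0 : I * (I * (I * a)) != 0 by rewrite mulf_neq0.
have h2 := inv_edge b0; have h3 := inv_edge c0; have := inv_edge d0; rewrite I4 => h4.
apply: le_trans (le_Im _); apply: le_trans (ler_norm _).
by rewrite /contour !raddfD /=; lra.
Qed.

(** Put k(z) = (f(z) - f(0) - f'(0) z) / z^2. It is o(1/z), so its integral over small squares tends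
    to 0; this integral does not depend on the size of the square, so it vanishes. Hence f'(0) times
    the integral of 1/z, of modulus at least 4, equals the integral of (f(z) - f(0)) / z^2, at most
    256 M / r on the square of half-diagonal r/2. *)
Theorem cauchy_estimate f r M : 0 < r ->
  (forall z, nrm z < r -> differentiable f z) ->
  (forall z, nrm z < r -> nrm (f z) <= M) ->
  nrm ('d f 0 1) <= 64 * M / r.
Proof.
move=> r0 df fM; set f1 := 'd f 0 1.
have nz0 : nrm (0 : Cx R) < r by rewrite nrm0.
have M0 : 0 <= M by apply: le_trans (fM 0 nz0); exact: nrm_ge0.
pose a : Cx R := ((r / 2)%:C)%C.
have na : nrm a = r / 2 by rewrite /a nrmR ger0_norm //; lra.
have na0 : 0 < nrm a by rewrite na; lra.
have a0 : a != 0 by apply/eqP => h; move: na0; rewrite h nrm0 ltxx.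
pose g z := (f z - f 0) / z ^+ 2.
pose k z := g z + (- f1) * z^-1.
have dinv z : z != 0 -> differentiable (fun z : Cx R => z^-1) z.
  by move=> z0; exact: (differentiableV (f := id)).
have dg z : z != 0 -> nrm z < r -> differentiable g z.
  move=> z0 zr; apply: differentiableM; first by apply: differentiableB => //; exact: df.
  apply: differentiableV; last by rewrite expf_neq0.
  by apply: (@differentiableM _ _ (id : Cx R -> Cx R) id z); exact: ex_diff.
have dk z : z != 0 -> nrm z <= nrm a -> differentiable k z.
  rewrite na => z0 zr; apply: differentiableD; first by apply: dg => //; lra.
  exact: (differentiableM (differentiable_cst _ _) (dinv z z0)).
have kc : contour k a = 0.
  apply: nrm_eq0; apply/le_anti; rewrite nrm_ge0 andbT.
  apply/ler_addgt0Pl => e e0; rewrite addr0.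
  have e1 : 0 < e / 64 by lra.
  have [d d0 hd] := diff_nrm (df 0 nz0) e1.
  (* The shrunken square then has half-diagonal [s * (r / 2)], at most [d / 2], so it lies where the
     first-order remainder of [f] is controlled. *)
  pose s := Num.min 1 (d / r).
  have s0 : 0 < s by rewrite lt_min ltr01 divr_gt0.
  have s1 : s <= 1 by rewrite ge_min lexx.
  pose b : Cx R := (s%:C)%C * a.
  rewrite (contour_scale a0 s0 s1 dk) -/b.
  have sr : s * r <= d by rewrite -ler_pdivlMr // ge_min lexx orbT.
  have nsa : nrm b = s * (r / 2) by rewrite /b nrmM nrmR na ger0_norm // ltW.
  have nsa0 : 0 < nrm b by rewrite nsa mulr_gt0 //; lra.
  apply: le_trans (@contour_bound k _ (e / 32 / nrm b) nsa0 _) _; last first.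
    by rewrite -mulrA divfK ?gt_eqF //; lra.
  move=> z z1 z2; have z0 : z != 0.
    by apply/eqP => h; move: z1; rewrite h nrm0; lra.
  split.
    apply: differentiable_continuous; apply: dk => //.
    by rewrite na; rewrite nsa in z2; nra.
  have nz := nrm_gt0 z0.
  have -> : k z = (f (0 + z) - f 0 - 'd f 0 z) / z ^+ 2.
    rewrite add0r -[X in 'd f 0 X]mulr1 -[z * 1]/(z *: (1 : Cx R)) linearZ /= -/f1.
    by rewrite /k /g -[_ *: f1]/(_ * f1); field.
  rewrite nrmM nrmV nrmX.
  have zd : nrm z < d by rewrite nsa in z2; nra.
  rewrite ler_pdivrMr ?exprn_gt0 //; apply: le_trans (hd z zd) _.
  rewrite expr2 mulrA ler_pM2r //.
  by rewrite mulrAC ler_pdivlMr //; nra.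
have sE : contour k a = contour g a + (- f1) * contour (fun z => z^-1) a.
  have scg x t : x != 0 -> nrm x = nrm a -> 0 <= t <= 1 ->
      let z := x + (t%:C)%C * (I * x - x) in z != 0 /\ nrm z < r.
    move=> x0 xa /(edge_nrm x)[h1 h2] z; split; last by apply: le_lt_trans h2 _; lra.
    by apply/eqP => h; move: h1; rewrite -/z h nrm0 xa; lra.
  have lin x : x != 0 -> nrm x = nrm a -> segint k x (I * x) =
      segint g x (I * x) + (- f1) * segint (fun z => z^-1) x (I * x).
    move=> x0 xa; apply: segint_lin => t t01; have [z0 zr] := scg x t x0 xa t01;
      apply: differentiable_continuous; [exact: dg|exact: dinv].
  have I0 : I != 0 by apply/eqP => h; have := Inrm; rewrite h nrm0 => /eqP; rewrite eq_sym oner_eq0.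
  have nb : nrm (I * a) = nrm a by rewrite nrmM Inrm mul1r.
  have nc : nrm (I * (I * a)) = nrm a by rewrite nrmM Inrm mul1r.
  have nd : nrm (I * (I * (I * a))) = nrm a by rewrite nrmM Inrm mul1r.
  have b0 : I * a != 0 by rewrite mulf_neq0.
  have c0 : I * (I * a) != 0 by rewrite mulf_neq0.
  have d0 : I * (I * (I * a)) != 0 by rewrite mulf_neq0.
  have l1 := lin _ a0 erefl; have l2 := lin _ b0 nb; have l3 := lin _ c0 nc.
  have := lin _ d0 nd; rewrite I4 => l4.
  by rewrite /contour l1 l2 l3 l4; ring.
have gb : nrm (contour g a) <= 16 * (2 * M / (nrm a / 2) ^+ 2) * nrm a.
  apply: contour_bound => // z z1 z2.
  have z0 : z != 0 by apply/eqP => h; move: z1; rewrite h nrm0; lra.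
  have zr : nrm z < r by lra.
  split; first exact/differentiable_continuous/dg.
  have nz := nrm_gt0 z0.
  rewrite /g nrmM nrmV nrmX; apply: ler_pM; rewrite ?nrm_ge0 ?invr_ge0 ?exprn_ge0 ?(ltW nz) //.
    by apply: le_trans (nrmB _ _) _; have := fM z zr; have := fM 0 nz0; lra.
  rewrite lef_pV2 ?posrE ?exprn_gt0 //; last by lra.
  by rewrite lerXn2r ?nnegrE // ?(ltW nz); lra.
have H : f1 * contour (fun z => z^-1) a = contour g a.
  by apply/eqP; rewrite -subr_eq0 -oppr_eq0 opprB; apply/eqP; rewrite -kc sE; ring.
have : nrm f1 * 4 <= 16 * (2 * M / (nrm a / 2) ^+ 2) * nrm a.
  apply: le_trans gb; rewrite -H nrmM ler_wpM2l ?nrm_ge0 //; exact: contour_inv.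
rewrite na => h.
have E : 16 * (2 * M / (r / 2 / 2) ^+ 2) * (r / 2) = 4 * (64 * M / r).
  by field; rewrite gt_eqF.
by rewrite E in h; lra.
Qed.

End CauchyEstimate.

(** * Holomorphic functions of several variables *)

HB.lock Definition dv (R : realType) (V W : normedModType (Cx R)) (f : V -> W) (x h : V) : W :=
  'd f x h.

Section SeveralVariables.
Variables (R : realType) (V : normedModType (Cx R)).
Implicit Types (f g : V -> Cx R) (p x y v h : V) (r M : R).

Lemma dvE f x h : dv f x h = 'd f x h. Proof. by rewrite dv.unlock. Qed.

Lemma dv_lin f x (a : Cx R) h k : dv f x (a *: h + k) = a * dv f x h + dv f x k.
Proof. by rewrite !dvE linearP. Qed.

Lemma dv0 f x : dv f x 0 = 0. Proof. by rewrite dvE linear0. Qed.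

Lemma dvZr f x (a : Cx R) h : dv f x (a *: h) = a * dv f x h.
Proof. by rewrite -[a *: h]addr0 dv_lin dv0 addr0. Qed.

Lemma dvDr f x h k : dv f x (h + k) = dv f x h + dv f x k.
Proof. by rewrite -[h]scale1r dv_lin mul1r scale1r. Qed.

Lemma dvNr f x h : dv f x (- h) = - dv f x h.
Proof. by rewrite -scaleN1r dvZr mulN1r. Qed.

Lemma dvBr f x h k : dv f x (h - k) = dv f x h - dv f x k.
Proof. by rewrite dvDr dvNr. Qed.

Lemma dvD f g x h : differentiable f x -> differentiable g x ->
  dv (fun z => f z + g z) x h = dv f x h + dv g x h.
Proof.
move=> df dg; have e : (fun z => f z + g z) = f + g by [].
rewrite !dvE; have -> : 'd f x h + 'd g x h = ('d f x \+ 'd g x) h by [].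
by rewrite e -(diffD df dg); reflexivity.
Qed.

Lemma dvB f g x h : differentiable f x -> differentiable g x ->
  dv (fun z => f z - g z) x h = dv f x h - dv g x h.
Proof.
move=> df dg; have e : (fun z => f z - g z) = f - g by [].
rewrite !dvE; have -> : 'd f x h - 'd g x h = ('d f x \- 'd g x) h by [].
by rewrite e -(diffB df dg); reflexivity.
Qed.

Lemma dvM f g x h : differentiable f x -> differentiable g x ->
  dv (fun z => f z * g z) x h = f x * dv g x h + g x * dv f x h.
Proof.
move=> df dg; have e : (fun z => f z * g z) = f * g by [].
rewrite !dvE.
have -> : f x * 'd g x h + g x * 'd f x h = (f x \*: 'd g x + g x \*: 'd f x) h by [].
by rewrite e -(diffM df dg); reflexivity.
Qed.

Lemma dv_scale (c : Cx R) f x h : differentiable f x ->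
  dv (fun z => c * f z) x h = c * dv f x h.
Proof.
move=> df; have e : (fun z => c * f z) = c *: f by [].
rewrite !dvE; have -> : c * 'd f x h = (c \*: 'd f x) h by [].
by rewrite e -(diffZ c df); reflexivity.
Qed.

Lemma dvP f p : differentiable f p ->
  forall e : R, 0 < e -> exists2 d : R, 0 < d & forall h, nrm h < d ->
    nrm (f (p + h) - f p - dv f p h) <= e * nrm h.
Proof.
move=> /diff_nrm df e /df[d d0 hd]; exists d => // h; rewrite dvE; exact: hd.
Qed.

Lemma dv_ex f (L : V -> Cx R) p (c : R) :
  linear L -> (forall h, nrm (L h) <= c * nrm h) ->
  (forall e : R, 0 < e -> exists2 d : R, 0 < d & forall h, nrm h < d ->
    nrm (f (p + h) - f p - L h) <= e * nrm h) ->
  differentiable f p /\ forall h, dv f p h = L h.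
Proof.
move=> h1 h2 h3; have [h4 h5] := nrm_diff_fun h1 h2 h3; split => // h.
by rewrite dvE h5.
Qed.

Lemma dv_bounded f p : differentiable f p ->
  exists2 k : R, 0 < k & forall h, nrm (dv f p h) <= k * nrm h.
Proof. by move=> /diff_bound[k k0 hk]; exists k => // h; rewrite dvE. Qed.

Definition hol_on f p r := forall x, nrm (x - p) < r -> differentiable f x.

Lemma diff_line f p v (z : Cx R) : differentiable f (p + z *: v) ->
  differentiable (fun w : Cx R => f (p + w *: v)) z /\
  'd (fun w : Cx R => f (p + w *: v)) z 1 = dv f (p + z *: v) v.
Proof.
move=> df; apply: nrm_diff1 => e e0; have v0 := nrm_ge0 v.
have v1 : 0 < nrm v + 1 by lra.
have e2 : 0 < e / (nrm v + 1) by rewrite divr_gt0.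
have [d d0 hd] := dvP df e2.
exists (d / (nrm v + 1)); first by rewrite divr_gt0.
move=> h; rewrite ltr_pdivlMr // => hh; have h0 := nrm_ge0 h.
have kh : nrm (h *: v) <= nrm h * (nrm v + 1) by rewrite nrmZ ler_wpM2l //; lra.
have := hd _ (le_lt_trans kh hh).
rewrite scalerDl addrA dvZr => /le_trans; apply.
apply: le_trans (_ : e / (nrm v + 1) * (nrm h * (nrm v + 1)) <= _).
  by rewrite ler_wpM2l // ltW.
by rewrite mulrCA divfK ?gt_eqF // mulrC.
Qed.

(** Restriction to the complex line through [p] in direction [v], on which the disc has radius
    [r / nrm v]. *)
Lemma cauchy_bound f p r M v : 0 < r -> hol_on f p r ->
  (forall x, nrm (x - p) < r -> nrm (f x) <= M) ->
  nrm (dv f p v) <= 64 * M * nrm v / r.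
Proof.
move=> r0 hf fM.
have [->|v0] := eqVneq v 0; first by rewrite dv0 !nrm0 mulr0 mul0r.
have nv := nrm_gt0 v0.
have inb (z : Cx R) : nrm z < r / nrm v -> nrm (p + z *: v - p) < r.
  by rewrite addrAC subrr add0r nrmZ ltr_pdivlMr.
have h0 : differentiable f (p + 0 *: v).
  by rewrite scale0r addr0; apply: hf; rewrite subrr nrm0.
have [_] := diff_line h0; rewrite scale0r addr0 => <-.
have -> : 64 * M * nrm v / r = 64 * M / (r / nrm v) by field; rewrite !gt_eqF.
apply: cauchy_estimate; first exact: divr_gt0.
  by move=> z zr; have [] := diff_line (hf _ (inb z zr)).
by move=> z zr; apply/fM/inb.
Qed.

Lemma mean_value f x v (K : R) :
  (forall t : R, 0 <= t <= 1 -> let z := x + (t%:C)%C *: v in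
    differentiable f z /\ nrm (dv f z v) <= K) ->
  nrm (f (x + v) - f x) <= 2 * K.
Proof.
move=> H.
have h1 t : 0 <= t <= 1 -> cder (fun s => f (x + (s%:C)%C *: v)) t (dv f (x + (t%:C)%C *: v) v).
  by move=> /H[d _]; rewrite dvE; apply: cder_path.
have := @cder_mvi R _ _ K h1; rewrite scale1r scale0r addr0; apply.
by move=> t /H[].
Qed.

Lemma seg_near x y p t r : nrm (x - p) < r -> nrm (y - p) < r -> 0 <= t <= 1 ->
  nrm (x + (t%:C)%C *: (y - x) - p) < r.
Proof.
move=> xr yr /andP[t0 t1].
have -> : x + (t%:C)%C *: (y - x) - p = ((1 - t)%:C)%C *: (x - p) + (t%:C)%C *: (y - p).
  rewrite rmorphB /= rmorph1 scalerBl scale1r.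
  have -> : y - x = (y - p) - (x - p) by rewrite opprB addrA subrK.
  rewrite scalerBr addrAC.
  by move: (_ *: (y - p)) (_ *: (x - p)) => u v; rewrite (addrC u) addrA.
apply: le_lt_trans (nrmD _ _) _; rewrite !nrmZ !nrmR !ger0_norm; try lra.
have [->|tn] := eqVneq t 0; first by lra.
have {tn} : 0 < t by rewrite lt_neqAle eq_sym tn t0.
by nra.
Qed.

(** Every point of the half ball is the centre of a ball of radius [r / 2] on which [M] still bounds
    [f]; 256 is 64 from Cauchy, 2 from the halved radius and 2 from the mean value inequality. *)
Lemma lipschitz_half f p r M x y : 0 < r -> hol_on f p r ->
  (forall x, nrm (x - p) < r -> nrm (f x) <= M) ->
  nrm (x - p) < r / 2 -> nrm (y - p) < r / 2 ->
  nrm (f y - f x) <= 256 * M / r * nrm (y - x).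
Proof.
move=> r0 hf fM xr yr.
have r2 : 0 < r / 2 by lra.
have -> : 256 * M / r * nrm (y - x) = 2 * (64 * M * nrm (y - x) / (r / 2)).
  by field; rewrite gt_eqF.
rewrite -{1}(subrKC x y); apply: mean_value => t t01 z.
have zr : nrm (z - p) < r / 2 by exact: seg_near.
have zb w : nrm (w - z) < r / 2 -> nrm (w - p) < r.
  by have := nrm_tri w z p; lra.
split; first by apply: hf; lra.
apply: cauchy_bound => // [w /zb|w /zb]; [exact: hf|exact: fM].
Qed.

Lemma hol_shift f w x : differentiable f (x + w) ->
  differentiable (fun z => f (z + w)) x /\ forall h, dv (fun z => f (z + w)) x h = dv f (x + w) h.
Proof.
move=> df; have [c c0 hc] := dv_bounded df.
apply: dv_ex hc _; first exact: dv_lin.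
move=> e e0; have [d d0 hd] := dvP df e0; exists d => // h /hd.
by rewrite (addrAC x w h).
Qed.

(** Cauchy's bound is applied, on balls of radius [r / 4], to the difference of [f] and its
    translate by [y - x], which [lipschitz_half] makes small. Thus the differential is Lipschitz
    before any second derivative is available. *)
Lemma diff_lipschitz f p r M x y v : 0 < r -> hol_on f p r ->
  (forall x, nrm (x - p) < r -> nrm (f x) <= M) ->
  nrm (x - p) < r / 4 -> nrm (y - p) < r / 4 ->
  nrm (dv f y v - dv f x v) <= 256 ^+ 2 * M / r ^+ 2 * nrm v * nrm (y - x).
Proof.
move=> r0 hf fM xr yr.
pose w := y - x; pose q z := f (z + w) - f z.
have r4 : 0 < r / 4 by lra.
have r2r : r / 2 < r by lra.
have in1 z : nrm (z - x) < r / 4 -> nrm (z - p) < r / 2.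
  by have := nrm_tri z x p; lra.
have in2 z : nrm (z - x) < r / 4 -> nrm (z + w - p) < r / 2.
  have -> : z + w - p = (z - x) + (y - p) by rewrite /w (addrC y) (addrA z) -(addrA _ y).
  by have := nrmD (z - x) (y - p); lra.
have dq z : nrm (z - x) < r / 4 -> differentiable q z /\
    forall h, dv q z h = dv f (z + w) h - dv f z h.
  move=> zx; have d1 : differentiable f z by apply: hf; exact: lt_trans (in1 z zx) r2r.
  have [d2 d3] : _ := @hol_shift f w z (hf _ (lt_trans (in2 z zx) r2r)).
  split; first exact: differentiableB d2 d1.
  by move=> h; rewrite -d3; exact: dvB d2 d1.
have qM z : nrm (z - x) < r / 4 -> nrm (q z) <= 256 * M / r * nrm w.
  move=> zx; have -> : nrm w = nrm ((z + w) - z) by rewrite [z + w]addrC addrK.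
  exact: lipschitz_half r0 hf fM (in1 z zx) (in2 z zx).
have := cauchy_bound v r4 (fun z zx => (dq z zx).1) qM.
have x0 : nrm (x - x) < r / 4 by rewrite subrr nrm0.
have [_ ->] := dq x x0; rewrite /w subrKC => h.
apply: le_trans h _; rewrite le_eqVlt; apply/orP; left; apply/eqP.
by field; rewrite gt_eqF.
Qed.

(** Mean value inequality for [f] minus its differential at [p], the derivative of this difference
    being controlled by [diff_lipschitz]. The constant depends only on [M] and [r], hence is uniform
    in families. *)
Lemma taylor2 f p r M h : 0 < r -> hol_on f p r ->
  (forall x, nrm (x - p) < r -> nrm (f x) <= M) -> nrm h < r / 4 ->
  nrm (f (p + h) - f p - dv f p h) <= 2 * 256 ^+ 2 * M / r ^+ 2 * nrm h ^+ 2.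
Proof.
move=> r0 hf fM hr.
have dp : differentiable f p by apply: hf; rewrite subrr nrm0.
have pr : nrm (p - p) < r / 4 by rewrite subrr nrm0; lra.
have hr' : nrm (p + h - p) < r / 4 by rewrite [p + h]addrC addrK.
have pp : nrm (p - p) < r by rewrite subrr nrm0.
have M0 : 0 <= M by exact: le_trans (nrm_ge0 _) (fM p pp).
have [c c0 hc] := dv_bounded dp.
have dL z : differentiable (dv f p) z /\ forall k, dv (dv f p) z k = dv f p k.
  apply: dv_ex hc _; first exact: dv_lin.
  move=> e e0; exists 1 => // k _; rewrite dvDr [X in nrm X](_ : _ = 0) ?nrm0; last by ring.
  by rewrite mulr_ge0 ?nrm_ge0 // ltW.
pose F z := f z - dv f p z.
have -> : f (p + h) - f p - dv f p h = F (p + h) - F p by rewrite /F dvDr; ring.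
apply: le_trans (@mean_value F p h (256 ^+ 2 * M / r ^+ 2 * nrm h * nrm h) _) _; last first.
  by rewrite le_eqVlt; apply/orP; left; apply/eqP; ring.
move=> t t01 z.
have zr : nrm (z - p) < r / 4.
  by have := seg_near pr hr' t01; rewrite [p + h]addrC addrK.
have dz : differentiable f z by apply: hf; lra.
have [d1 d2] := dL z.
split; first exact: differentiableB dz d1.
rewrite (dvB _ dz d1) d2; apply: le_trans (diff_lipschitz h r0 hf fM pr zr) _.
rewrite ler_wpM2l //; first by rewrite !mulr_ge0 ?invr_ge0 ?exprn_ge0 ?nrm_ge0 ?(ltW r0).
rewrite /z addrAC subrr add0r nrmZ nrmR; move/andP: t01 => [t0 t1].
by rewrite ger0_norm // ler_piMl // nrm_ge0.
Qed.

Lemma continuous_bounded_near f p : {for p, continuous f} ->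
  exists2 r : R, 0 < r & forall x, nrm (x - p) < r -> nrm (f x) <= nrm (f p) + 1.
Proof.
move=> /cont_nrm /(_ _ ltr01)[r r0 hr]; exists r => // x /hr.
by have := nrm_tri (f x) (f p) 0; rewrite !subr0; lra.
Qed.

(** The differentials at [p] converge geometrically, by Cauchy's bound for consecutive differences;
    512 is 64 times 2 for a difference, times 4 for the limit of a complex geometric sequence. The
    remainder of [taylor2] is uniform in [n] and passes to the limit, which identifies the limit [L]
    as the differential of [f]. *)
Lemma weierstrass (g : nat -> V -> Cx R) f p r (c B : R) : 0 < r ->
  (forall n, hol_on (g n) p r) ->
  (forall n x, nrm (x - p) < r -> nrm (g n x - f x) <= c / 2 ^+ n) ->
  (forall x, nrm (x - p) < r -> nrm (f x) <= B) ->
  differentiable f p /\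
  forall n h, nrm (dv (g n) p h - dv f p h) <= 512 * c * nrm h / r / 2 ^+ n.
Proof.
move=> r0 hg gf fB.
have pp : nrm (p - p) < r by rewrite subrr nrm0.
have c0 : 0 <= c.
  by have := le_trans (nrm_ge0 _) (gf 0%N p pp); rewrite expr0 divr1.
have B0 : 0 <= B by exact: le_trans (nrm_ge0 _) (fB p pp).
have p2 n : 0 < 2 ^+ n :> R by rewrite exprn_gt0.
have c2 n : 0 <= c / 2 ^+ n <= c.
  rewrite divr_ge0 ?(ltW (p2 n)) //= ler_pdivrMr ?p2 // ler_peMr //.
  by rewrite exprn_ege1 // ler1n.
have gB n x : nrm (x - p) < r -> nrm (g n x) <= B + c.
  move=> xr; have := fB x xr; have := gf n x xr; have /andP[_] := c2 n.
  by have := nrm_tri (g n x) (f x) 0; rewrite !subr0; lra.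
have gd n : differentiable (g n) p by exact: hg.
have step n h : nrm (dv (g n.+1) p h - dv (g n) p h) <= 128 * c * nrm h / r / 2 ^+ n.
  rewrite -(dvB _ (gd _) (gd _)).
  have := @cauchy_bound (fun z => g n.+1 z - g n z) p r (2 * (c / 2 ^+ n)) h r0.
  have -> : 64 * (2 * (c / 2 ^+ n)) * nrm h / r = 128 * c * nrm h / r / 2 ^+ n.
    by field; rewrite !gt_eqF.
  apply=> [x xr|x xr]; first exact: differentiableB (hg _ x xr) (hg _ x xr).
  have := nrm_tri (g n.+1 x) (f x) (g n x); have := gf n.+1 x xr; have := gf n x xr.
  rewrite (nrmC (f x)) exprS invfM mulrCA => h1 h2 h3.
  by have /andP[h4 _] := c2 n; lra.
have /choice[L hL] : forall h, exists l, forall n,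
    nrm (dv (g n) p h - l) <= 512 * c * nrm h / r / 2 ^+ n.
  move=> h; have [l hl] := complex_geometric_cauchy (fun n => step n h); exists l => n.
  by have := hl n; rewrite !mulrA -[4 * 128]natrM.
have small (x y : R) : 0 <= y -> (forall n, x <= y / 2 ^+ n) -> x <= 0.
  move=> y0 h; apply/ler_addgt0Pr => e e0; rewrite add0r.
  by have [n hn] := @small_half_pow R y e e0; apply: le_trans (h n) (ltW hn).
have K0 h : 0 <= 512 * c * nrm h / r by rewrite !mulr_ge0 ?invr_ge0 ?nrm_ge0 ?(ltW r0).
have Llin : linear L.
  move=> a h k; apply/eqP; rewrite -subr_eq0; apply/eqP/nrm_eq0/le_anti.
  rewrite nrm_ge0 andbT.
  pose y := 512 * c * nrm (a *: h + k) / r + nrm a * (512 * c * nrm h / r) + 512 * c * nrm k / r.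
  apply: (small _ y); first by rewrite !addr_ge0 // mulr_ge0 // nrm_ge0.
  move=> n; have h1 := hL (a *: h + k) n; have h2 := hL h n; have h3 := hL k n.
  have -> : L (a *: h + k) - (a *: L h + L k) = (L (a *: h + k) - dv (g n) p (a *: h + k)) +
     (a * (dv (g n) p h - L h) + (dv (g n) p k - L k)).
    by rewrite dv_lin -[a *: L h]/(a * L h); ring.
  apply: le_trans (nrmD _ _) _; rewrite (nrmC (L _)).
  have := nrmD (a * (dv (g n) p h - L h)) (dv (g n) p k - L k).
  rewrite nrmM; have := ler_wpM2l (nrm_ge0 a) h2.
  have -> : y / 2 ^+ n = 512 * c * nrm (a *: h + k) / r / 2 ^+ n +
    (nrm a * (512 * c * nrm h / r / 2 ^+ n) + 512 * c * nrm k / r / 2 ^+ n).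
    rewrite /y; move: (512 * c * nrm (a *: h + k) / r) (512 * c * nrm h / r).
    by move: (512 * c * nrm k / r) (nrm a) (2 ^+ n)^-1 => *; ring.
  move: h1 h3; move: (512 * c * nrm (a *: h + k) / r / 2 ^+ n) => X1.
  move: (512 * c * nrm k / r / 2 ^+ n) => X2.
  move: (nrm a * (512 * c * nrm h / r / 2 ^+ n)) => X3 h1 h3 h4 h5.
  apply: lerD h1 _; apply: le_trans h5 _; exact: lerD.
pose K := 2 * 256 ^+ 2 * (B + c) / r ^+ 2.
have Kp : 0 <= K by rewrite /K !mulr_ge0 ?invr_ge0 ?exprn_ge0 ?(ltW r0) // addr_ge0.
have tay h : nrm h < r / 4 -> nrm (f (p + h) - f p - L h) <= K * nrm h ^+ 2.
  move=> hr; rewrite -subr_le0.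
  apply: (small _ (2 * c + 512 * c * nrm h / r)); first by rewrite addr_ge0 // mulr_ge0.
  move=> n; have h1 := hL h n; have h2 := gf n p pp.
  have hpr : nrm (p + h - p) < r by rewrite [p + h]addrC addrK; lra.
  have h3 := gf n _ hpr; have h4 := @taylor2 (g n) p r (B + c) h r0 (hg n) (gB n) hr.
  have -> : f (p + h) - f p - L h = (f (p + h) - g n (p + h)) + ((g n p - f p) +
    ((dv (g n) p h - L h) + (g n (p + h) - g n p - dv (g n) p h))) by ring.
  have := nrmD (f (p + h) - g n (p + h)) ((g n p - f p) +
    ((dv (g n) p h - L h) + (g n (p + h) - g n p - dv (g n) p h))).
  have := nrmD (g n p - f p) ((dv (g n) p h - L h) + (g n (p + h) - g n p - dv (g n) p h)).
  have := nrmD (dv (g n) p h - L h) (g n (p + h) - g n p - dv (g n) p h).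
  rewrite (nrmC (f _)) -/K in h3 h4 *; rewrite mulrDl.
  have -> : 2 * c / 2 ^+ n = 2 * (c / 2 ^+ n) by rewrite mulrA.
  lra.
have Lb h : nrm (L h) <= (64 * (B + c) / r + 512 * c / r) * nrm h.
  have := hL h 0%N; rewrite expr0 divr1.
  have := @cauchy_bound (g 0%N) p r (B + c) h r0 (hg 0%N) (gB 0%N).
  have := nrm_tri (L h) (dv (g 0%N) p h) 0; rewrite !subr0 (nrmC (L h)) => h1 h2 h3.
  apply: le_trans h1 _; rewrite mulrDl addrC lerD //.
    by rewrite mulrAC.
  by rewrite mulrAC.
have [|d1 d2] := dv_ex Llin Lb (f := f) (p := p).
  move=> e e0; exists (Num.min (r / 4) (e / (K + 1))).
    by rewrite lt_min !divr_gt0 //; lra.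
  move=> h; rewrite lt_min => /andP[h1 h2]; apply: le_trans (tay h h1) _.
  move: h2; rewrite ltr_pdivlMr; last by lra.
  by have := nrm_ge0 h; nra.
by split=> // n h; rewrite d2.
Qed.

End SeveralVariables.

Definition hol (R : realType) (V : normedModType (Cx R)) (f : V -> Cx R) (p : V) : Prop :=
  exists2 r : R, 0 < r & hol_on f p r.

Local Notation CC r := ((r%:C)%C : Cx _).

Section Derivatives.

(** * Differentiability of the derivative and symmetry of mixed derivatives *)

Variables (R : realType) (V : normedModType (Cx R)).
Implicit Types (f g : V -> Cx R) (p x y v h : V) (r M : R).

Lemma hol_diff f p : hol f p -> differentiable f p.
Proof. by move=> [r r0 h]; apply: h; rewrite subrr nrm0. Qed.

Lemma hol_on_hol f p r x : hol_on f p r -> nrm (x - p) < r -> hol f x.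
Proof.
move=> h xr; exists (r - nrm (x - p)); first by rewrite subr_gt0.
by move=> y yx; apply: h; have := nrm_tri y x p; lra.
Qed.

Lemma hol_bounded f p : hol f p -> exists r M : R, [/\ 0 < r, hol_on f p r &
  forall x, nrm (x - p) < r -> nrm (f x) <= M].
Proof.
move=> [r r0 h].
have [s s0 hs] := continuous_bounded_near (differentiable_continuous (hol_diff (ex_intro2 _ _ r r0 h))).
exists (Num.min r s), (nrm (f p) + 1); split; first by rewrite lt_min r0 s0.
  by move=> x; rewrite lt_min => /andP[xr _]; apply: h.
by move=> x; rewrite lt_min => /andP[_ xs]; apply: hs.
Qed.

(** By [taylor2] the difference quotients in direction [v] with steps [s / 2 ^+ n] converge
    uniformly, at rate [2 ^- n], to the derivative along [v]. Then [weierstrass] differentiates this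
    limit and shows that the differentials of the quotients converge to its differential. *)
Lemma dv_quotients f p v : hol f p ->
  exists s c : R, 0 < s /\ differentiable (fun x => dv f x v) p /\
    forall n h, let t : R := s / 2 ^+ n in
    nrm (CC t^-1 * (dv f (p + CC t *: v) h - dv f p h) - dv (fun x => dv f x v) p h)
    <= c * nrm h / 2 ^+ n.
Proof.
move=> /hol_bounded[r [M [r0 hf fM]]].
have n0 := nrm_ge0 v; have v1 : 0 < nrm v + 1 by lra.
have pp : nrm (p - p) < r by rewrite subrr nrm0.
have M0 : 0 <= M by exact: le_trans (nrm_ge0 _) (fM p pp).
(* All shifts then have norm below [r / 8], a quarter of the radius [r / 2] on which [taylor2] is
   used; the added 1 covers [v = 0]. *)
pose s := r / 16 / (nrm v + 1).
have s0 : 0 < s by rewrite !divr_gt0.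
pose t n : R := s / 2 ^+ n.
have t0 n : 0 < t n by rewrite divr_gt0 // exprn_gt0.
have ts n : t n <= s by rewrite ler_pdivrMr ?exprn_gt0 // ler_peMr ?(ltW s0) // exprn_ege1 // ler1n.
have tv n : nrm (CC (t n) *: v) < r / 8.
  rewrite nrmZ nrmR gtr0_norm //; apply: (@le_lt_trans _ _ (s * nrm v)); first by rewrite ler_wpM2r.
  rewrite /s mulrAC ltr_pdivrMr //; nra.
pose g n x := CC (t n)^-1 * (f (x + CC (t n) *: v) - f x).
have r4 : 0 < r / 4 by lra.
have sub x : nrm (x - p) < r / 4 -> hol_on f x (r / 2) /\ forall y, nrm (y - x) < r / 2 -> nrm (f y) <= M.
  by move=> xp; split=> y yx; [apply: hf|apply: fM]; have := nrm_tri y x p; lra.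
have inb x n : nrm (x - p) < r / 4 -> nrm (x + CC (t n) *: v - p) < r.
  move=> xp; rewrite addrAC; apply: le_lt_trans (nrmD _ _) _; have := tv n; lra.
have dfx x : nrm (x - p) < r / 4 -> differentiable f x by move=> xp; apply: hf; lra.
have dg n x : nrm (x - p) < r / 4 -> differentiable (g n) x /\
    forall h, dv (g n) x h = CC (t n)^-1 * (dv f (x + CC (t n) *: v) h - dv f x h).
  move=> xp; have [d1 d2] := hol_shift (hf _ (inb x n xp)).
  have d3 := differentiableB d1 (dfx x xp).
  split; first exact: differentiableZ d3.
  by move=> h; rewrite /g dv_scale // dvB ?d2 //; exact: dfx.
pose c := 2 * 256 ^+ 2 * M / (r / 2) ^+ 2 * nrm v ^+ 2 * s.
have gf n x : nrm (x - p) < r / 4 -> nrm (g n x - dv f x v) <= c / 2 ^+ n.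
  move=> xp; have [h1 h2] := sub x xp; have r2 : 0 < r / 2 by lra.
  have h3 : nrm (CC (t n) *: v) < r / 2 / 4 by have := tv n; lra.
  have := taylor2 r2 h1 h2 h3; rewrite dvZr => H.
  have tn0 : CC (t n) != 0 :> Cx R by rewrite (fmorph_eq0 (real_complex R)) gt_eqF.
  have -> : g n x - dv f x v =
     CC (t n)^-1 * (f (x + CC (t n) *: v) - f x - CC (t n) * dv f x v).
    by rewrite /g fmorphV [RHS]mulrBr mulKf.
  rewrite nrmM nrmR gtr0_norm ?invr_gt0 // mulrC ler_pdivrMr //; apply: le_trans H _.
  rewrite nrmZ nrmR gtr0_norm // (exprMn _ (t n)) le_eqVlt; apply/orP; left; apply/eqP.
  rewrite /c /t; move: (2 * 256 ^+ 2 * M / (r / 2) ^+ 2) (2 ^+ n)^-1 => *; ring.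
have [|d1 d2] := weierstrass (B := 64 * M * nrm v / (r / 2)) r4 (fun n x xp => (dg n x xp).1) gf.
  move=> x xp; have [h1 h2] := sub x xp; apply: cauchy_bound => //; lra.
exists s, (512 * c / (r / 4)); do 2?split => //; move=> n h /=.
rewrite -/(t n).
have pp4 : nrm (p - p) < r / 4 by rewrite subrr nrm0.
have := d2 n h; have [_ ->] := dg n p pp4.
by rewrite (mulrAC (512 * c)).
Qed.

Lemma hol_dv_diff f p v : hol f p -> differentiable (fun x => dv f x v) p.
Proof. by move=> /(dv_quotients v) [s [c [_ []]]]. Qed.

(** The quotients of [dv_quotients], evaluated on [h], are difference quotients in direction [v] of
    the function [dv f] along [h]. They therefore have both sides as limits. *)
Lemma dv_sym f p v h : hol f p ->
  dv (fun x => dv f x v) p h = dv (fun x => dv f x h) p v.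
Proof.
move=> hf; have [s [c [s0 [_ H]]]] := dv_quotients v hf.
apply/eqP; rewrite -subr_eq0; apply/eqP/nrm_eq0/le_anti; rewrite nrm_ge0 andbT.
have v0 := nrm_ge0 v; have v1 : 0 < nrm v + 1 by lra.
apply/ler_addgt0Pr => e e0; rewrite add0r.
have e2 : 0 < e / 2 / (nrm v + 1) by rewrite !divr_gt0.
have [d d0 hd] := dvP (hol_dv_diff h hf) e2.
have c0 : 0 <= c * nrm h.
  by have := le_trans (nrm_ge0 _) (H 0%N h); rewrite expr0 divr1.
have [n hn] := @small_half_pow R (c * nrm h + s * nrm v) (Num.min (e / 2) d) ltac:(by rewrite lt_min d0 divr_gt0).
have := H n h; set t : R := s / 2 ^+ n => /= h1.
have p0 : 0 < 2 ^+ n :> R by rewrite exprn_gt0.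
have t0 : 0 < t by rewrite divr_gt0.
move: hn; rewrite lt_min mulrDl -(mulrAC s) -/t => /andP[h2 h3].
have c1 : 0 <= c * nrm h / 2 ^+ n by rewrite divr_ge0 // ltW.
have tv : 0 <= t * nrm v by rewrite mulr_ge0 // ltW.
have ntv : nrm (CC t *: v) = t * nrm v by rewrite nrmZ nrmR gtr0_norm.
have := hd (CC t *: v); rewrite ntv dvZr => /(_ ltac:(lra)) h4.
have tn0 : CC t != 0 :> Cx R by rewrite (fmorph_eq0 (real_complex R)) gt_eqF.
have h5 : nrm (CC t^-1 * (dv f (p + CC t *: v) h - dv f p h) -
    dv (fun x => dv f x h) p v) <= e / 2.
  rewrite -[dv _ p v](mulKf tn0) -fmorphV -mulrBr nrmM nrmR gtr0_norm ?invr_gt0 //.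
  rewrite mulrC ler_pdivrMr //; apply: le_trans h4 _.
  have -> : e / 2 / (nrm v + 1) * (t * nrm v) = e / 2 * t * (nrm v / (nrm v + 1)).
    by field; rewrite gt_eqF.
  rewrite ler_piMr //; first by rewrite mulr_ge0 ?(ltW t0) //; lra.
  by rewrite ler_pdivrMr //; lra.
apply: le_trans (nrm_tri _ (CC t^-1 * (dv f (p + CC t *: v) h - dv f p h)) _) _.
rewrite nrmC; lra.
Qed.

End Derivatives.

Lemma eq_near_diff (R : realType) (W : normedModType (Cx R)) (f g : W -> Cx R) (p : W) :
  (\forall x \near p, f x = g x) -> differentiable f p ->
  differentiable g p /\ forall h, dv g p h = dv f p h.
Proof.
move=> /near_nrmP[d d0 hd] df; have [c c0 hc] := dv_bounded df.
apply: dv_ex hc _; first exact: dv_lin.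
move=> e e0; have [b b0 hb] := dvP df e0.
exists (Num.min b d); first by rewrite lt_min b0 d0.
move=> h; rewrite lt_min => /andP[/hb h1 h2].
by rewrite -!hd ?subrr ?nrm0 // [p + h]addrC addrK.
Qed.

(** * The identity theorem *)

Section Identity.
Variables (R : realType) (V : normedModType (Cx R)).
Implicit Types (f g : V -> Cx R) (p x y v h : V) (r M : R).

Lemma zero_near_disc (g : Cx R -> Cx R) r M d z : 0 < r -> 0 < d ->
  hol_on g 0 r -> (forall w, nrm (w - 0) < r -> nrm (g w) <= M) ->
  (forall w, nrm w < d -> g w = 0) -> nrm z < r / 512 -> g z = 0.
Proof.
move=> r0 d0 hg gM g0 hz.
have M0 : 0 <= M by apply: le_trans (nrm_ge0 _) (gM 0 _); rewrite subrr nrm0.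
pose F k w := g w / w ^+ k.
have key k : hol_on (F k) 0 r /\ forall w, nrm (w - 0) < r -> nrm (F k w) <= M * (256 / r) ^+ k.
  elim: k => [|k [hF FM]].
    have -> : F 0%N = g by apply/funext => w; rewrite /F expr0 divr1.
    by split=> // w wr; rewrite expr0 mulr1; exact: gM.
  have FE w : F k.+1 w = F k w / w by rewrite /F exprSr invfM mulrA mulrAC -mulrA.
  have F0 j : F j 0 = 0 by rewrite /F g0 ?mul0r // nrm0.
  have K0 : 0 <= M * (256 / r) ^+ k by rewrite mulr_ge0 // exprn_ge0 // divr_ge0 // ltW.
  split=> w wr.
    have [->|w0] := eqVneq w 0.
      have z0 : \forall x \near (0 : Cx R), (fun=> 0 : Cx R) x = F k.+1 x.
        by apply/near_nrmP; exists d => // x; rewrite subr0 => xd; rewrite /F g0 ?mul0r.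
      by have [] := eq_near_diff z0 (differentiable_cst 0 0).
    have -> : F k.+1 = (fun w => F k w * w^-1) by apply/funext => u; exact: FE.
    apply: differentiableM; first exact: hF.
    exact: (@differentiableV _ _ (id : Cx R -> Cx R)).
  have [->|w0] := eqVneq w 0; first by rewrite F0 nrm0 mulr_ge0 // exprn_ge0 // divr_ge0 // ltW.
  have nw := nrm_gt0 w0.
  rewrite FE nrmM nrmV ler_pdivrMr //.
  have -> : M * (256 / r) ^+ k.+1 * nrm w = 256 * (M * (256 / r) ^+ k) / r * nrm w.
    by rewrite exprS; move: ((256 / r) ^+ k) => *; field; rewrite gt_eqF.
  (* In the half disc the quotient by [w] is bounded by the Lipschitz constant of [F k], which
     vanishes at 0; outside it, dividing by [w] costs at most [2 / r]. *)
  have [w2|w2] := ltrP (nrm w) (r / 2).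
    have := @lipschitz_half _ _ (F k) 0 r _ 0 w r0 hF FM.
    rewrite F0 !subr0 nrm0; apply=> //; by rewrite divr_gt0.
  apply: le_trans (FM w wr) _; move: (M * _) K0 => X X0.
  have -> : 256 * X / r * nrm w = X * (256 * (nrm w / r)) by ring.
  have h : 1 / 2 <= nrm w / r by rewrite ler_pdivlMr //; lra.
  by rewrite ler_peMr //; lra.
have [->|z0] := eqVneq z 0; first by rewrite g0 // nrm0.
apply: nrm_eq0; apply/le_anti; rewrite nrm_ge0 andbT.
apply/ler_addgt0Pr => e e0; rewrite add0r.
have [n hn] := @small_half_pow R M e e0; apply: le_trans (ltW hn).
have nz := nrm_gt0 z0.
have zr : nrm (z - 0) < r by rewrite subr0; lra.
have [_ /(_ z zr)] := key n; rewrite /F nrmM nrmV nrmX ler_pdivrMr ?exprn_gt0 // => h.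
apply: le_trans h _; rewrite -mulrA -exprMn ler_wpM2l // -exprVn lerXn2r ?nnegrE ?invr_ge0 //.
  by rewrite mulr_ge0 ?divr_ge0 ?(ltW r0) ?(ltW nz).
rewrite mulrAC ler_pdivrMr //; lra.
Qed.

Lemma zero_near_ball f p r M x : 0 < r -> hol_on f p r ->
  (forall w, nrm (w - p) < r -> nrm (f w) <= M) ->
  (\forall w \near p, f w = 0) -> nrm (x - p) < r / 512 -> f x = 0.
Proof.
move=> r0 hf fM /near_nrmP[d d0 hd] xp.
have [e|v0] := eqVneq (x - p) 0.
  by apply: hd; rewrite e nrm0.
have nv := nrm_gt0 v0; set v := x - p in v0 nv xp.
have rv : 0 < r / nrm v by rewrite divr_gt0.
have inb (z : Cx R) : nrm (z - 0) < r / nrm v -> nrm (p + z *: v - p) < r.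
  by rewrite subr0 addrAC subrr add0r nrmZ ltr_pdivlMr.
have -> : x = p + 1 *: v by rewrite scale1r /v subrKC.
apply: (@zero_near_disc (fun z => f (p + z *: v)) (r / nrm v) M (d / nrm v) 1) => //.
- by rewrite divr_gt0.
- by move=> z zr; have [] := diff_line (hf _ (inb z zr)).
- by move=> z zr; apply/fM/inb.
- by move=> z zr; apply: hd; rewrite addrAC subrr add0r nrmZ -ltr_pdivlMr.
by rewrite nrm1 mulrAC ltr_pdivlMr // mul1r.
Qed.

End Identity.

(** Being locally constant relative to [S] makes both [P] and its negation relatively open. This
    carries the identity theorem and later the constancy of directions on fibre components and of
    the type on connected sets. *)
Lemma locally_const_connected (T : topologicalType) (S : set T) (P : T -> Prop) :
  connected S -> (forall x, S x -> \forall y \near x, S y -> (P x <-> P y)) ->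
  forall x y, S x -> S y -> P x -> P y.
Proof.
move=> cS hP x y Sx Sy Px.
have H (Q : T -> Prop) : (forall x, S x -> \forall y \near x, S y -> (Q x <-> Q y)) ->
    exists2 C : set T, open C & S `&` Q = S `&` C.
  move=> hQ; exists [set z | \forall y \near z, S y -> Q y]°; first exact: open_interior.
  apply/seteqP; split=> z [Sz Qz]; split=> //.
    have : \forall y \near z, \forall w \near y, S w -> (Q z <-> Q w).
      by apply: near_join; exact: hQ.
    apply: filterS => w; apply: filterS => u h /h[]; tauto.
  have /nbhs_singleton/nbhs_singleton := Qz; exact.
have cP : exists2 C : set T, closed C & S `&` P = S `&` C.
  have [|C oC hC] := H (fun z => ~ P z).
    move=> z Sz; have := hP z Sz; apply: filterS => w h /h; tauto.
  exists (~` C); first exact: open_closedC.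
  apply/seteqP; split=> z [Sz Pz]; split=> //.
    by move=> Cz; have : (S `&` C) z by []; rewrite -hC => -[].
  by apply: contrapT => nP; have : (S `&` (fun z => ~ P z)) z by []; rewrite hC => -[].
have := cS (S `&` P) (ex_intro _ x (conj Sx Px)) (H P hP) cP.
by move=> e; have : (S `&` P) y by [rewrite e]; case.
Qed.

Section Convex.
Variables (R : realType) (V : normedModType (Cx R)).

Lemma convex_connected (S : set V) :
  (forall x y (t : R), S x -> S y -> 0 <= t <= 1 -> S (x + CC t *: (y - x))) -> connected S.
Proof.
move=> cv; have [[x Sx]|nS] := pselect (S !=set0); last first.
  have -> : S = set0 by apply/seteqP; split=> x // Sx; apply: nS; exists x.
  exact: connected0.
pose seg y := (fun t : R => x + CC t *: (y - x)) @` `[0, 1].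
have -> : S = \bigcup_(y in S) seg y.
  apply/seteqP; split=> [y Sy|y [z Sz [t]]].
    exists y => //; exists 1; first by rewrite /= in_itv /= ler01 lexx.
    by rewrite scale1r subrKC.
  by rewrite /= in_itv /= => t01 <-; exact: cv.
apply: bigcup_connected.
  exists x => y Sy; exists 0; first by rewrite /= in_itv /= ler01 lexx.
  by rewrite scale0r addr0.
move=> y Sy; apply: connected_continuous_connected; first exact: segment_connected.
apply: continuous_subspaceT => t; apply/cvgrPdist_lt => e /gt0CE[c c0 ->].
have n0 := nrm_ge0 (y - x).
apply/nbhs_ballP; exists (c / (nrm (y - x) + 1)); first by rewrite /= divr_gt0 //; lra.
move=> s; rewrite /ball /= ltr_pdivlMr => [h|]; last by lra.
rewrite normE ltcR opprD addrACA subrr add0r -scalerBl -rmorphB nrmZ nrmR.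
by apply: le_lt_trans h; rewrite ler_wpM2l //; lra.
Qed.

Theorem identity_theorem (f : V -> Cx R) p r x0 : hol_on f p r -> nrm (x0 - p) < r ->
  (\forall x \near x0, f x = 0) -> forall x, nrm (x - p) < r -> f x = 0.
Proof.
move=> hf x0r fx0 x xr.
pose P (z : V) := \forall y \near z, f y = 0.
suff /nbhs_singleton : P x by [].
apply: (@locally_const_connected V [set z | nrm (z - p) < r] P _ _ x0) => //.
  by apply: convex_connected => y z t yr zr t01; exact: seg_near.
move=> z /= zr; have [s [M [s0 hs fM]]] := hol_bounded (hol_on_hol hf zr).
(* Two points [a], [b] near [z] and a point [w] near [b] are joined by at most three steps of length
   [e]; this must fit in the ball of radius [s / 2 / 512] around [a] on which [zero_near_ball]
   propagates zeros. *)
have [e [e0 e2 e3]] : exists e : R, [/\ 0 < e, e <= s / 2 & e + e + e <= s / 2 / 512].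
  by exists (s / 4096); split; lra.
apply/near_nrmP; exists e => // y yz yr.
have step a b : nrm (a - z) < e -> nrm (b - z) < e -> P a -> P b.
  move=> az bz Pa; apply/near_nrmP; exists e => //.
  move=> w wb.
  have inb u : nrm (u - a) < s / 2 -> nrm (u - z) < s.
    by move=> ua; rewrite [s]splitr; apply: le_lt_trans (nrm_tri u a z) _; rewrite ltrD // (lt_le_trans az).
  have s2 : 0 < s / 2 by rewrite divr_gt0.
  apply: (@zero_near_ball R V f a (s / 2) M w s2) => //.
  - by move=> u /inb; exact: hs.
  - by move=> u /inb; exact: fM.
  apply: lt_le_trans e3; apply: le_lt_trans (nrm_tri w b a) _; rewrite -addrA ltrD //.
  by apply: le_lt_trans (nrm_tri b z a) _; rewrite ltrD // nrmC.
have zz : nrm (z - z) < e by rewrite subrr nrm0.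
by split; [exact: step|exact: step].
Qed.

End Convex.

(** * Straightening a submersion *)

Lemma dv_comp (R : realType) (U V W : normedModType (Cx R)) (F : U -> V) (g : V -> W) x :
  differentiable F x -> differentiable g (F x) ->
  differentiable (fun z => g (F z)) x /\
  forall h, dv (fun z => g (F z)) x h = dv g (F x) (dv F x h).
Proof.
move=> dF dg; split; first exact: differentiable_comp dF dg.
move=> h; rewrite !dv.unlock.
have -> : 'd g (F x) ('d F x h) = ('d g (F x) \o 'd F x) h by [].
by rewrite -(diff_comp dF dg); reflexivity.
Qed.

Lemma dv_ext (R : realType) (V W : normedModType (Cx R)) (f : V -> W) (L : V -> W) p (c : R) :
  linear L -> (forall h, nrm (L h) <= c * nrm h) ->
  (forall e : R, 0 < e -> exists2 d : R, 0 < d & forall h, nrm h < d ->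
    nrm (f (p + h) - f p - L h) <= e * nrm h) ->
  differentiable f p /\ forall h, dv f p h = L h.
Proof.
move=> h1 h2 h3; have [h4 h5] := nrm_diff_fun h1 h2 h3; split => // h.
by rewrite dv.unlock h5.
Qed.

Lemma dv_cst0 (R : realType) (V : normedModType (Cx R)) (c : Cx R) (x h : V) :
  dv (fun=> c) x h = 0.
Proof.
have l0 : linear (fun _ : V => 0 : Cx R) by move=> b k m; rewrite scaler0 addr0.
have [k|e e0|_ ->//] := dv_ex l0 (c := 0) (f := fun=> c) (p := x).
  by rewrite nrm0 mul0r.
by exists 1 => // k _; rewrite !subrr nrm0 mulr_ge0 ?nrm_ge0 // ltW.
Qed.

Section Straightening.
Variables (R : realType) (V : normedModType (Cx R)).
Implicit Types (f : V -> Cx R) (p x y u v h : V).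

(** The displacement along [u] is chosen so that [dv f p (shear f p u x - p)] equals [f x - f p]. It
    is of second order at [p], so the differential there is the identity. *)
Definition shear f p u x : V := x + ((f x - f p - dv f p (x - p)) / dv f p u) *: u.

(* In the coordinates given by [shear], [f] is an affine function. *)
Lemma straighten f p u (rmax : R) : hol f p -> dv f p u != 0 -> 0 < rmax ->
  exists (r r1 : R) (Psi : V -> V),
  [/\ [/\ 0 < r, r <= rmax, 0 < r1 & hol_on f p r],
      (forall y, nrm (y - p) < r1 ->
        [/\ nrm (Psi y - p) < r, differentiable Psi y,
            f (Psi y) = f p + dv f p (y - p) & exists t, Psi y = y + t *: u]),
      (forall x, nrm (x - p) < r -> nrm (shear f p u x - p) < r1 -> Psi (shear f p u x) = x),
      (forall x y, nrm (x - p) < r -> nrm (y - p) < r -> shear f p u x = shear f p u y -> x = y) &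
      (forall v, dv Psi p v = v)].
Proof.
move=> hf; set a := dv f p u => a0 rmax0.
have [r0 [M [r00 hr fM]]] := hol_bounded hf.
have u0 : u != 0 by apply: contraNneq a0 => u0; rewrite /a u0 dv0.
have nu := nrm_gt0 u0; have na := nrm_gt0 a0.
have pp0 : nrm (p - p) < r0 by rewrite subrr nrm0.
have M0 : 0 <= M by exact: le_trans (nrm_ge0 _) (fM p pp0).
pose psi x := (f x - f p - dv f p (x - p)) / a.
pose K : R := 256 ^+ 2 * M / r0 ^+ 2.
have K0 : 0 <= K by rewrite /K !mulr_ge0 ?invr_ge0 ?exprn_ge0 ?(ltW r00).
(* [K] bounds the variation of the differential of [f]. The last term of the minimum gives [psi * u]
   differential at most 1/4, hence Lipschitz constant 1/2 after the mean value factor 2; the added 1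
   covers [K = 0]. *)
pose r := Num.min rmax (Num.min (r0 / 8) (nrm a / (4 * (K + 1) * nrm u))).
have k1 : 0 < 4 * (K + 1) * nrm u by rewrite !mulr_gt0 //; lra.
have rpos : 0 < r by rewrite !lt_min rmax0 /= !divr_gt0.
have rmx : r <= rmax by rewrite ge_min lexx.
have rr0 : r <= r0 / 8 by rewrite !ge_min lexx !orbT.
have rK : K * r * nrm u <= nrm a / 4.
  have : r <= nrm a / (4 * (K + 1) * nrm u) by rewrite !ge_min lexx !orbT.
  by rewrite ler_pdivlMr // => h; nra.
have dfx x : nrm (x - p) < r -> differentiable f x by move=> xp; apply: hr; lra.
have pp : nrm (p - p) < r by rewrite subrr nrm0.
have [cf cf0 hcf] := dv_bounded (dfx p pp).
have dlin z : differentiable (fun x => dv f p (x - p)) z /\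
    forall h, dv (fun x => dv f p (x - p)) z h = dv f p h.
  apply: dv_ex hcf _; first exact: dv_lin.
  move=> e e0; exists 1 => // k _ /=; rewrite (addrAC z k) (dvDr _ _ (z - p)) [X in nrm X](_ : _ = 0) ?nrm0; last by ring.
  by rewrite mulr_ge0 ?nrm_ge0 // ltW.
have psiE : psi = fun x => a^-1 * ((f x - f p) - dv f p (x - p)) by apply/funext => x; rewrite /psi mulrC.
have dpsi x : nrm (x - p) < r -> differentiable psi x /\
    forall h, dv psi x h = a^-1 * (dv f x h - dv f p h).
  move=> xp; have d1 := dfx x xp; have [d2 d3] := dlin x.
  have d4 : differentiable (fun x => f x - f p) x by apply: differentiableB.
  have d5 : differentiable (fun x => f x - f p - dv f p (x - p)) x by exact: differentiableB d4 d2.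
  rewrite psiE; split; first exact: differentiableZ d5.
  move=> h; rewrite dv_scale // dvB // d3 dvB //.
  have -> : dv (fun=> f p) x h = 0 :> Cx R.
    by rewrite dv_cst0.
  by rewrite subr0.
have psib x h : nrm (x - p) < r -> nrm (dv psi x h) * nrm u <= nrm h / 4.
  move=> xp; have [_ ->] := dpsi x xp.
  have xp4 : nrm (x - p) < r0 / 4 by lra.
  have pp4 : nrm (p - p) < r0 / 4 by rewrite subrr nrm0; lra.
  have H := diff_lipschitz h r00 hr fM pp4 xp4; rewrite -/K in H.
  rewrite nrmM nrmV -mulrA ler_pdivrMl //.
  have h0 := nrm_ge0 h; have x0 := nrm_ge0 (x - p).
  apply: le_trans (ler_wpM2r (ltW nu) H) _.
  have : K * nrm (x - p) * nrm u <= nrm a / 4.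
    by apply: le_trans rK; rewrite ler_wpM2r ?(ltW nu) // ler_wpM2l // ltW.
  move=> h1; have := ler_wpM2r h0 h1.
  have -> : K * nrm h * nrm (x - p) * nrm u = K * nrm (x - p) * nrm u * nrm h by ring.
  by move=> h2; apply: le_trans h2 _; lra.
have psiL x y : nrm (x - p) < r -> nrm (y - p) < r ->
    nrm (psi y - psi x) * nrm u <= nrm (y - x) / 2.
  move=> xp yp; rewrite -ler_pdivlMr //.
  have -> : nrm (y - x) / 2 / nrm u = 2 * (nrm (y - x) / 4 / nrm u) by field; rewrite gt_eqF.
  have {1}-> : y = x + (y - x) by rewrite addrCA subrr addr0.
  apply: mean_value => t t01 z.
  have zr : nrm (z - p) < r by exact: seg_near.
  by split; [have [] := dpsi z zr|rewrite ler_pdivlMr //; exact: psib].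
have psip : psi p = 0 by rewrite /psi !subrr dv0 subrr mul0r.
have shE x : shear f p u x = x + psi x *: u by [].
have psiA x : psi x * a = f x - f p - dv f p (x - p) by rewrite /psi divfK.
clearbody psi; clear psiE.
have shL x y : nrm (x - p) < r -> nrm (y - p) < r ->
    nrm (y - x) <= 2 * nrm (shear f p u y - shear f p u x).
  move=> xp yp; have := psiL x y xp yp; rewrite -nrmZ !shE => h1.
  have e : y - x = (y + psi y *: u - (x + psi x *: u)) - (psi y - psi x) *: u.
    by rewrite scalerBl (opprD x) addrACA addrK.
  by have := nrmB (y + psi y *: u - (x + psi x *: u)) ((psi y - psi x) *: u); rewrite -e; lra.

pose r1 := r / 4.
have r10 : 0 < r1 by rewrite /r1; lra.
have ex y : nrm (y - p) < r1 -> exists x, nrm (x - p) < r /\ shear f p u x = y.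
  rewrite /r1 => yp.
  (* A preimage of [y] under the shear is [y + t *: u] with [t = - psi (y + t *: u)], a scalar fixed
     point equation for a contraction. *)
  pose t := fix t n : Cx R := if n is m.+1 then - psi (y + t m *: u) else 0.
  pose c := r / 8 / nrm u.
  have tb n : nrm (y + t n *: u - p) <= r / 2.
    elim: n => [|n IH] /=; first by rewrite scale0r addr0; lra.
    have xr : nrm (y + t n *: u - p) < r by lra.
    have := psiL p _ pp xr; rewrite psip subr0 -nrmZ => h.
    rewrite addrAC scaleNr; apply: le_trans (nrmB _ _) _; lra.
  have tr n : nrm (y + t n *: u - p) < r by have := tb n; lra.
  have stp n : nrm (t n.+1 - t n) * nrm u <= r / 8 / 2 ^+ n.
    elim: n => [|n IH].
      have yr : nrm (y - p) < r by lra.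
      rewrite /= scale0r addr0 subr0 nrmN expr0 divr1.
      by have := psiL p y pp yr; rewrite psip subr0; lra.
    have -> : t n.+2 - t n.+1 = psi (y + t n *: u) - psi (y + t n.+1 *: u).
      by rewrite /= opprK addrC.
    have := psiL _ _ (tr n.+1) (tr n).
    rewrite opprD addrACA subrr add0r -scalerBl nrmZ (nrmC (t n)) => h.
    apply: le_trans h _; rewrite exprS invfM.
    have -> : r / 8 * (2^-1 * (2 ^+ n)^-1) = r / 8 / 2 ^+ n / 2 by ring.
    by rewrite ler_pM2r // invr_gt0.
  have [l hl] : exists l, forall n, nrm (t n - l) <= 4 * c / 2 ^+ n.
    apply: complex_geometric_cauchy => n; rewrite /c -(ler_pM2r nu).
    by apply: le_trans (stp n) _; rewrite le_eqVlt; apply/orP; left; apply/eqP; field; rewrite ?gt_eqF ?exprn_gt0.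
  have cu : 4 * c * nrm u = r / 2 by rewrite /c; field; rewrite gt_eqF.
  have lu : nrm l * nrm u <= r / 2.
    have := hl 0%N; rewrite /= sub0r nrmN expr0 divr1 => h.
    by rewrite -cu ler_wpM2r // ltW.
  have xr : nrm (y + l *: u - p) < r.
    by rewrite addrAC; apply: le_lt_trans (nrmD _ _) _; rewrite nrmZ; lra.
  have lE : l = - psi (y + l *: u).
    apply/eqP; rewrite -subr_eq0; apply/eqP/nrm_eq0/le_anti; rewrite nrm_ge0 andbT.
    rewrite -(pmulr_lle0 _ nu); apply/ler_addgt0Pr => e e0; rewrite add0r.
    have [n hn] := @small_half_pow R r e e0; apply: le_trans (ltW hn).
    have h1 := ler_wpM2r (ltW nu) (hl n.+1); have h2 := ler_wpM2r (ltW nu) (hl n).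
    have h3 := psiL _ _ xr (tr n).
    rewrite opprD addrACA subrr add0r -scalerBl nrmZ in h3.
    have h4 := ler_wpM2r (ltW nu) (nrm_tri l (t n.+1) (- psi (y + l *: u))).
    have e4 : nrm (t n.+1 - - psi (y + l *: u)) = nrm (psi (y + t n *: u) - psi (y + l *: u)).
      by rewrite /= -opprD nrmN.
    rewrite (nrmC l (t n.+1)) e4 mulrDl in h4.
    have p2 : 0 < 2 ^+ n :> R by rewrite exprn_gt0.
    have e1 : 4 * c / 2 ^+ n.+1 * nrm u = r / 4 / 2 ^+ n.
      by rewrite mulrAC cu exprS; field; rewrite ?gt_eqF ?exprn_gt0.
    have e2 : 4 * c / 2 ^+ n * nrm u = r / 2 / 2 ^+ n by rewrite mulrAC cu.
    have e3 : 0 < r / 2 ^+ n by rewrite divr_gt0.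
    rewrite e1 in h1; rewrite e2 in h2; lra.
  exists (y + l *: u); split=> //.
  by rewrite shE {1}lE scaleNr subrK.
have /choice[Psi hPsi] : forall y, exists x, nrm (y - p) < r1 -> nrm (x - p) < r /\ shear f p u x = y.
  move=> y; have [/ex[x hx]|h] := pselect (nrm (y - p) < r1); first by exists x.
  by exists y => /h.
have inj x y : nrm (x - p) < r -> nrm (y - p) < r -> shear f p u x = shear f p u y -> x = y.
  move=> xp yp e; have := shL x y xp yp; rewrite e subrr nrm0 mulr0 => h.
  by have /nrm_eq0/eqP : nrm (y - x) = 0 by [apply/le_anti; rewrite h nrm_ge0]; rewrite subr_eq0 => /eqP.
have onep x : nrm (x - p) < r -> 1 + dv psi x u != 0.
  move=> xp; have := psib x u xp; rewrite -ler_pdivlMr // => h.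
  apply/eqP => /eqP; rewrite addrC addr_eq0 => /eqP e.
  move: h; rewrite e nrmN nrm1 mulrAC divff ?gt_eqF //; lra.
(* The differential of the shear is the identity plus the rank one map [k] to [dv psi x k *: u]; its
   inverse is explicit as soon as [1 + dv psi x u] is nonzero, which [onep] ensures. *)
have dP y : nrm (y - p) < r1 -> let x := Psi y in
    differentiable Psi y /\ forall k, dv Psi y k = k - (dv psi x k / (1 + dv psi x u)) *: u.
  move=> yp x; have [xr xE] := hPsi y yp; rewrite -/x in xr xE.
  have q0 := onep x xr; set q := 1 + dv psi x u in q0 *.
  have nq := nrm_gt0 q0.
  have [dpx _] := dpsi x xr.
  have [b b0 hb] := dv_bounded dpx.
  apply: (@dv_ext R V V Psi _ y (1 + b / nrm q * nrm u)).
  - move=> c k l; rewrite dv_lin mulrDl scalerDl scalerBr opprD addrACA.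
    by rewrite -mulrA scalerA.
  - move=> k; apply: le_trans (nrmB _ _) _.
    rewrite nrmZ nrmM nrmV mulrDl mul1r lerD2l.
    have -> : b / nrm q * nrm u * nrm k = b * nrm k / nrm q * nrm u by ring.
    apply: ler_wpM2r; first exact: ltW.
    by apply: ler_wpM2r; [rewrite invr_ge0 ltW|exact: hb].
  move=> e e0.
  have e1 : 0 < e * nrm q / (2 * nrm u) by rewrite divr_gt0 ?mulr_gt0.
  have [d d0 hd] := dvP dpx e1.
  exists (Num.min (d / 2) (r1 - nrm (y - p))).
    by rewrite lt_min subr_gt0 yp divr_gt0.
  move=> k; rewrite lt_min => /andP[kd kr].
  have ykp : nrm (y + k - p) < r1.
    by rewrite addrAC; apply: le_lt_trans (nrmD _ _) _; lra.
  have [x'r x'E] := hPsi (y + k) ykp; set x' := Psi (y + k) in x'r x'E *.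
  pose h := x' - x.
  have hk : nrm h <= 2 * nrm k.
    by have := shL x x' xr x'r; rewrite x'E xE addrAC subrr add0r.
  have := hd h ltac:(lra); rewrite {1}/h subrKC.
  set ee := psi x' - psi x - dv psi x h => hee.
  have kE : k = h + (dv psi x h + ee) *: u.
    have -> : k = shear f p u x' - shear f p u x by rewrite x'E xE addrAC subrr add0r.
    by rewrite !shE /ee addrCA subrr addr0 scalerBl opprD addrACA.
  have -> : x' - x - (k - (dv psi x k / q) *: u) = (- (ee / q)) *: u.
    have dk : dv psi x k = dv psi x h + (dv psi x h + ee) * dv psi x u.
      by rewrite {1}kE dvDr dvZr.
    have cancel X Y : h + (X - (h + Y)) = X - Y.
      by rewrite opprD addrCA (addrA h) subrr add0r.
    rewrite -/h dk {1}kE opprB cancel -scalerBl; congr (_ *: u).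
    by rewrite /q; field; exact: q0.
  rewrite nrmZ nrmN nrmM nrmV mulrAC ler_pdivrMr //.
  apply: le_trans (ler_wpM2r (ltW nu) hee) _.
  have -> : e * nrm q / (2 * nrm u) * nrm h * nrm u = e * nrm q / 2 * nrm h.
    by field; rewrite gt_eqF.
  have eq0 : 0 <= e * nrm q / 2 by rewrite divr_ge0 // mulr_ge0 // ltW.
  apply: le_trans (ler_wpM2l eq0 hk) _; lra.
have PsiK x : nrm (x - p) < r -> nrm (shear f p u x - p) < r1 -> Psi (shear f p u x) = x.
  by move=> xr yr; have [h1 h2] := hPsi _ yr; exact: inj.
exists r, r1, Psi; split=> //.
  move=> y yp; have [xr xE] := hPsi y yp; have [dPy _] := dP y yp; split=> //.
    by rewrite -{2}xE shE addrAC dvDr dvZr -/a psiA; ring.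
  exists (- psi (Psi y)); rewrite -{2}xE shE scaleNr addrK //.
move=> v; have [_ ->] := dP p ltac:(by rewrite subrr nrm0).
have -> : Psi p = p by rewrite -{1}[p](_ : shear f p u p = p) ?PsiK // shE psip scale0r addr0 // subrr nrm0.
have [_ ->] := dpsi p pp; by rewrite subrr mulr0 mul0r scale0r subr0.
Qed.

End Straightening.

(** * Functions constant on the level sets of a submersion *)

Section Factorization.
Variables (R : realType) (V : normedModType (Cx R)).
Implicit Types (f mu : V -> Cx R) (p x y u v h : V).

(** On a smaller ball the shear lands in the domain of its inverse. The fourth clause, injectivity
    of [f] on lines in direction [u], holds because two such points with equal values of [f] have
    the same shear. *)
Lemma straighten_near f p u (rmax : R) : hol f p -> dv f p u != 0 -> 0 < rmax ->
  exists (d r1 : R) (Psi : V -> V),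
  [/\ [/\ 0 < d, d <= rmax, 0 < r1 & Psi p = p],
      (forall y, nrm (y - p) < r1 ->
        [/\ nrm (Psi y - p) < rmax, differentiable Psi y,
            f (Psi y) = f p + dv f p (y - p) & exists t, Psi y = y + t *: u]),
      (forall x, nrm (x - p) < d -> nrm (shear f p u x - p) < r1 /\ Psi (shear f p u x) = x),
      (forall x t, nrm (x - p) < d -> nrm (x + t *: u - p) < d -> f (x + t *: u) = f x -> t = 0) &
      (forall v, dv Psi p v = v)].
Proof.
move=> hf a0 rmax0.
have [r [r1 [Psi [[r0 rm r10 hr] A B inj dP]]]] := straighten hf a0 rmax0.
set a := dv f p u in a0 *.
have u0 : u != 0 by apply: contraNneq a0 => u0; rewrite /a u0 dv0.
have nu := nrm_gt0 u0; have na := nrm_gt0 a0.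
(* With this precision the shear moves [x] by at most the distance from [x] to [p], so the radius
   [r1 / 2] guarantees that it stays within [r1]. *)
have e0 : 0 < nrm a / nrm u by rewrite divr_gt0.
have [d d0 hd] := dvP (hol_diff hf) e0.
have shp : shear f p u p = p by rewrite /shear !subrr dv0 subrr mul0r scale0r addr0.
have pp s : 0 < s -> nrm (p - p) < s by rewrite subrr nrm0.
exists (Num.min (Num.min d r) (r1 / 2)), r1, Psi; split.
- split=> //; first by rewrite !lt_min d0 r0 /=; lra.
    by rewrite !ge_min rm !orbT.
  by rewrite -{1}shp B ?shp //; exact: pp.
- move=> y /A[h1 h2 h3 h4]; split=> //; exact: lt_le_trans rm.
- move=> x; rewrite !lt_min => /andP[/andP[xd xr] x1].
  have sn : nrm (shear f p u x - p) < r1.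
    have := hd (x - p) xd; rewrite subrKC => h.
    rewrite /shear addrAC; apply: le_lt_trans (nrmD _ _) _.
    rewrite nrmZ nrmM nrmV -/a.
    have : nrm (f x - f p - dv f p (x - p)) / nrm a * nrm u <= nrm (x - p); last by lra.
    rewrite mulrAC ler_pdivrMr //; apply: le_trans (ler_wpM2r (ltW nu) h) _.
    by rewrite mulrAC divfK ?gt_eqF // mulrC.
  by split=> //; exact: B.
- move=> x t; rewrite !lt_min => /andP[/andP[_ xr] _] /andP[/andP[_ tr] _] e.
  have h : shear f p u (x + t *: u) = shear f p u x.
    rewrite /shear e (addrAC x (t *: u) (- p)) (dvDr _ _ (x - p)) dvZr -/a.
    rewrite (_ : (f x - f p - (dv f p (x - p) + t * a)) / a =
       (f x - f p - dv f p (x - p)) / a - t); last by field.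
    by rewrite scalerBl addrACA subrr addr0.
  have := inj _ _ tr xr h => /eqP; rewrite -subr_eq0 addrAC subrr add0r scaler_eq0.
  by rewrite (negbTE u0) orbF => /eqP.
exact: dP.
Qed.

Lemma dv_affine f p z v : differentiable f p ->
  differentiable (fun y => f p + dv f p (y - p)) z /\
  dv (fun y => f p + dv f p (y - p)) z v = dv f p v.
Proof.
move=> df; have [c c0 hc] := dv_bounded df.
suff : differentiable (fun y => f p + dv f p (y - p)) z /\
    forall h, dv (fun y => f p + dv f p (y - p)) z h = dv f p h.
  by move=> [? ->].
apply: dv_ex hc _; first exact: dv_lin.
move=> e e0; exists 1 => // k _ /=; rewrite (addrAC z k) (dvDr _ _ (z - p)).
rewrite [X in nrm X](_ : _ = 0) ?nrm0; last by ring.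
by rewrite mulr_ge0 ?nrm_ge0 // ltW.
Qed.

(** In straightened coordinates the levels of [f] are parallel hyperplanes and the differential of
    [mu] vanishes along them, so [mu] is constant on each slice of the ball, which is convex. The
    function [rho] reads [mu] along the transversal line [pt] in direction [u]. *)
Lemma factor_through f mu p u (r0 : R) : hol f p -> dv f p u != 0 -> 0 < r0 ->
  hol_on mu p r0 ->
  (forall x, nrm (x - p) < r0 -> exists l, forall v, dv mu x v = l * dv f x v) ->
  hol_on f p r0 ->
  exists (rho : Cx R -> Cx R) (d e : R), [/\ 0 < d, 0 < e,
    (forall z, nrm (z - f p) < e -> differentiable rho z) &
    (forall x, nrm (x - p) < d -> nrm (f x - f p) < e /\ mu x = rho (f x))].
Proof.
move=> hf a0 r00 hmu dmu hfr.
have [d [r1 [Psi [[d0 dr r10 Pp] A B inj dP]]]] := straighten_near hf a0 r00.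
set a := dv f p u in a0 *.
have u0 : u != 0 by apply: contraNneq a0 => u0; rewrite /a u0 dv0.
have nu := nrm_gt0 u0; have na := nrm_gt0 a0.
pose pt z := p + ((z - f p) / a) *: u.
pose e := r1 * nrm a / nrm u.
have e0 : 0 < e by rewrite divr_gt0 // mulr_gt0.
have ptn z : nrm (z - f p) < e -> nrm (pt z - p) < r1.
  rewrite /pt addrAC subrr add0r nrmZ nrmM nrmV /e ltr_pdivlMr // => h.
  by rewrite mulrAC ltr_pdivrMr.
have dF y : nrm (y - p) < r1 -> differentiable (fun y => mu (Psi y)) y /\
    forall v, dv f p v = 0 -> dv (fun y => mu (Psi y)) y v = 0.
  move=> yr; have [Pr dPy fP _] := A y yr.
  have [d1 d2] := dv_comp dPy (hmu _ Pr); split=> // v v0.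
  have [d3 d4] := dv_comp dPy (hfr _ Pr).
  rewrite d2; have [l ->] := dmu _ Pr; rewrite -d4.
  have near : \forall w \near y, f p + dv f p (w - p) = f (Psi w).
    apply/near_nrmP; exists (r1 - nrm (y - p)); first by rewrite subr_gt0.
    move=> w wy; have [|_ _ -> _] := A w; last by [].
    by have := nrm_tri w y p; lra.
  have [d5 d6] := dv_affine y v (hol_diff hf).
  have [_ d7] := eq_near_diff near d5.
  by rewrite d7 d6 v0 mulr0.
have [b b0 hb] := cont_nrm (differentiable_continuous (hol_diff hf)) e0.
exists (fun z => mu (Psi (pt z))), (Num.min d b), e; split=> //.
- by rewrite lt_min d0 b0.
- move=> z ze; have [d1 _] := dF _ (ptn z ze).
  have dpt : differentiable pt z.
    pose dl (h : Cx R) : V := (h / a) *: u.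
    have ll : linear dl.
      by move=> c x y; rewrite /dl mulrDl scalerDl -[c *: x]/(c * x) -mulrA scalerA.
    have bl (h : Cx R) : nrm (dl h) <= nrm a^-1 * nrm u * nrm h.
      by rewrite /dl nrmZ nrmM (mulrC (nrm h)) mulrAC.
    have el (e' : R) : 0 < e' -> exists2 c : R, 0 < c & forall h : Cx R, nrm h < c ->
        nrm (pt (z + h) - pt z - dl h) <= e' * nrm h.
      move=> e'0; exists 1 => // h _; rewrite /pt /dl.
      have cancel (X Y Z : V) : p + X - (p + Y) - Z = X - Y - Z.
        by rewrite opprD addrACA subrr add0r.
      rewrite cancel -!scalerBl.
      have -> : z + h - f p - (z - f p) - h = 0 by ring.
      by rewrite !scale0r nrm0 mulr_ge0 ?nrm_ge0 // ltW.
    by have [] := dv_ext ll bl el.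
  exact: (@differentiable_comp _ _ _ _ pt (fun y => mu (Psi y)) z dpt d1).
move=> x; rewrite lt_min => /andP[xd xb].
have fxe := hb x xb; split=> //.
have [sr sx] := B x xd.
set X := shear f p u x in sr sx *; set Y := pt (f x).
have YX : dv f p (Y - X) = 0.
  rewrite /Y /X /pt /shear -/a.
  have -> : p + ((f x - f p) / a) *: u - (x + ((f x - f p - dv f p (x - p)) / a) *: u) =
     ((f x - f p) / a - (f x - f p - dv f p (x - p)) / a) *: u - (x - p).
    by rewrite scalerBl opprB opprD addrACA addrC.
  by rewrite (dvBr _ _ (_ *: u)) dvZr -/a; field.
have := @mean_value R V (fun y => mu (Psi y)) X (Y - X) 0; rewrite mulr0 subrKC sx => H.
apply/esym/eqP; rewrite -subr_eq0; apply/eqP/nrm_eq0/le_anti; rewrite nrm_ge0 andbT.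
apply: H => t t01 z.
have zr : nrm (z - p) < r1 by apply: seg_near => //; exact: ptn.
by have [h1 h2] := dF z zr; split=> //; rewrite h2 // nrm0.
Qed.

(** For [v] in the kernel, [f] is constant along the curve [Psi (p + s *: v)], hence so is [mu], and
    this curve has velocity [v] at [p]. *)
Lemma level_const_dv f mu p u (d : R) : hol f p -> dv f p u != 0 -> 0 < d ->
  differentiable mu p ->
  (forall x y, nrm (x - p) < d -> nrm (y - p) < d -> f x = f y -> mu x = mu y) ->
  forall v, dv f p v = 0 -> dv mu p v = 0.
Proof.
move=> hf a0 d0 dmu hmu v v0.
have [b [r1 [Psi [[b0 bd r10 Pp] A B inj dP]]]] := straighten_near hf a0 d0.
have pp s : 0 < s -> nrm (p - p) < s by rewrite subrr nrm0.
have [_ dPp _ _] := A p (pp _ r10).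
have := dv_comp dPp; rewrite Pp => /(_ _ mu dmu)[dF /(_ v)]; rewrite dP => <-.
set F := fun z => mu (Psi z) in dF *.
apply/nrm_eq0/le_anti; rewrite nrm_ge0 andbT.
have v1 : 0 < nrm v + 1 by rewrite ltr_wpDl ?nrm_ge0.
apply/ler_addgt0Pr => e e0; rewrite add0r.
have e1 : 0 < e / (nrm v + 1) by rewrite divr_gt0.
have [c c0 hc] := dvP dF e1.
pose s := Num.min c r1 / 2 / (nrm v + 1).
have m0 : 0 < Num.min c r1 by rewrite lt_min c0 r10.
have s0 : 0 < s by rewrite !divr_gt0.
have sv : nrm (CC s *: v) < Num.min c r1.
  rewrite nrmZ nrmR gtr0_norm // /s mulrAC ltr_pdivrMr //.
  by have := nrm_ge0 v; nra.
move: sv; rewrite lt_min => /andP[sc sr].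
have := hc _ sc; rewrite dvZr.
have hsr : nrm (p + CC s *: v - p) < r1 by rewrite addrAC subrr add0r.
have [h1 _ h2 _] := A _ hsr.
have -> : F (p + CC s *: v) = F p.
  rewrite /F; apply: hmu => //; first by rewrite Pp; exact: pp.
  by rewrite h2 addrAC subrr add0r dvZr v0 mulr0 addr0 Pp.
rewrite subrr sub0r nrmN nrmM nrmZ nrmR gtr0_norm // mulrCA ler_pM2l //.
move=> h; apply: le_trans h _; rewrite mulrAC ler_pdivrMr //.
by rewrite ler_pM2l //; lra.
Qed.

End Factorization.

(** * Null harmonic functions *)

(** Here [a] stands for the derivative of [f] along [u1], with [a1], [at1], [a2], [at2] its
    derivatives in the four directions. The hypotheses are symmetry of second derivatives and
    harmonicity, after substituting [- m * a], [- n * a], [- m * n * a] for the other derivatives of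
    [f]; eliminating second derivatives of [f] leaves equations for [m] and [n]. *)
Lemma null_algebra (K : fieldType)
  (a m n m1 mt1 m2 mt2 n1 nt1 n2 nt2 a1 at1 a2 at2 : K) : a != 0 ->
  at2 = - (m * a1 + a * m1) -> a2 = - (n * a1 + a * n1) ->
  at1 = - (m * n * a1 + a * (m * n1 + n * m1)) ->
  at1 - (m * a2 + a * m2) = 0 ->
  m * a2 + a * m2 = n * at2 + a * nt2 ->
  m * at1 + a * mt1 = m * n * at2 + a * (m * nt2 + n * mt2) ->
  n * at1 + a * nt1 = m * n * a2 + a * (m * n2 + n * m2) ->
  [/\ m2 = - (n * m1), nt2 = - (m * n1), mt1 = n * mt2 & nt1 = m * n2].
Proof.
move=> a0 e1 e2 e3 e4 e5 e6 e7.
have E1 : m2 = - (n * m1).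
  apply: (mulfI a0); apply/eqP; rewrite -subr_eq0; apply/eqP.
  by rewrite -[RHS]oppr0 -[in RHS]e4 e3 e2; ring.
have E2 : nt2 = - (m * n1).
  apply: (mulfI a0); apply: (addrI (n * at2)); rewrite -e5 E1 e1 e2; ring.
split=> //; apply: (mulfI a0).
  by apply: (addrI (m * at1)); rewrite e6 E2 e1 e3; ring.
by apply: (addrI (n * at1)); rewrite e7 E1 e2 e3; ring.
Qed.

Section NullFrame.
Variables (R : realType) (V : normedModType (Cx R)).
Implicit Types (f F G : V -> Cx R) (p x y u v w h : V) (r : R).

Lemma eq_on_dv F G p r : hol_on F p r ->
  (forall y, nrm (y - p) < r -> F y = G y) ->
  forall x v, nrm (x - p) < r -> dv F x v = dv G x v.
Proof.
move=> hF FG x v xr.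
have near : \forall w \near x, F w = G w.
  apply/near_nrmP; exists (r - nrm (x - p)); first by rewrite subr_gt0.
  by move=> w wx; apply: FG; have := nrm_tri w x p; lra.
by have [_ ->] := eq_near_diff near (hF x xr).
Qed.

Lemma hol_on_dv f p r w : hol_on f p r -> hol_on (fun y => dv f y w) p r.
Proof. by move=> hf x xr; apply: hol_dv_diff; exact: hol_on_hol hf xr. Qed.

Lemma dvNf F x v : differentiable F x -> dv (fun y => - F y) x v = - dv F x v.
Proof.
move=> dF; have -> : (fun y => - F y) = (fun y => (-1) * F y).
  by apply/funext => y; rewrite mulN1r.
by rewrite dv_scale // mulN1r.
Qed.

(* The gradient of [f] is null and [f] is harmonic for the metric in which
   (u1, ut1) and (u2, ut2) are dual null pairs. *)
Definition null_harmonic f p r u1 ut1 u2 ut2 : Prop :=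
  [/\ hol_on f p r,
      (forall x, nrm (x - p) < r ->
         dv (fun y => dv f y ut1) x u1 + dv (fun y => dv f y ut2) x u2 = 0),
      (forall x, nrm (x - p) < r ->
         dv f x u1 * dv f x ut1 + dv f x u2 * dv f x ut2 = 0) &
      (forall x, nrm (x - p) < r -> dv f x u1 != 0)].

Definition slope f u w x : Cx R := - (dv f x w / dv f x u).

Lemma hol_on_slope f p r u w : hol_on f p r ->
  (forall x, nrm (x - p) < r -> dv f x u != 0) -> hol_on (slope f u w) p r.
Proof.
move=> hf nz x xr; apply: differentiableN.
apply: differentiableM; first exact: (hol_on_dv _ hf).
by apply: (@differentiableV _ _ (fun y => dv f y u)); [exact: (hol_on_dv _ hf)|exact: nz].
Qed.

Section Local.
Variables (f : V -> Cx R) (p : V) (r : R) (u1 ut1 u2 ut2 : V).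
Hypothesis H : null_harmonic f p r u1 ut1 u2 ut2.
Let mu := slope f u1 ut2.
Let nu := slope f u1 u2.

Let hf : hol_on f p r. Proof. by case: H. Qed.
Let nz x : nrm (x - p) < r -> dv f x u1 != 0. Proof. by case: H => _ _ _; apply. Qed.
Let hmu : hol_on mu p r. Proof. exact: hol_on_slope hf nz. Qed.
Let hnu : hol_on nu p r. Proof. exact: hol_on_slope hf nz. Qed.

Let muE x : nrm (x - p) < r -> dv f x ut2 = - (mu x * dv f x u1).
Proof. by move=> xr; rewrite /mu /slope mulNr opprK divfK // nz. Qed.

Let nuE x : nrm (x - p) < r -> dv f x u2 = - (nu x * dv f x u1).
Proof. by move=> xr; rewrite /nu /slope mulNr opprK divfK // nz. Qed.

Let munuE x : nrm (x - p) < r -> dv f x ut1 = - (mu x * nu x * dv f x u1).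
Proof.
move=> xr; have [_ _ /(_ x xr) nul _] := H; move: nul; rewrite (muE xr) (nuE xr).
move: (dv f x u1) (nz xr) => a a0 e; apply: (mulfI a0).
by apply/eqP; rewrite -subr_eq0; apply/eqP; rewrite -[RHS]e; ring.
Qed.

Let holM F G : hol_on F p r -> hol_on G p r -> hol_on (fun y => F y * G y) p r.
Proof. by move=> hF hG x xr; apply: differentiableM; [exact: hF|exact: hG]. Qed.

Let dNM F G x v : hol_on F p r -> hol_on G p r -> nrm (x - p) < r ->
  dv (fun y => - (F y * G y)) x v = - (F x * dv G x v + G x * dv F x v).
Proof.
move=> hF hG xr; rewrite dvNf; last exact: holM.
by rewrite dvM //; [exact: hF|exact: hG].
Qed.

Let sym F x v w : hol_on F p r -> nrm (x - p) < r ->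
  dv (fun y => dv F y v) x w = dv (fun y => dv F y w) x v.
Proof. by move=> hF xr; apply: dv_sym; exact: hol_on_hol hF xr. Qed.

Let hA := hol_on_dv u1 hf.

(** The equations for [mu] say that its differential vanishes on [u2 + nu u1] and [ut1 - nu ut2],
    the plane of the other type; those for [nu] are the same with the two types exchanged. *)
Lemma slope_equations x : nrm (x - p) < r ->
  [/\ dv mu x u2 = - (nu x * dv mu x u1), dv nu x ut2 = - (mu x * dv nu x u1),
      dv mu x ut1 = nu x * dv mu x ut2 & dv nu x ut1 = mu x * dv nu x u2].
Proof.
move=> xr.
have Dt2 v : dv (fun y => dv f y ut2) x v =
    - (mu x * dv (fun y => dv f y u1) x v + dv f x u1 * dv mu x v).
  by rewrite (eq_on_dv (hol_on_dv ut2 hf) muE) // dNM.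
have D2 v : dv (fun y => dv f y u2) x v =
    - (nu x * dv (fun y => dv f y u1) x v + dv f x u1 * dv nu x v).
  by rewrite (eq_on_dv (hol_on_dv u2 hf) nuE) // dNM.
have Dt1 v : dv (fun y => dv f y ut1) x v =
    - (mu x * nu x * dv (fun y => dv f y u1) x v +
       dv f x u1 * (mu x * dv nu x v + nu x * dv mu x v)).
  by rewrite (eq_on_dv (hol_on_dv ut1 hf) munuE v xr) (dNM v (holM hmu hnu) hA xr) (dvM v (hmu xr) (hnu xr)).
have [_ /(_ x xr) lap _ _] := H.
apply: (@null_algebra _ (dv f x u1) (mu x) (nu x) _ _ _ _ _ _ _ _
  (dv (fun y => dv f y u1) x u1) (dv (fun y => dv f y u1) x ut1)
  (dv (fun y => dv f y u1) x u2) (dv (fun y => dv f y u1) x ut2) (nz xr)).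
- by rewrite (sym _ _ hf xr) Dt2.
- by rewrite (sym _ _ hf xr) D2.
- by rewrite (sym _ _ hf xr) Dt1.
- by move: lap; rewrite (sym ut1 u1 hf xr) Dt2.
- by apply: oppr_inj; rewrite -Dt2 -D2 (sym ut2 u2 hf xr).
- by apply: oppr_inj; rewrite -Dt2 -Dt1 (sym ut2 ut1 hf xr).
- by apply: oppr_inj; rewrite -D2 (mulrC (mu x)) (addrC (mu x * _)) addrC; rewrite addrC (addrC (nu x * dv mu _ _)) (mulrC (nu x) (mu x)) -Dt1 (sym u2 ut1 hf xr).
Qed.

(** The derivatives of [mu] along [u2] and [ut1] are known from [slope_equations]. When they are
    differentiated crosswise, the terms with second derivatives of [mu] are both [nu ^+ 2] times the
    same one and cancel; the rest is the product. *)
Lemma shear_product x : nrm (x - p) < r ->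
  (dv mu x ut2 + mu x * dv mu x u1) * (dv nu x u2 + nu x * dv nu x u1) = 0.
Proof.
move=> xr; have [e1 e2 e3 e4] := slope_equations xr.
have q1 y : nrm (y - p) < r -> dv mu y u2 = - (nu y * dv mu y u1) by case/slope_equations.
have q3 y : nrm (y - p) < r -> dv mu y ut1 = nu y * dv mu y ut2 by case/slope_equations.
have hM w := hol_on_dv w hmu.
have D2 v : dv (fun y => dv mu y u2) x v =
    - (nu x * dv (fun y => dv mu y u1) x v + dv mu x u1 * dv nu x v).
  by rewrite (eq_on_dv (hM u2) q1) // dNM.
have Dt1 v : dv (fun y => dv mu y ut1) x v =
    nu x * dv (fun y => dv mu y ut2) x v + dv mu x ut2 * dv nu x v.
  by rewrite (eq_on_dv (hM ut1) q3 v xr) (dvM v (hnu xr) (hM ut2 x xr)).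
have s1 := D2 ut1; rewrite (sym _ _ hmu xr) Dt1 in s1.
have s2 := D2 ut2; rewrite (sym _ _ hmu xr) in s2.
have s3 := sym u1 ut1 hmu xr; rewrite Dt1 in s3.
have s4 := sym u1 ut2 hmu xr.
move: s1; rewrite s2 s3 s4 e2 e4 => s1.
apply/eqP; move/eqP: s1; rewrite -subr_eq0 => /eqP s1; apply/eqP.
by rewrite -[RHS]s1; ring.
Qed.

(** Once the factor vanishes, the four derivatives of [mu] stand in the ratios 1, [- mu * nu],
    [- nu], [- mu], which are also those of the derivatives of [f]. *)
Lemma slope_gradient x : nrm (x - p) < r ->
  (forall v, exists c1 ct1 c2 ct2, v = c1 *: u1 + ct1 *: ut1 + c2 *: u2 + ct2 *: ut2) ->
  dv mu x ut2 + mu x * dv mu x u1 = 0 ->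
  forall v, dv mu x v = dv mu x u1 / dv f x u1 * dv f x v.
Proof.
move=> xr basis h v; have [e1 e2 e3 e4] := slope_equations xr.
have e5 : dv mu x ut2 = - (mu x * dv mu x u1).
  by apply/eqP; rewrite -addr_eq0 h.
have [c1 [ct1 [c2 [ct2 ->]]]] := basis v.
rewrite !dvDr !dvZr e1 e3 e5 (muE xr) (nuE xr) (munuE xr).
by field; exact: nz.
Qed.

Lemma slope_shear_dv x : dv mu x (ut2 + mu x *: u1) = dv mu x ut2 + mu x * dv mu x u1.
Proof. by rewrite dvDr dvZr. Qed.

Lemma slope_tangent x : nrm (x - p) < r -> dv f x (ut2 + mu x *: u1) = 0 /\
  dv f x (ut1 - mu x *: u2) = 0.
Proof.
move=> xr; rewrite dvDr dvBr !dvZr (muE xr) (munuE xr) (nuE xr).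
by split; ring.
Qed.

End Local.
End NullFrame.

(** * Frames and plaque charts *)

(** The coordinate forms come with an explicit bound, so that estimates hold in any normed space.
    Duality is recorded for [fu1] and [fu2], the directions used to move transversally to the
    planes. *)
Record frame (R : realType) (V : normedModType (Cx R)) := Frame {
  fu1 : V; fut1 : V; fu2 : V; fut2 : V;
  fk1 : V -> Cx R; fkt1 : V -> Cx R; fk2 : V -> Cx R; fkt2 : V -> Cx R;
  frame_lin : [/\ linear fk1, linear fkt1, linear fk2 & linear fkt2];
  frame_bound : exists2 c : R, 0 < c & forall v,
    [/\ nrm (fk1 v) <= c * nrm v, nrm (fkt1 v) <= c * nrm v,
        nrm (fk2 v) <= c * nrm v & nrm (fkt2 v) <= c * nrm v];
  frame_dec : forall v,
    v = fk1 v *: fu1 + fkt1 v *: fut1 + fk2 v *: fu2 + fkt2 v *: fut2;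
  frame_dual1 : [/\ fk1 fu1 = 1, fkt1 fu1 = 0, fk2 fu1 = 0 & fkt2 fu1 = 0];
  frame_dual2 : [/\ fk1 fu2 = 0, fkt1 fu2 = 0, fk2 fu2 = 1 & fkt2 fu2 = 0]
}.

(** The span of [fut1 e - m *: fu2 e] and [fut2 e + m *: fu1 e], given by equations so that
    membership can be tested on coordinates. *)
Definition plane (R : realType) (V : normedModType (Cx R)) (e : frame V) (m : Cx R) : set V :=
  [set v | fk1 e v = m * fkt2 e v /\ fk2 e v = - (m * fkt1 e v)].

Section LinearForms.
Variables (R : realType) (V : normedModType (Cx R)) (k : V -> Cx R) (c : R).
Hypotheses (kl : linear k) (kb : forall v, nrm (k v) <= c * nrm v).

Lemma formD u v : k (u + v) = k u + k v.
Proof. by have := kl 1 u v; rewrite !scale1r. Qed.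

Lemma formZ a v : k (a *: v) = a * k v.
Proof.
have k0 : k 0 = 0 by have := formD 0 0; rewrite addr0 => /eqP; rewrite -subr_eq0 opprD addNKr oppr_eq0 => /eqP.
by have := kl a v 0; rewrite !addr0 k0 addr0.
Qed.

Lemma formB u v : k (u - v) = k u - k v.
Proof. by rewrite formD -scaleN1r formZ mulN1r. Qed.

Lemma dv_form p x : differentiable (fun y => k (y - p)) x /\
  forall v, dv (fun y => k (y - p)) x v = k v.
Proof.
apply: dv_ext kl kb _ => e e0; exists 1 => // h _.
rewrite /= (addrAC x h) (formD (x - p)) [X in nrm X](_ : _ = 0); last by ring.
by rewrite nrm0 mulr_ge0 ?nrm_ge0 // ltW.
Qed.
End LinearForms.

Section Pairs.
Variable R : realType.

Definition pair2 (a b : Cx R) : 'rV[Cx R]_2 := a *: delta_mx 0 0 + b *: delta_mx 0 1.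

Lemma pair2E a b : (pair2 a b 0 0 = a) * (pair2 a b 0 1 = b).
Proof. by rewrite /pair2 !mxE /= !(mulr1, mulr0, addr0, add0r). Qed.

Lemma pair2_eta (w : 'rV[Cx R]_2) : w = pair2 (w 0 0) (w 0 1).
Proof.
apply/rowP => j; rewrite /pair2 !mxE.
by case: (unliftP 0 j) => [i ->|->]; rewrite ?(ord1 i) /= ?(mulr1, mulr0, addr0, add0r) //;
  congr (w 0 _); apply/val_inj.
Qed.

Lemma pair2_inj a b a' b' : pair2 a b = pair2 a' b' -> a = a' /\ b = b'.
Proof.
move=> e; split.
  by rewrite -(pair2E a b).1 e pair2E.
by rewrite -(pair2E a b).2 e pair2E.
Qed.

Lemma dv_pair2 (V : normedModType (Cx R)) (f g : V -> Cx R) x :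
  differentiable f x -> differentiable g x ->
  differentiable (fun y => pair2 (f y) (g y)) x /\
  forall v, dv (fun y => pair2 (f y) (g y)) x v = pair2 (dv f x v) (dv g x v).
Proof.
move=> df dg; have [c c0 hc] := dv_bounded df; have [d d0 hd] := dv_bounded dg.
set A : R := nrm (delta_mx 0 0 : 'rV[Cx R]_2); set B : R := nrm (delta_mx 0 1 : 'rV[Cx R]_2).
have A0 : 0 <= A := nrm_ge0 _; have B0 : 0 <= B := nrm_ge0 _.
have nb a b : nrm (pair2 a b) <= nrm a * A + nrm b * B.
  by apply: le_trans (nrmD _ _) _; rewrite !nrmZ.
apply: (@dv_ext R V _ _ _ x (c * A + d * B)).
- move=> a u v; rewrite !dv_lin /pair2 !scalerDl !scalerDr !scalerA addrACA.
  by [].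
- move=> h; apply: le_trans (nb _ _) _; rewrite mulrDl lerD //.
    by rewrite mulrAC ler_wpM2r.
  by rewrite mulrAC ler_wpM2r.
move=> e e0.
have e1 : 0 < e / 2 / (A + 1) by rewrite !divr_gt0 //; lra.
have e2 : 0 < e / 2 / (B + 1) by rewrite !divr_gt0 //; lra.
have [b b0 hb] := dvP df e1; have [b' b0' hb'] := dvP dg e2.
exists (Num.min b b'); first by rewrite lt_min b0 b0'.
move=> h; rewrite lt_min => /andP[/hb h1 /hb' h2].
have -> : pair2 (f (x + h)) (g (x + h)) - pair2 (f x) (g x) - pair2 (dv f x h) (dv g x h) =
   pair2 (f (x + h) - f x - dv f x h) (g (x + h) - g x - dv g x h).
  by rewrite /pair2 !scalerBl !opprD (addrACA (f _ *: _)) (addrACA (f _ *: _ - _)).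
apply: le_trans (nb _ _) _; have h0 := nrm_ge0 h.
have i1 : e / 2 / (A + 1) * nrm h * A <= e / 2 * nrm h.
  rewrite mulrAC ler_wpM2r // mulrAC ler_pdivrMr ?ltr_wpDl //.
  by rewrite ler_wpM2l ?lerDl ?ler01 // ltW ?divr_gt0.
have i2 : e / 2 / (B + 1) * nrm h * B <= e / 2 * nrm h.
  rewrite mulrAC ler_wpM2r // mulrAC ler_pdivrMr ?ltr_wpDl //.
  by rewrite ler_wpM2l ?lerDl ?ler01 // ltW ?divr_gt0.
have := ler_wpM2r A0 h1; have := ler_wpM2r B0 h2; lra.
Qed.

End Pairs.

Section Chart.
Variables (R : realType) (V : normedModType (Cx R)) (e : frame V).
Variables (f : V -> Cx R) (p : V) (r : R).
Local Notation u1 := (fu1 e). Local Notation ut1 := (fut1 e).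
Local Notation u2 := (fu2 e). Local Notation ut2 := (fut2 e).
Local Notation k1 := (fk1 e). Local Notation kt1 := (fkt1 e).
Local Notation k2 := (fk2 e). Local Notation kt2 := (fkt2 e).
Hypothesis r0 : 0 < r.
Hypothesis H : null_harmonic f p r u1 ut1 u2 ut2.
Let mu := slope f u1 ut2.
Let nu := slope f u1 u2.
Hypothesis H0 : forall x, nrm (x - p) < r -> dv mu x ut2 + mu x * dv mu x u1 = 0.

Definition chart_fun (x : V) : 'rV[Cx R]_2 := pair2 (f x) (k2 (x - p) + mu x * kt1 (x - p)).

Let hf : hol_on f p r. Proof. by case: H. Qed.
Let nz x : nrm (x - p) < r -> dv f x u1 != 0. Proof. by case: H => _ _ _; apply. Qed.
Let hmu : hol_on mu p r. Proof. exact: hol_on_slope hf nz. Qed.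

(** The bracket is (k1 - mu kt2) - nu (k2 + mu kt1), a combination of the two equations of the plane
    of slope [mu]. *)
Lemma dv_in_frame x v : nrm (x - p) < r ->
  dv f x v = dv f x u1 * (k1 v - mu x * nu x * kt1 v - nu x * k2 v - mu x * kt2 v).
Proof.
move=> xr; have a0 := nz xr; rewrite {1}(frame_dec e v) !dvDr !dvZr.
have [_ _ /(_ x xr) nul _] := H.
have e1 : dv f x ut2 = - (mu x * dv f x u1) by rewrite /mu /slope mulNr opprK divfK.
have e2 : dv f x u2 = - (nu x * dv f x u1) by rewrite /nu /slope mulNr opprK divfK.
have e3 : dv f x ut1 = - (mu x * nu x * dv f x u1).
  apply: (mulfI a0); apply/eqP; rewrite -subr_eq0; apply/eqP.
  by rewrite -[RHS]nul e1 e2; ring.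
by rewrite e1 e2 e3; ring.
Qed.

Let basis v : exists c1 ct1 c2 ct2, v = c1 *: u1 + ct1 *: ut1 + c2 *: u2 + ct2 *: ut2.
Proof. by exists (k1 v), (kt1 v), (k2 v), (kt2 v); exact: frame_dec. Qed.

Let dmu x v : nrm (x - p) < r -> dv mu x v = dv mu x u1 / dv f x u1 * dv f x v.
Proof. by move=> xr; apply: (slope_gradient H xr basis (H0 xr)). Qed.

(** The differential of [mu] is a multiple of df, so modulo df the second component has the
    differential of the affine form with slope frozen at [x]. The directions [u1] and [u2] already
    give surjectivity. *)
Lemma chart_submersion x : nrm (x - p) < r ->
  [/\ differentiable chart_fun x,
      (forall w, exists v, dv chart_fun x v = w) &
      (forall v, dv chart_fun x v = 0 <-> plane e (mu x) v)].
Proof.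
move=> xr; have [l1 l2 l3 l4] := frame_lin e; have [c c0 kb] := frame_bound e.
have [d1 d1E] := dv_form l3 (fun v => let: And4 _ _ h _ := kb v in h) p x.
have [d2 d2E] := dv_form l2 (fun v => let: And4 _ h _ _ := kb v in h) p x.
have d3 : differentiable (fun y => mu y * kt1 (y - p)) x.
  by apply: differentiableM d2; exact: hmu.
have d4 : differentiable (fun y => k2 (y - p) + mu y * kt1 (y - p)) x.
  exact: differentiableD d1 d3.
have [d5 d5E] := dv_pair2 (hf xr) d4.
set l := dv mu x u1 / dv f x u1.
have dE v : dv chart_fun x v =
    pair2 (dv f x v) (k2 v + (mu x * kt1 v + kt1 (x - p) * (l * dv f x v))).
  by rewrite d5E (dvD _ d1 d3) d1E (dvM _ (hmu xr) d2) d2E dmu.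
have a0 := nz xr.
split=> // [w|v].
  pose c2 := w 0 1 - kt1 (x - p) * (l * w 0 0).
  pose c1 := w 0 0 / dv f x u1 + nu x * c2.
  exists (c1 *: u1 + c2 *: u2).
  have [b1 b2 b3 b4] := frame_dual1 e; have [b5 b6 b7 b8] := frame_dual2 e.
  have fE : dv f x (c1 *: u1 + c2 *: u2) = w 0 0.
    rewrite (dv_in_frame _ xr) (formD l1) (formD l2) (formD l3) (formD l4).
    rewrite !(formZ l1) !(formZ l2) !(formZ l3) !(formZ l4) b1 b2 b3 b4 b5 b6 b7 b8.
    by rewrite /c1; field.
  rewrite dE fE (formD l2) (formD l3) !(formZ l2) !(formZ l3) b2 b3 b6 b7.
  rewrite [RHS]pair2_eta; congr pair2; rewrite /c2; ring.
rewrite dE (dv_in_frame _ xr) /plane /=; split.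
  have -> : 0 = pair2 0 0 :> 'rV[Cx R]_2 by rewrite /pair2 !scale0r addr0.
  move=> /pair2_inj[/eqP]; rewrite mulf_eq0 (negbTE a0) /= => /eqP e1.
  rewrite e1 !mulr0 addr0 => /eqP; rewrite addr_eq0 => /eqP e2; split=> //.
  by apply/eqP; rewrite -subr_eq0; apply/eqP; rewrite -[RHS]e1 e2; ring.
move=> [e1 e2]; rewrite e1 e2 /pair2.
rewrite (_ : _ - mu x * kt2 v = 0); last by ring.
by rewrite !mulr0 addr0 addNr !scale0r addr0.
Qed.

End Chart.

(** * Level sets and local sections of the plaque charts *)

Section ChartLevels.
Variables (R : realType) (V : normedModType (Cx R)) (e : frame V).
Variables (f : V -> Cx R) (p : V) (r : R).
Local Notation u1 := (fu1 e). Local Notation ut1 := (fut1 e).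
Local Notation u2 := (fu2 e). Local Notation ut2 := (fut2 e).
Local Notation k1 := (fk1 e). Local Notation kt1 := (fkt1 e).
Local Notation k2 := (fk2 e). Local Notation kt2 := (fkt2 e).
Hypothesis r0 : 0 < r.
Hypothesis H : null_harmonic f p r u1 ut1 u2 ut2.
Local Notation mu := (slope f u1 ut2).
Local Notation nu := (slope f u1 u2).
Hypothesis H0 : forall x, nrm (x - p) < r -> dv mu x ut2 + mu x * dv mu x u1 = 0.
Local Notation chart := (chart_fun e f p).

Let hf : hol_on f p r. Proof. by case: H. Qed.
Let nz x : nrm (x - p) < r -> dv f x u1 != 0. Proof. by case: H => _ _ _; apply. Qed.
Let hmu : hol_on mu p r. Proof. exact: hol_on_slope hf nz. Qed.
Let hnu : hol_on nu p r. Proof. exact: hol_on_slope hf nz. Qed.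
Let pp s : 0 < s -> nrm (p - p) < s. Proof. by rewrite subrr nrm0. Qed.
Let holfp : hol f p. Proof. by exists r. Qed.
Let basis v : exists c1 ct1 c2 ct2, v = c1 *: u1 + ct1 *: ut1 + c2 *: u2 + ct2 *: ut2.
Proof. by exists (k1 v), (kt1 v), (k2 v), (kt2 v); exact: frame_dec. Qed.

(* Along a segment in [plane e (mu x)] the function [f - f x] satisfies
   |f'| <= C |f - f x|, because the slope is a Lipschitz function of [f]. *)
Lemma const_along_plane (L K D B0 : R) : 0 < D -> D <= r -> 0 <= L -> 0 <= K ->
  8 * (K * L) * D <= 1 ->
  (forall x y, nrm (x - p) < D -> nrm (y - p) < D -> nrm (mu y - mu x) <= L * nrm (f y - f x)) ->
  (forall z v, nrm (z - p) < D -> nrm (dv f z u1 * (kt2 v + nu z * kt1 v)) <= K * nrm v) ->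
  (forall x, nrm (x - p) < D -> nrm (f x - f p) <= B0) ->
  forall x y, nrm (x - p) < D -> nrm (y - p) < D -> plane e (mu x) (y - x) -> f y = f x.
Proof.
move=> D0 Dr L0 K0 KL muL Kb fB x y xD yD [e1 e2].
set v := y - x in e1 e2 *; set m := mu x in e1 e2 *.
have vD : nrm v <= 2 * D by have := nrm_tri y p x; rewrite (nrmC p x) /v; lra.
have inD s : 0 <= s <= 1 -> nrm (x + CC s *: v - p) < D by exact: seg_near.
(* As [v] lies in the plane of slope [m], only the mismatch between [m] and the slope at [z]
   survives in the derivative along [v]. *)
have dE z : nrm (z - p) < D ->
    dv f z v = (m - mu z) * (dv f z u1 * (kt2 v + nu z * kt1 v)).
  move=> zD; rewrite (dv_in_frame H _ (lt_le_trans zD Dr)) e1 e2; ring.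
pose B := 2 * B0.
have hB s : 0 <= s <= 1 -> nrm (f (x + CC s *: v) - f x) <= B.
  move=> s01; have := fB _ (inD s s01); have := fB x xD.
  by have := nrm_tri (f (x + CC s *: v)) (f p) (f x); rewrite (nrmC (f p)) /B; lra.
(* Each pass halves the bound: [8 * (K * L) * D <= 1] and |v| at most 2 D bound the derivative by a
   quarter of the previous bound, and [mean_value] doubles this. All [s] are treated together
   because the estimate at [s] uses the bound at every [t * s]. *)
have key n : forall s, 0 <= s <= 1 -> nrm (f (x + CC s *: v) - f x) <= B / 2 ^+ n.
  elim: n => [|n IH] s s01; first by rewrite expr0 divr1; exact: hB.
  apply: le_trans (@mean_value R V f x (CC s *: v) (B / 2 ^+ n / 4) _) _; last first.
    by rewrite exprS invfM; lra.
  move=> t t01 z.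
  have st01 : 0 <= t * s <= 1 by move/andP: t01 s01 => [? ?] /andP[? ?]; apply/andP; split; nra.
  have zE : z = x + CC (t * s) *: v by rewrite /z scalerA rmorphM.
  have zD : nrm (z - p) < D by rewrite zE; exact: inD.
  split; first by apply: hf; exact: lt_le_trans Dr.
  rewrite dvZr (dE _ zD) !nrmM nrmR; move/andP: s01 => [s0 s1]; rewrite (ger0_norm s0).
  have h1 := muL z x zD xD; rewrite -/m (nrmC (f x)) in h1.
  have h2 := IH _ st01; rewrite -zE in h2.
  have h3 := Kb z v zD; rewrite nrmM in h3.
  have h4 := ler_wpM2l L0 h2.
  have B2 : 0 <= B / 2 ^+ n by exact: le_trans (nrm_ge0 _) h2.
  move: (B / 2 ^+ n) B2 h4 => b b0 h4 {h2 IH}.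
  have h5 : nrm (m - mu z) * (nrm (dv f z u1) * nrm (kt2 v + nu z * kt1 v)) <=
     L * b * (K * nrm v).
    apply: ler_pM => //; rewrite ?nrm_ge0 ?mulr_ge0 ?nrm_ge0 //; exact: le_trans h1 h4.
  have X0 : 0 <= nrm (m - mu z) * (nrm (dv f z u1) * nrm (kt2 v + nu z * kt1 v)).
    by rewrite !mulr_ge0 ?nrm_ge0.
  apply: (@le_trans _ _ (nrm (m - mu z) * (nrm (dv f z u1) * nrm (kt2 v + nu z * kt1 v)))).
    by rewrite ler_piMl.
  apply: le_trans h5 _.
  have h6 : K * L * nrm v <= K * L * (2 * D) by rewrite ler_wpM2l // mulr_ge0.
  have -> : L * b * (K * nrm v) = b * (K * L * nrm v) by ring.
  have := ler_wpM2l b0 h6; nra.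
have := fun n => key n 1; rewrite scale1r /v subrKC => H1.
apply/eqP; rewrite -subr_eq0; apply/eqP/nrm_eq0/le_anti; rewrite nrm_ge0 andbT.
apply/ler_addgt0Pr => c c0; rewrite add0r.
have [n hn] := @small_half_pow R B c c0; apply: le_trans (ltW hn).
by apply: H1; rewrite ler01 lexx.
Qed.

Let chartE x : chart x = pair2 (f x) (k2 (x - p) + mu x * kt1 (x - p)).
Proof. by []. Qed.

Lemma coord_cont (j : 'I_2) (w : 'rV[Cx R]_2) : differentiable (fun y : 'rV[Cx R]_2 => y 0 j) w.
Proof. exact: differentiable_coord. Qed.

(** The first coordinate of [y] prescribes the value of [f], hence the slope [rho (y 0 0)]. [T] is
    the shift along [u2] that then yields the second coordinate, and [S] the shift along [u1] that
    corrects the affine model of [f]. Applying [Psi] moves the point along [u1] only, which [k2] and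
    [kt1] do not see. *)
Lemma chart_section (rho : Cx R -> Cx R) (D eps r1 : R) (Psi : V -> V) x :
  (forall z, nrm (z - f p) < eps -> differentiable rho z) ->
  (forall x, nrm (x - p) < D -> nrm (f x - f p) < eps /\ mu x = rho (f x)) ->
  (forall y, nrm (y - p) < r1 ->
        [/\ nrm (Psi y - p) < D, differentiable Psi y,
            f (Psi y) = f p + dv f p (y - p) & exists t, Psi y = y + t *: u1]) ->
  nrm (x - p) < D -> nrm (shear f p u1 x - p) < r1 -> Psi (shear f p u1 x) = x ->
  exists s : 'rV[Cx R]_2 -> V, s (chart x) = x /\
    \forall y \near chart x, differentiable s y /\ chart (s y) = y.
Proof.
move=> drho muE A xD shr shE.
set a := dv f p u1; have a0 : a != 0 by exact: nz (pp r0).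
pose T (y : 'rV[Cx R]_2) := y 0 1 - k2 (x - p) - rho (y 0 0) * kt1 (x - p).
pose S (y : 'rV[Cx R]_2) := (y 0 0 - f p - dv f p (x - p) - T y * dv f p u2) * a^-1.
pose arg y := x + (T y *: u2 + S y *: u1).
have [fxe mux] := muE x xD.
have Tx : T (chart x) = 0 by rewrite /T chartE !pair2E mux; ring.
have argx : arg (chart x) = shear f p u1 x.
  by rewrite /arg Tx scale0r add0r /S Tx mul0r subr0 chartE pair2E.
have dT (y : 'rV[Cx R]_2) : nrm (y 0 0 - f p) < eps -> differentiable T y.
  move=> ye.
  have h1 : differentiable (fun y : 'rV[Cx R]_2 => y 0 1 - k2 (x - p)) y.
    exact: differentiableB (coord_cont 1 y) (differentiable_cst _ _).
  have h2 := @differentiable_comp _ _ _ _ (fun y : 'rV[Cx R]_2 => y 0 0) rho y (coord_cont 0 y) (drho _ ye).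
  exact: differentiableB h1 (differentiableM h2 (differentiable_cst (kt1 (x - p)) y)).
have dS (y : 'rV[Cx R]_2) : nrm (y 0 0 - f p) < eps -> differentiable S y.
  move=> ye.
  have h1 : differentiable (fun y : 'rV[Cx R]_2 => y 0 0 - f p) y.
    exact: differentiableB (coord_cont 0 y) (differentiable_cst _ _).
  have h2 := differentiableB h1 (differentiable_cst (dv f p (x - p)) y).
  have h3 := differentiableB h2 (differentiableM (dT y ye) (differentiable_cst (dv f p u2) y)).
  exact: differentiableM h3 (differentiable_cst a^-1 y).
have darg (y : 'rV[Cx R]_2) : nrm (y 0 0 - f p) < eps -> differentiable arg y.
  move=> ye; apply: differentiableD (differentiable_cst x y) _.
  exact: differentiableD (differentiableZl u2 (dT y ye)) (differentiableZl u1 (dS y ye)).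
have fx0 : nrm (chart x 0 0 - f p) < eps by rewrite chartE pair2E.
have n1 : \forall y \near chart x, nrm ((y : 'rV[Cx R]_2) 0 0 - f p) < eps.
  have e0 : 0 < eps - nrm (chart x 0 0 - f p) by rewrite subr_gt0.
  have [d d0 hd] := cont_nrm (differentiable_continuous (coord_cont 0 (chart x))) e0.
  apply/near_nrmP; exists d => // y /hd.
  by have := nrm_tri (y 0 0) (chart x 0 0) (f p); lra.
have n2 : \forall y \near chart x, nrm (arg y - p) < r1.
  have e0 : 0 < r1 - nrm (arg (chart x) - p) by rewrite subr_gt0 argx.
  have [d d0 hd] := cont_nrm (differentiable_continuous (darg _ fx0)) e0.
  apply/near_nrmP; exists d => // y /hd.
  by have := nrm_tri (arg y) (arg (chart x)) p; lra.
exists (fun y => Psi (arg y)); split; first by rewrite argx.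
move: n1 n2; apply: filterS2 => y ye yr.
have [sD dP fP [t tE]] := A _ yr.
split; first exact: (@differentiable_comp _ _ _ _ arg Psi y (darg _ ye) dP).
have [l1 l2 l3 l4] := frame_lin e.
have [b1 b2 b3 b4] := frame_dual1 e; have [b5 b6 b7 b8] := frame_dual2 e.
have fs : f (Psi (arg y)) = y 0 0.
  rewrite fP /arg (addrAC x) (dvDr _ _ (x - p)) (dvDr _ _ (_ *: _)) !dvZr -/a /S divfK //; ring.
have [_ mus] := muE _ sD.
rewrite chartE fs mus fs [RHS]pair2_eta; congr pair2.
have -> : Psi (arg y) - p = (x - p) + (T y *: u2 + (S y + t) *: u1).
  rewrite tE /arg scalerDl; move: (T y *: u2) (S y *: u1) (t *: u1) => a' b' c'.
  by rewrite -!addrA; congr (x + _); rewrite !addrA [LHS]addrC !addrA.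
rewrite (formD l3 (x - p)) (formD l2 (x - p)) (formD l3 (_ *: _)) (formD l2 (_ *: _)).
by rewrite !(formZ l3) !(formZ l2) b7 b6 b3 b2 /T; ring.
Qed.

Theorem chart_exists : exists (rho : Cx R -> Cx R) (d eps : R),
  [/\ [/\ 0 < d, d <= r, 0 < eps & forall z, nrm (z - f p) < eps -> differentiable rho z],
      (forall x, nrm (x - p) < d -> nrm (f x - f p) < eps /\ mu x = rho (f x)),
      (forall x y, nrm (x - p) < d -> nrm (y - p) < d ->
         (chart x = chart y <-> plane e (mu x) (y - x))) &
      (forall x, nrm (x - p) < d -> exists s : 'rV[Cx R]_2 -> V, s (chart x) = x /\
         \forall y \near chart x, differentiable s y /\ chart (s y) = y)].
Proof.
have a0 : dv f p u1 != 0 by exact: nz (pp r0).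
have prop x : nrm (x - p) < r -> exists l, forall v, dv mu x v = l * dv f x v.
  by move=> xr; exists (dv mu x u1 / dv f x u1) => v; exact: slope_gradient H _ xr basis (H0 xr) v.
have [rho [d1 [eps [d10 eps0 drho muE]]]] := factor_through holfp a0 r0 hmu prop hf.
have hrho : hol rho (f p) by exists eps.
have [s [M [s0 hs rM]]] := hol_bounded hrho.
have s2 : 0 < Num.min (s / 2) 1 by rewrite lt_min ltr01 divr_gt0.
have [d2 d20 fd2] := cont_nrm (differentiable_continuous (hol_diff holfp)) s2.
have [d3 d30 A1] := continuous_bounded_near (differentiable_continuous (hol_on_dv u1 hf (pp r0))).
have [d4 d40 N1] := continuous_bounded_near (differentiable_continuous (hnu (pp r0))).
have [d5 d50 M1] := continuous_bounded_near (differentiable_continuous (hmu (pp r0))).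
have [c c0 kb] := frame_bound e.
have u10 : u1 != 0 by apply: contraNneq a0 => ->; rewrite dv0.
have nu1 := nrm_gt0 u10.
move: (nrm (dv f p u1) + 1) A1 => AA A1.
move: (nrm (nu p) + 1) N1 => NN N1.
move: (nrm (mu p) + 1) M1 => MM M1.
have AA0 : 0 <= AA by exact: le_trans (nrm_ge0 _) (A1 p (pp d30)).
have NN0 : 0 <= NN by exact: le_trans (nrm_ge0 _) (N1 p (pp d40)).
have MM0 : 0 <= MM by exact: le_trans (nrm_ge0 _) (M1 p (pp d50)).
have M0 : 0 <= M by apply: le_trans (nrm_ge0 _) (rM (f p) _); rewrite subrr nrm0.
pose L := 256 * M / s.
have L0 : 0 <= L by rewrite /L divr_ge0 ?mulr_ge0 ?(ltW s0).
pose K := AA * (c + NN * c).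
have K0 : 0 <= K by rewrite /K mulr_ge0 ?addr_ge0 ?mulr_ge0 ?(ltW c0).
pose C := (c + MM * c) * nrm u1.
have C0 : 0 <= C by rewrite /C !mulr_ge0 ?addr_ge0 ?mulr_ge0 ?(ltW c0) ?(ltW nu1).
pose D := Num.min (Num.min r (Num.min d1 d2)) (Num.min (Num.min d3 d4) (Num.min d5 (1 / (8 * (K * L) + 1)))).
have KL0 : 0 <= K * L by rewrite mulr_ge0.
have KL1 : 0 < 8 * (K * L) + 1 by lra.
have D0 : 0 < D by rewrite /D !lt_min r0 d10 d20 d30 d40 d50 divr_gt0.
have : D <= D by []. rewrite {2}/D !le_min => /andP[/andP[Dr /andP[Dd1 Dd2]] /andP[/andP[Dd3 Dd4] /andP[Dd5 DK]]].
clearbody D.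
have DKL : 8 * (K * L) * D <= 1 by move: DK; rewrite ler_pdivlMr //; lra.
have muL x y : nrm (x - p) < D -> nrm (y - p) < D -> nrm (mu y - mu x) <= L * nrm (f y - f x).
  move=> xD yD; have [_ ->] := muE x (lt_le_trans xD Dd1); have [_ ->] := muE y (lt_le_trans yD Dd1).
  have := fd2 x (lt_le_trans xD Dd2); have := fd2 y (lt_le_trans yD Dd2).
  rewrite !lt_min => /andP[fy _] /andP[fx _].
  exact: lipschitz_half s0 hs rM fx fy.
have Kb z v : nrm (z - p) < D -> nrm (dv f z u1 * (kt2 v + nu z * kt1 v)) <= K * nrm v.
  move=> zD; rewrite nrmM /K -mulrA; apply: ler_pM; rewrite ?nrm_ge0 //.
    by apply: A1; exact: lt_le_trans Dd3.
  apply: le_trans (nrmD _ _) _; rewrite mulrDl; have [_ b2 _ b4] := kb v.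
  apply: lerD => //; rewrite nrmM -mulrA; apply: ler_pM; rewrite ?nrm_ge0 //.
  by apply: N1; exact: lt_le_trans Dd4.
have fB x : nrm (x - p) < D -> nrm (f x - f p) <= 1.
  by move=> xD; have := fd2 x (lt_le_trans xD Dd2); rewrite lt_min => /andP[_ /ltW].
have along := const_along_plane D0 Dr L0 K0 DKL muL Kb fB.
have [b [r1 [Psi [[b0 bD r10 Pp] A B inj dP]]]] := straighten_near holfp a0 D0.
(* [C] bounds the correction along [u1] relative to the distance of two points; with this radius the
   corrected point [x'] below stays in the ball of radius [b]. *)
pose d := b / (1 + 2 * C).
have C1 : 0 < 1 + 2 * C by lra.
have d0 : 0 < d by rewrite divr_gt0.
have dC : d * (1 + 2 * C) = b by rewrite /d divfK // gt_eqF.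
have db : d <= b by rewrite -dC ler_peMr ?(ltW d0) //; lra.
have dD : d <= D by exact: le_trans bD.
exists rho, d, eps; split.
- by split=> //; exact: le_trans Dr.
- by move=> x xd; apply: muE; apply: lt_le_trans xd _; exact: le_trans Dd1.
- move=> x y xd yd.
  have [l1 l2 l3 l4] := frame_lin e.
  have [b1 b2 b3 b4] := frame_dual1 e.
  have xD := lt_le_trans xd dD; have yD := lt_le_trans yd dD.
  have [_ mux] := muE x (lt_le_trans xD Dd1); have [_ muy] := muE y (lt_le_trans yD Dd1).
  have yx : y - p = (x - p) + (y - x) by rewrite [RHS]addrC addrA subrK.
  rewrite !chartE; split=> [/pair2_inj[fxy]|].
    rewrite muy -fxy -mux yx (formD l3 (x - p)) (formD l2 (x - p)) => hh.
    have k2E : k2 (y - x) = - (mu x * kt1 (y - x)).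
      by apply/eqP; rewrite -subr_eq0; apply/eqP; rewrite -[RHS](subrr (k2 (x - p) + mu x * kt1 (x - p))) {1}hh; ring.
    (* Equal chart values give only one of the two equations of the plane, and [t] is the defect in
       the other. Moving [y] by [- t] along [u1] gives a point [x'] in the plane through [x], where
       [f] takes the value [f x = f y]; injectivity of [f] along [u1] forces [t = 0]. *)
    pose t := k1 (y - x) - mu x * kt2 (y - x).
    pose x' := y - t *: u1.
    have tC : nrm (t *: u1) <= C * nrm (y - x).
      rewrite nrmZ /C mulrAC ler_wpM2r ?(ltW nu1) //.
      apply: le_trans (nrmB _ _) _; rewrite mulrDl; have [b5 _ _ b6] := kb (y - x).
      apply: lerD => //; rewrite nrmM -mulrA; apply: ler_pM; rewrite ?nrm_ge0 //.
      by apply: M1; exact: lt_le_trans Dd5.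
    have yxd : nrm (y - x) <= 2 * d.
      apply: le_trans (nrm_tri y p x) _; rewrite (nrmC p x) mulr_natl mulr2n.
      by apply: lerD; apply: ltW.
    have x'b : nrm (x' - p) < b.
      rewrite /x' addrAC; apply: le_lt_trans (nrmB _ _) _.
      have := ler_wpM2l C0 yxd; rewrite -dC; lra.
    have pl : plane e (mu x) (x' - x).
      rewrite /x' addrAC /plane /= !(formB l1) !(formB l2) !(formB l3) !(formB l4).
      rewrite !(formZ l1) !(formZ l2) !(formZ l3) !(formZ l4) b1 b2 b3 b4.
      rewrite -(formB l1) -(formB l2) -(formB l3) -(formB l4) k2E /t.
      by split; ring.
    have x'D := lt_le_trans x'b bD.
    have fx' := along x x' xD x'D pl.
    have yE : y = x' + t *: u1 by rewrite /x' subrK.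
    have t0 : t = 0.
      apply: (inj x' t) => //; rewrite -yE; first exact: lt_le_trans db.
      by rewrite fx' fxy.
    split=> //; apply/eqP; rewrite -subr_eq0; apply/eqP; exact: t0.
  move=> pl; have fyx := along x y xD yD pl; have [e1 e2] := pl.
  rewrite fyx muy fyx -mux yx (formD l3 (x - p)) (formD l2 (x - p)) e2; congr pair2; ring.
move=> x xd; have xb := lt_le_trans xd db; have [shr shE] := B x xb.
apply: (chart_section drho _ A (lt_le_trans xd dD) shr shE) => z zD.
by apply: muE; exact: lt_le_trans Dd1.
Qed.

End ChartLevels.

(** * Null coordinates and null planes *)

(* [c] selects the index 1 or 2 of the null coordinate, [t] whether it carries a tilde. *)
HB.lock Definition nullv (R : realType) (c t : bool) : 'rV[Cx R]_4 :=
  if c then (if t then vqt2 R else vq2 R) else (if t then vqt1 R else vq1 R).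

HB.lock Definition nullq (R : realType) (c t : bool) (v : 'rV[Cx R]_4) : Cx R :=
  let a := if c then 2%N else 0%N in
  if t then v 0 (inord a) - Ci R * v 0 (inord a.+1) else v 0 (inord a) + Ci R * v 0 (inord a.+1).

Section NullCoordinates.
Variable R : realType.
Local Notation V := ('rV[Cx R]_4).
Local Notation I := (Ci R).
Local Notation nullv := (nullv R).
Local Notation nullq := (@nullq R).
Implicit Types (v w : V).

Lemma inord4_eq (a b : nat) : (a < 4)%N -> (b < 4)%N -> (inord a == inord b :> 'I_4) = (a == b).
Proof.
move=> ha hb; apply/eqP/eqP => [/(congr1 val)|-> //].
by rewrite /= !inordK.
Qed.

Lemma row4_eq v w : v 0 (inord 0) = w 0 (inord 0) -> v 0 (inord 1) = w 0 (inord 1) ->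
  v 0 (inord 2) = w 0 (inord 2) -> v 0 (inord 3) = w 0 (inord 3) -> v = w.
Proof.
move=> h0 h1 h2 h3; apply/rowP => j; rewrite -(inord_val j).
by case: j => [[|[|[|[|j]]]] //= _].
Qed.

Lemma std_vecE (a b : nat) : (a < 4)%N -> (b < 4)%N ->
  std_vec R (inord a) 0 (inord b) = (a == b)%:R.
Proof. by move=> ha hb; rewrite /std_vec mxE /= inord4_eq // eq_sym. Qed.

Lemma CiCi : I * I = -1. Proof. by rewrite -expr2 /Ci sqr_i. Qed.
Let combD (a : Cx R) (A B : V) j : (2^-1 *: (A + a *: B)) 0 j = 2^-1 * (A 0 j + a * B 0 j).
Proof. by rewrite !mxE. Qed.

Let combB (a : Cx R) (A B : V) j : (2^-1 *: (A - a *: B)) 0 j = 2^-1 * (A 0 j - a * B 0 j).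
Proof. by rewrite !mxE. Qed.

Let comb4 (a b c d : Cx R) (A B C D : V) j :
  (a *: A + b *: B + c *: C + d *: D) 0 j = a * A 0 j + b * B 0 j + c * C 0 j + d * D 0 j.
Proof. by rewrite !mxE. Qed.

Lemma nullvE c t (b : nat) : (b < 4)%N -> nullv c t 0 (inord b) =
  2^-1 * (((if c then 2 else 0)%N == b)%:R + (if t then I else - I) * ((if c then 3 else 1)%N == b)%:R).
Proof.
move=> hb; case: c; case: t; rewrite nullv.unlock /vq1 /vqt1 /vq2 /vqt2;
  by rewrite ?combD ?combB !std_vecE // mulNr.
Qed.

Let lt0 : (0 < 4)%N. Proof. by []. Qed.
Let lt1 : (1 < 4)%N. Proof. by []. Qed.
Let lt2 : (2 < 4)%N. Proof. by []. Qed.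
Let lt3 : (3 < 4)%N. Proof. by []. Qed.

Lemma null_dec v : v = nullq false false v *: nullv false false + nullq false true v *: nullv false true
  + nullq true false v *: nullv true false + nullq true true v *: nullv true true.
Proof.
have E0 c t := nullvE c t lt0; have E1 c t := nullvE c t lt1.
have E2 c t := nullvE c t lt2; have E3 c t := nullvE c t lt3.
move: nullv E0 E1 E2 E3 => n E0 E1 E2 E3.
apply: row4_eq; rewrite comb4 nullq.unlock /=.
- rewrite !E0; move: (v 0 (inord 0)) (v 0 (inord 1)) I CiCi => a b J JJ.
  by rewrite /= !(mulr0, mulr1, addr0, add0r); field.
- rewrite !E1; move: (v 0 (inord 0)) (v 0 (inord 1)) I CiCi => a b J JJ.
  rewrite /= !(mulr0, mulr1, addr0, add0r).
  by rewrite -{1}[b]opprK -[- b]mulN1r -JJ; field.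
- rewrite !E2; move: (v 0 (inord 2)) (v 0 (inord 3)) I CiCi => a b J JJ.
  by rewrite /= !(mulr0, mulr1, addr0, add0r); field.
- rewrite !E3; move: (v 0 (inord 2)) (v 0 (inord 3)) I CiCi => a b J JJ.
  rewrite /= !(mulr0, mulr1, addr0, add0r).
  by rewrite -{1}[b]opprK -[- b]mulN1r -JJ; field.
Qed.

Lemma nullq_dual c t c' t' : nullq c t (nullv c' t') = ((c == c') && (t == t'))%:R.
Proof.
have half : (2^-1 : Cx R) + 2^-1 = 1 by field.
have E0 := nullvE c' t' lt0; have E1 := nullvE c' t' lt1.
have E2 := nullvE c' t' lt2; have E3 := nullvE c' t' lt3.
rewrite nullq.unlock; move: (nullv c' t') E0 E1 E2 E3 => w.
move: I CiCi => J JJ; have J2 : J * (2^-1 * J) = - 2^-1 by rewrite mulrCA JJ mulrN1.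
case: c; case: t; case: c'; case: t' => /=;
  move: (w 0 (inord 0)) (w 0 (inord 1)) (w 0 (inord 2)) (w 0 (inord 3)) => w0 w1 w2 w3 E0 E1 E2 E3; rewrite ?E0 ?E1 ?E2 ?E3;
  rewrite ?(mulr0, mulr1, addr0, add0r, subr0, mulrN, mulNr, J2, oppr0, opprK) ?half ?subrr ?addNr //.
Qed.

Lemma nullq_linear c t : linear (nullq c t).
Proof. by move=> a u v; case: c; case: t; rewrite nullq.unlock /= !mxE -[a *: _]/(a * _); ring. Qed.

Lemma nullq_bound : exists2 b : R, 0 < b & forall c t v, nrm (nullq c t v) <= b * nrm v.
Proof.
have H (j : 'I_4) : exists2 b : R, 0 < b & forall v, nrm (v 0 j) <= b * nrm v.
  have d := @differentiable_coord (Cx R) 1 4 0 0 j.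
  have [b b0 hb] := diff_bound d; exists b => // v.
  have l : linear (fun N : V => N 0 j : Cx R) by move=> a u w; rewrite !mxE.
  pose LM := GRing.isLinear.Build _ _ _ _ _ l.
  pose L : {linear V -> Cx R} := HB.pack (fun N : V => N 0 j : Cx R) LM.
  have := hb v; rewrite (_ : 'd _ _ v = v 0 j) //.
  by have := @diff_lin (Cx R) V (Cx R) L 0 (@coord_continuous (Cx R) 1 4 0 j) => /(congr1 (fun G => G v)).
have [b0 p0 h0] := H (inord 0); have [b1 p1 h1] := H (inord 1).
have [b2 p2 h2] := H (inord 2); have [b3 p3 h3] := H (inord 3).
exists (b0 + b1 + b2 + b3); first by lra.
have I1 : nrm I = 1.
  by apply/eqP; rewrite -(@eqrXn2 _ 2) ?nrm_ge0 // nrm_sqr /= expr0n add0r.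
move=> c t v; have := h0 v; have := h1 v; have := h2 v; have := h3 v; have := nrm_ge0 v.
rewrite nullq.unlock; case: c; case: t => /=; move=> *;
  (apply: le_trans (nrmB _ _) _ || apply: le_trans (nrmD _ _) _); rewrite nrmM I1 mul1r; nra.
Qed.

End NullCoordinates.

Section NullFrames.
Variable R : realType.
Local Notation V := ('rV[Cx R]_4).
Local Notation nullq := (@nullq R).
Implicit Types (v : V) (w : V -> Cx R).

(* [c] selects the index (1 or 2) of the first vector, [t] whether it carries a
   tilde, and [s] exchanges q_2 and q~_2 as in the definition of beta-planes. *)
Definition nframe (c t s : bool) : frame V.
Proof.
refine (@Frame R V (nullv R c t) (nullv R c (~~ t)) (nullv R (~~ c) (t (+) s)) (nullv R (~~ c) (~~ (t (+) s)))
  (nullq c t) (nullq c (~~ t)) (nullq (~~ c) (t (+) s)) (nullq (~~ c) (~~ (t (+) s))) _ _ _ _ _).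
- by split; exact: nullq_linear.
- by have [b b0 h] := nullq_bound R; exists b => // v; split; exact: h.
- move=> v; rewrite {1}(null_dec v).
  case: c; case: t; case: s => /=; move: (_ *: nullv R false false) (_ *: nullv R false true)
    (_ *: nullv R true false) (_ *: nullv R true true) => A B C D.
  + by rewrite -addrA addrC (addrC C) addrA.
  + by rewrite -addrA addrC (addrC C) addrA addrAC.
  + by rewrite -[LHS]addrA [LHS]addrC addrA addrAC.
  + by rewrite -addrA addrC addrA.
  + by rewrite (addrC A).
  + by rewrite (addrC A) addrAC.
  + by rewrite addrAC.
  + by [].
- by rewrite !nullq_dual; case: c; case: t; case: s.
- by rewrite !nullq_dual; case: c; case: t; case: s.
Defined.

(* In terms of the components of a null covector [w], the vectors tangent to its
   self-dual (or anti-self-dual) plane; homogeneous in [w]. *)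
Definition null_eqs (e : frame V) w v : Prop :=
  [/\ w (fu2 e) * fk1 e v = w (fut1 e) * fkt2 e v,
      w (fu2 e) * fk2 e v = - (w (fut1 e) * fkt1 e v),
      w (fu1 e) * fk1 e v = - (w (fut2 e) * fkt2 e v) &
      w (fu1 e) * fk2 e v = w (fut2 e) * fkt1 e v].

Definition tangent_plane (s : bool) w : set V := [set v | null_eqs (nframe false false s) w v].

(** Changing [c] or [t] only permutes the four equations up to sign, so the plane depends on the
    covector and on the type alone. *)
Lemma null_eqs_nframe c t s w v : null_eqs (nframe c t s) w v <-> tangent_plane s w v.
Proof.
have sw (a b : Cx R) : a = - b <-> b = - a by split=> ->; rewrite opprK.
rewrite /tangent_plane /null_eqs /=.
by case: c; case: t; case: s => /=; split=> -[e1 e2 e3 e4]; split;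
  first [exact: e1|exact: e2|exact: e3|exact: e4|exact: esym e1|exact: esym e2
  |exact: esym e3|exact: esym e4|exact/sw|exact/sw/esym
  |rewrite ?e1 ?e2 ?e3 ?e4 ?opprK; first [done|by rewrite -?e1 -?e2 -?e3 -?e4 ?opprK]].
Qed.

Lemma null_eqs_plane (e : frame V) w v : w (fu1 e) != 0 ->
  w (fu1 e) * w (fut1 e) + w (fu2 e) * w (fut2 e) = 0 ->
  null_eqs e w v <-> plane e (- (w (fut2 e) / w (fu1 e))) v.
Proof.
move=> a0 nul; rewrite /null_eqs /plane /=.
move: (w (fu1 e)) (w (fut1 e)) (w (fu2 e)) (w (fut2 e)) a0 nul => a b c d a0 nul.
have bE : b = - (c * d / a).
  by apply: (mulfI a0); apply/eqP; rewrite -subr_eq0; apply/eqP; rewrite -[RHS]nul; field.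
split=> [[_ _ e3 e4]|[e1 e2]].
  split; apply: (mulfI a0).
    by rewrite e3; field.
  by rewrite e4; field.
by rewrite e1 e2 bE; split; field.
Qed.

Lemma tangent_plane_scale s w w' (h : Cx R) : h != 0 -> (forall v, w' v = h * w v) ->
  tangent_plane s w' = tangent_plane s w.
Proof.
move=> h0 hw; apply/seteqP; split=> v; rewrite /tangent_plane /null_eqs /= !hw => -[e1 e2 e3 e4];
  split.
- by apply: (mulfI h0); rewrite !mulrA.
- by apply: (mulfI h0); rewrite mulrN !mulrA.
- by apply: (mulfI h0); rewrite mulrN !mulrA.
- by apply: (mulfI h0); rewrite !mulrA.
- by rewrite -!mulrA e1.
- by rewrite -!mulrA e2 mulrN.
- by rewrite -!mulrA e3 mulrN.
- by rewrite -!mulrA e4.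
Qed.

Definition spanb (s : bool) (m : sphere R) : set V := if s then beta_span m else alpha_span m.
Arguments spanb : simpl never.

Lemma spanb_some s m : spanb s (Some m) = plane (nframe false false s) m.
Proof.
have -> : spanb s (Some m) = span2 (nullv R false true - m *: nullv R true s)
    (nullv R true (~~ s) + m *: nullv R false false) by case: s; rewrite nullv.unlock.
have l c t := @nullq_linear R c t.
apply/seteqP; split=> v.
  move=> [a [b ->]]; rewrite /plane /= !(formD (l _ _)) !(formZ (l _ _)) -(scaleNr m (nullv R true s)) !(formD (l _ _)) !(formZ (l _ _)).
  by rewrite !nullq_dual; case: s; split => /=; ring.
rewrite /plane /= => -[e1 e2]; exists (nullq false true v), (nullq true (~~ s) v).
rewrite {1}(frame_dec (nframe false false s) v) /= e1 e2.
move: (nullq false true v) (nullq true (~~ s) v) => x y.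
rewrite scalerBr scalerDr !scalerA scaleNr (mulrC m x) (mulrC m y).
by rewrite [RHS]addrA [RHS]addrC !addrA.
Qed.

Lemma spanb_none s : spanb s None = [set v : V | nullq false true v = 0 /\ nullq true (~~ s) v = 0].
Proof.
have -> : spanb s None = span2 (nullv R true s) (nullv R false false) by case: s; rewrite nullv.unlock.
have l c t := @nullq_linear R c t.
apply/seteqP; split=> v /=.
  by move=> [a [b ->]]; rewrite !(formD (l _ _)) !(formZ (l _ _)) !nullq_dual; case: s; split => /=; ring.
move=> [e1 e2]; exists (nullq true s v), (nullq false false v).
by rewrite {1}(frame_dec (nframe false false s) v) /= e1 e2 !scale0r !addr0 addrC.
Qed.

(** Passing to the frame [nframe false false s], in which slopes are measured on the sphere, acts on
    a slope by a sign change, an inversion, both or neither. An inverted slope 0 becomes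
    infinity. *)
Definition slope_sphere (c t s : bool) (m : Cx R) : sphere R :=
  let m' := if (if s then t else c (+) t) then - m else m in
  if (if s then c (+) t else t) then sphere_inv (Some m') else Some m'.

Lemma plane_nframe c t s m : plane (nframe c t s) m = spanb s (slope_sphere c t s m).
Proof.
rewrite /slope_sphere; have [->|m0] := eqVneq m 0.
  rewrite oppr0 if_same /sphere_inv eqxx.
  by case: c; case: t; case: s => /=; rewrite ?spanb_none ?spanb_some; apply/seteqP; split=> v;
    rewrite /plane /= ?mul0r ?oppr0 => -[e1 e2]; split.
have n0 : - m != 0 by rewrite oppr_eq0.
by case: c; case: t; case: s; rewrite /= ?(negbTE n0) ?(negbTE m0) spanb_some; apply/seteqP; split=> v;
  rewrite /plane /= => -[e1 e2]; split; rewrite ?e1 ?e2; field.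
Qed.

End NullFrames.

Section NullPlanes.
Variable R : realType.
Local Notation V := ('rV[Cx R]_4).
Local Notation I := (Ci R).

Definition mx4 (s : seq (seq R)) : 'M[R]_4 := \matrix_(i, j) nth 0 (nth [::] s i) j.

Lemma det4 (a00 a01 a02 a03 a10 a11 a12 a13 a20 a21 a22 a23 a30 a31 a32 a33 : R) :
  \det (mx4 [:: [:: a00; a01; a02; a03]; [:: a10; a11; a12; a13];
                [:: a20; a21; a22; a23]; [:: a30; a31; a32; a33]]) =
  a00 * (a11 * (a22 * a33 - a23 * a32) - a12 * (a21 * a33 - a23 * a31) + a13 * (a21 * a32 - a22 * a31))
  - a01 * (a10 * (a22 * a33 - a23 * a32) - a12 * (a20 * a33 - a23 * a30) + a13 * (a20 * a32 - a22 * a30))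
  + a02 * (a10 * (a21 * a33 - a23 * a31) - a11 * (a20 * a33 - a23 * a30) + a13 * (a20 * a31 - a21 * a30))
  - a03 * (a10 * (a21 * a32 - a22 * a31) - a11 * (a20 * a32 - a22 * a30) + a12 * (a20 * a31 - a21 * a30)).
Proof.
have det2 (M : 'M[R]_2) : \det M = M 0 0 * M 1 1 - M 0 1 * M 1 0.
  rewrite (expand_det_row _ 0) !big_ord_recl big_ord0 /cofactor !det_mx11 !mxE.
  rewrite (_ : lift 0 0 = 1); last exact/val_inj.
  rewrite (_ : lift 1 0 = 0); last exact/val_inj.
  by rewrite /= /bump /=; ring.
rewrite (expand_det_row _ ord0) !big_ord_recl big_ord0 /cofactor.
rewrite !(expand_det_row _ (0 : 'I_3)) !big_ord_recl !big_ord0 /cofactor !det2.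
by rewrite !mxE /= /bump /=; ring.
Qed.

Lemma span2_scale (c : Cx R) (u v : V) : c != 0 -> span2 (c *: u) (c *: v) = span2 u v.
Proof.
move=> c0; apply/seteqP; split=> w [a [b ->]].
  by exists (a * c), (b * c); rewrite !scalerA.
by exists (a / c), (b / c); rewrite !scalerA !divfK.
Qed.

Lemma span2C (u v : V) : span2 u v = span2 v u.
Proof. by apply/seteqP; split=> w [a [b ->]]; exists b, a; rewrite addrC. Qed.

Lemma complexCC (a b : R) : (a +i* b)%C = CC a + I * CC b.
Proof. by apply/eqP; rewrite eq_complex /=; apply/andP; split; apply/eqP; ring. Qed.

Definition cvec (r r' : seq R) : V := \row_(l < 4) (nth 0 r l +i* nth 0 r' l)%C.

Lemma frame_plane_mx4 r0 r1 r2 r3 :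
  frame_plane (mx4 [:: r0; r1; r2; r3]) = span2 (cvec r0 r1) (cvec r2 r3).
Proof.
have fE (E : 'M[R]_4) : frame_plane E =
    span2 (\row_l (E (inord 0) l +i* E (inord 1) l)%C) (\row_l (E (inord 2) l +i* E (inord 3) l)%C).
  by apply: (f_equal2 (@span2 R)); apply/rowP => j; rewrite !mxE.
have e0 j : mx4 [:: r0; r1; r2; r3] (inord 0) j = nth 0 r0 j by rewrite mxE inordK.
have e1 j : mx4 [:: r0; r1; r2; r3] (inord 1) j = nth 0 r1 j by rewrite mxE inordK.
have e2 j : mx4 [:: r0; r1; r2; r3] (inord 2) j = nth 0 r2 j by rewrite mxE inordK.
have e3 j : mx4 [:: r0; r1; r2; r3] (inord 3) j = nth 0 r3 j by rewrite mxE inordK.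
rewrite fE; move: (mx4 _) e0 e1 e2 e3 => E e0 e1 e2 e3.
apply: (f_equal2 (@span2 R)); apply/rowP => j; rewrite [LHS]mxE [RHS]mxE.
  by rewrite e0 e1.
by rewrite e2 e3.
Qed.

Lemma cvecE r r' b : (b < 4)%N -> cvec r r' 0 (inord b) = CC (nth 0 r b) + I * CC (nth 0 r' b).
Proof. by move=> hb; rewrite mxE complexCC inordK. Qed.

End NullPlanes.

Section NullPlaneBases.
Variable R : realType.
Local Notation V := ('rV[Cx R]_4).
Local Notation I := (Ci R).

(** The two spanning vectors, multiplied by [2 * k] with [k] the inverse square root of 1 + |m|^2,
    have as real and imaginary parts an orthonormal basis of determinant [ep]. For infinite slope a
    signed diagonal matrix serves. *)
Lemma spanb_is_plane (s : bool) (mu : sphere R) :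
  if s then beta_plane (spanb s mu) else alpha_plane (spanb s mu).
Proof.
pose ep : R := if s then -1 else 1.
suff [E [h1 h2 h3]] : exists E : 'M[R]_4, [/\ E *m E^T = 1%:M, \det E = ep & spanb s mu = frame_plane E].
  move: h2 h3; rewrite /ep; clear ep; case: (s) => h2 h3; exists E; split; rewrite ?h2 ?oppr_lt0 ?ltr01 //.
have ep2 : ep * ep = 1 by rewrite /ep; case: (s); rewrite ?mulrNN mulr1.
have lt0 : (0 < 4)%N by []. have lt1 : (1 < 4)%N by [].
have lt2 : (2 < 4)%N by []. have lt3 : (3 < 4)%N by [].
case: mu => [m|].
  pose x := complex.Re m; pose y := complex.Im m.
  have n0 : 0 < 1 + x ^+ 2 + y ^+ 2 by have := sqr_ge0 x; have := sqr_ge0 y; lra.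
  pose k := (Num.sqrt (1 + x ^+ 2 + y ^+ 2))^-1.
  have k0 : 0 < k by rewrite invr_gt0 sqrtr_gt0.
  have K : k ^+ 2 * (1 + x ^+ 2 + y ^+ 2) = 1.
    by rewrite exprVn sqr_sqrtr ?(ltW n0) // mulVf // gt_eqF.
  exists (mx4 [:: [:: k; 0; - (k * x); - (k * y * ep)]; [:: 0; k; - (k * y); k * x * ep];
                 [:: k * x; k * y; k; 0]; [:: k * y; - (k * x); 0; k * ep]]).
  split.
  - apply/matrixP => i j; rewrite !mxE !big_ord_recl big_ord0 !mxE.
    case: i => [[|[|[|[|i]]]] //= hi]; case: j => [[|[|[|[|j]]]] //= hj];
      rewrite /bump /=; move: ep ep2 => e e2;
      first [by rewrite -K; transitivity (k ^+ 2 + k ^+ 2 * x ^+ 2 + k ^+ 2 * y ^+ 2 * (e * e)); [ring|rewrite e2; ring]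
            |by rewrite -K; transitivity (k ^+ 2 + k ^+ 2 * y ^+ 2 + k ^+ 2 * x ^+ 2 * (e * e)); [ring|rewrite e2; ring]
            |by rewrite -K; transitivity (k ^+ 2 * x ^+ 2 + k ^+ 2 * y ^+ 2 + k ^+ 2 * (e * e)); [ring|rewrite e2; ring]
            |by rewrite -K; ring
            |by transitivity (k ^+ 2 * x * y * (1 - e * e)); [ring|rewrite e2; ring]
            |by transitivity (k ^+ 2 * x * (1 - e * e)); [ring|rewrite e2; ring]
            |by transitivity (k ^+ 2 * y * (1 - e * e)); [ring|rewrite e2; ring]
            |by transitivity (k ^+ 2 * x * (e * e - 1)); [ring|rewrite e2; ring]
            |by transitivity (k ^+ 2 * y * (e * e - 1)); [ring|rewrite e2; ring]
            |by ring].
  - rewrite det4; transitivity (ep * (k ^+ 2 * (1 + x ^+ 2 + y ^+ 2)) ^+ 2); first by ring.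
    by rewrite K expr1n mulr1.
  have -> : spanb s (Some m) = span2 (nullv R false true - m *: nullv R true s)
      (nullv R true (~~ s) + m *: nullv R false false) by case: (s); rewrite nullv.unlock.
  have c0 : 2 * CC k != 0 :> Cx R.
    by rewrite mulf_neq0 ?pnatr_eq0 // (fmorph_eq0 (real_complex R)) gt_eqF.
  rewrite frame_plane_mx4 -(span2_scale _ _ c0).
  have mE : m = CC x + I * CC y by rewrite -complexCC /x /y; case: (m).
  have epE : CC ep = if s then -1 else 1 :> Cx R by rewrite /ep; case: (s); rewrite ?rmorphN rmorph1.
  have en c t b (hb : (b < 4)%N) := @nullvE R c t b hb.
  have e1 (a : Cx R) (u v : V) b : (a *: (u - m *: v)) 0 (inord b) = a * (u 0 (inord b) - m * v 0 (inord b)) :> Cx R.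
    by rewrite !mxE.
  have e2 (a : Cx R) (u v : V) b : (a *: (u + m *: v)) 0 (inord b) = a * (u 0 (inord b) + m * v 0 (inord b)) :> Cx R.
    by rewrite !mxE.
  have JJ := CiCi R.
  move: (nullv R) en => n en.
  apply: (f_equal2 (@span2 R)); apply: row4_eq.
  - rewrite e1 !(en _ _ _ lt0) (cvecE _ _ lt0) /= rmorph0; move: I JJ => J JJ; by case: (s) => /=; field.
  - rewrite e1 !(en _ _ _ lt1) (cvecE _ _ lt1) /= rmorph0; move: I JJ => J JJ; by case: (s) => /=; field.
  - rewrite e1 !(en _ _ _ lt2) (cvecE _ _ lt2) /= !(rmorphN, rmorphM) /= mE; move: I JJ => J JJ; by case: (s) => /=; field.
  - rewrite e1 !(en _ _ _ lt3) (cvecE _ _ lt3) /= !(rmorphN, rmorphM) /= epE mE.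
    move: I JJ => J JJ; move: (CC x) (CC y) (CC k) => X Y Z.
    case: (s) => /=.
      transitivity (Z * (Y * (- (J * J))) * -1 * -1 - J * Z * X); last by rewrite JJ; ring.
      by field.
    transitivity (Z * (Y * (J * J)) + J * Z * X); last by rewrite JJ; ring.
    by field.
  - rewrite e2 !(en _ _ _ lt0) (cvecE _ _ lt0) /= !(rmorphN, rmorphM) /= mE; move: I JJ => J JJ; by case: (s) => /=; field.
  - rewrite e2 !(en _ _ _ lt1) (cvecE _ _ lt1) /= !(rmorphN, rmorphM) /= mE.
    move: I JJ => J JJ; move: (CC x) (CC y) (CC k) => X Y Z.
    transitivity (Z * (Y * (- (J * J))) - J * Z * X); last by rewrite JJ; ring.
    by case: (s) => /=; field.
  - rewrite e2 !(en _ _ _ lt2) (cvecE _ _ lt2) /= rmorph0; move: I JJ => J JJ; by case: (s) => /=; field.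
  - rewrite e2 !(en _ _ _ lt3) (cvecE _ _ lt3) /= rmorph0 rmorphM /= epE; move: I JJ => J JJ; by case: (s) => /=; field.
exists (mx4 [:: [:: 1; 0; 0; 0]; [:: 0; -1; 0; 0]; [:: 0; 0; 1; 0]; [:: 0; 0; 0; - ep]]).
split.
- apply/matrixP => i j; rewrite !mxE !big_ord_recl big_ord0 !mxE.
  case: i => [[|[|[|[|i]]]] //= hi]; case: j => [[|[|[|[|j]]]] //= hj];
    rewrite /bump /=; move: ep ep2 => e e2; first [by ring | by rewrite -e2; ring].
- by rewrite det4; ring.
have -> : spanb s None = span2 (nullv R true s) (nullv R false false) by case: (s); rewrite nullv.unlock.
have c0 : (2 : Cx R) != 0 by rewrite pnatr_eq0.
rewrite frame_plane_mx4 span2C -(span2_scale _ _ c0).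
have epE : CC ep = if s then -1 else 1 :> Cx R by rewrite /ep; case: (s); rewrite ?rmorphN rmorph1.
have en c t b (hb : (b < 4)%N) := @nullvE R c t b hb.
have e1 (a : Cx R) (u : V) b : (a *: u) 0 (inord b) = a * u 0 (inord b) :> Cx R by rewrite mxE.
move: (nullv R) en => n en.
apply: (f_equal2 (@span2 R)); apply: row4_eq.
- rewrite e1 (en _ _ _ lt0) (cvecE _ _ lt0) /= rmorph0 rmorph1; by case: (s) => /=; field.
- rewrite e1 (en _ _ _ lt1) (cvecE _ _ lt1) /= rmorph0 rmorphN rmorph1; by case: (s) => /=; field.
- rewrite e1 (en _ _ _ lt2) (cvecE _ _ lt2) /= rmorph0; by case: (s) => /=; field.
- rewrite e1 (en _ _ _ lt3) (cvecE _ _ lt3) /= rmorph0; by case: (s) => /=; field.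
- rewrite e1 (en _ _ _ lt0) (cvecE _ _ lt0) /= rmorph0; by case: (s) => /=; field.
- rewrite e1 (en _ _ _ lt1) (cvecE _ _ lt1) /= rmorph0; by case: (s) => /=; field.
- rewrite e1 (en _ _ _ lt2) (cvecE _ _ lt2) /= rmorph0 rmorph1; by case: (s) => /=; field.
- rewrite e1 (en _ _ _ lt3) (cvecE _ _ lt3) /= rmorph0 rmorphN /= epE; by case: (s) => /=; field.
Qed.

End NullPlaneBases.

(** * The harmonic morphism equations in a null frame *)

Section HarmonicFrames.
Variable R : realType.
Local Notation V := ('rV[Cx R]_4).
Local Notation I := (Ci R).
Implicit Types (f : V -> Cx R) (p x u v w h : V) (r : R).

Lemma derive_dv f x v : differentiable f x -> 'D_v f x = dv f x v.
Proof. by move=> df; rewrite deriveE // dvE. Qed.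

Lemma derive2_dv f p r x u v : hol_on f p r -> nrm (x - p) < r ->
  'D_v ('D_u f) x = dv (fun y => dv f y u) x v.
Proof.
move=> hf xr; rewrite -(derive_dv v (hol_on_dv u hf xr)).
apply: near_eq_derive; apply/near_nrmP; exists (r - nrm (x - p)); first by rewrite subr_gt0.
move=> y yx; apply: derive_dv; apply: hf; have := nrm_tri y x p; lra.
Qed.

Lemma dv2_lin f p r x (a b : Cx R) u v h : hol_on f p r -> nrm (x - p) < r ->
  dv (fun y => dv f y (a *: u + b *: v)) x h =
  a * dv (fun y => dv f y u) x h + b * dv (fun y => dv f y v) x h.
Proof.
move=> hf xr; have du := hol_on_dv u hf xr; have dw := hol_on_dv v hf xr.
have -> : (fun y => dv f y (a *: u + b *: v)) = (fun y => a * dv f y u + b * dv f y v).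
  by apply/funext => y; rewrite dvDr !dvZr.
rewrite (dvD _ (differentiableZ a du) (differentiableZ b dw)).
by rewrite (dv_scale a _ du) (dv_scale b _ dw).
Qed.

Definition stdv (k : nat) : V := std_vec R (inord k).

Lemma nullv_std c t :
  nullv R c t = 2^-1 *: (stdv (if c then 2 else 0)%N + (if t then I else - I) *: stdv (if c then 3 else 1)%N).
Proof.
rewrite nullv.unlock /stdv /vq1 /vq2 /vqt1 /vqt2; case: c; case: t; try reflexivity.
  by rewrite [in RHS]scaleNr.
by rewrite [in RHS]scaleNr.
Qed.

Lemma sum4 (W : zmodType) (F : 'I_4 -> W) :
  \sum_(i < 4) F i = F (inord 0) + F (inord 1) + F (inord 2) + F (inord 3).
Proof.
rewrite !big_ord_recl big_ord0 addr0 !addrA.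
by congr (F _ + F _ + F _ + F _); apply/val_inj; rewrite /= inordK.
Qed.

(** A dual pair of null vectors is [a e + b e'] and [a e - b e'] with a = 1/2 and b^2 = - a^2, so
    the product of the two derivatives is a quarter of the sum of squares, the cross terms
    cancelling. Both equations are thus rewritten, whatever the choice of tildes. *)
Lemma harmonic_null f p r : hol_on f p r ->
  (forall x, nrm (x - p) < r -> harmonic_morphism_equations f x) ->
  forall x t t', nrm (x - p) < r ->
  dv (fun y => dv f y (nullv R false (~~ t))) x (nullv R false t) +
  dv (fun y => dv f y (nullv R true (~~ t'))) x (nullv R true t') = 0 /\
  dv f x (nullv R false t) * dv f x (nullv R false (~~ t)) +
  dv f x (nullv R true t') * dv f x (nullv R true (~~ t')) = 0.
Proof.
move=> hf H x t t' xr; have [lap nul] := H x xr; have dfx := hf x xr.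
have sym i j : dv (fun y => dv f y (stdv i)) x (stdv j) = dv (fun y => dv f y (stdv j)) x (stdv i).
  by apply: dv_sym; exact: hol_on_hol hf xr.
have lap' : \sum_(i < 4) dv (fun y => dv f y (std_vec R i)) x (std_vec R i) = 0.
  by rewrite -[RHS]lap; apply: eq_bigr => i _; apply/esym; exact: derive2_dv hf xr.
have nul' : \sum_(i < 4) dv f x (std_vec R i) ^+ 2 = 0.
  by rewrite -[RHS]nul; apply: eq_bigr => i _; congr (_ ^+ 2); apply/esym; exact: derive_dv dfx.
rewrite !sum4 in lap' nul'; clear lap nul.
have {lap'} lap : dv (fun y => dv f y (stdv 0)) x (stdv 0) + dv (fun y => dv f y (stdv 1)) x (stdv 1) +
  dv (fun y => dv f y (stdv 2)) x (stdv 2) + dv (fun y => dv f y (stdv 3)) x (stdv 3) = 0 := lap'.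
have {nul'} nul : dv f x (stdv 0) ^+ 2 + dv f x (stdv 1) ^+ 2 + dv f x (stdv 2) ^+ 2 + dv f x (stdv 3) ^+ 2 = 0 := nul'.
have JJ := CiCi R.
have nE c t0 : exists b b' : Cx R, [/\ b' = - b, b * b = - (2^-1 * 2^-1),
    nullv R c t0 = 2^-1 *: stdv (if c then 2 else 0)%N + b *: stdv (if c then 3 else 1)%N &
    nullv R c (~~ t0) = 2^-1 *: stdv (if c then 2 else 0)%N + b' *: stdv (if c then 3 else 1)%N].
  exists (2^-1 * (if t0 then I else - I)), (2^-1 * (if t0 then - I else I)).
  rewrite !nullv_std !scalerDr !scalerA; split.
  - by case: (t0); rewrite mulrN // opprK.
  - by case: (t0); rewrite mulrACA ?mulrNN JJ mulrN1.
  - by [].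
  - by case: (t0).
have [b [b' [bN bb -> ->]]] := nE false t; have [d [d' [dN dd -> ->]]] := nE true t'.
move: stdv sym lap nul {nE} => /= e sym lap nul.
move: (2^-1 : Cx R) bb dd => a bb dd.
have D c1 c2 u v c1' c2' u' v' : dv (fun y => dv f y (c1 *: u + c2 *: v)) x (c1' *: u' + c2' *: v') =
    c1 * (c1' * dv (fun y => dv f y u) x u' + c2' * dv (fun y => dv f y u) x v') +
    c2 * (c1' * dv (fun y => dv f y v) x u' + c2' * dv (fun y => dv f y v) x v').
  by rewrite (dv2_lin _ _ _ _ _ hf xr) !dvDr !dvZr.
have D1 c1 c2 u v : dv f x (c1 *: u + c2 *: v) = c1 * dv f x u + c2 * dv f x v by rewrite dvDr !dvZr.
split.
  rewrite 2!D (sym 1%N 0%N) (sym 3%N 2%N).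
  move: lap; move: (dv _ x (e 0%N)) (dv _ x (e 1%N)) (dv _ x (e 1%N)) (dv _ x (e 2%N)) (dv _ x (e 3%N)) (dv _ x (e 3%N)).
  move=> B00 B01 B11 B22 B23 B33 lap; rewrite bN dN.
  transitivity (a * a * B00 - b * b * B11 + a * a * B22 - d * d * B33); first by ring.
  by rewrite bb dd !mulNr !opprK -!mulrDr lap mulr0.
transitivity ((a * dv f x (e 0%N) + b * dv f x (e 1%N)) * (a * dv f x (e 0%N) + b' * dv f x (e 1%N)) +
    (a * dv f x (e 2%N) + d * dv f x (e 3%N)) * (a * dv f x (e 2%N) + d' * dv f x (e 3%N))).
  by congr (_ * _ + _ * _); exact: D1.
move: nul; move: (dv f x (e 0%N)) (dv f x (e 1%N)) (dv f x (e 2%N)) (dv f x (e 3%N)) => w0 w1 w2 w3 nul.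
rewrite bN dN.
transitivity (a * a * w0 ^+ 2 - b * b * w1 ^+ 2 + a * a * w2 ^+ 2 - d * d * w3 ^+ 2); first by ring.
by rewrite bb dd !mulNr !opprK -!mulrDr nul mulr0.
Qed.
End HarmonicFrames.

(** * Choice of frame and dichotomy near a point *)

Section LocalFrames.
Variable R : realType.
Local Notation V := ('rV[Cx R]_4).
Implicit Types (f : V -> Cx R) (p x u v w h : V) (r : R).

Lemma diff_neq0_near f p : differentiable f p -> f p != 0 ->
  exists2 d : R, 0 < d & forall y, nrm (y - p) < d -> f y != 0.
Proof.
move=> df f0; have [d d0 hd] := cont_nrm (differentiable_continuous df) (nrm_gt0 f0).
exists d => // y /hd; apply: contraTneq => ->.
by rewrite sub0r nrmN ltxx.
Qed.

Definition null_harmonic_in (e : frame V) f p r :=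
  null_harmonic f p r (fu1 e) (fut1 e) (fu2 e) (fut2 e).

(** The null vectors span, so df is nonzero on one of them. The same [c] and [t] serve both values
    of [s], since [s] only relabels the second pair; the two types can therefore be compared in one
    frame. *)
Lemma local_frame f p r0 : 0 < r0 -> hol_on f p r0 ->
  (forall x, nrm (x - p) < r0 -> harmonic_morphism_equations f x) ->
  (exists v, dv f p v != 0) ->
  exists (c t : bool) (r : R), [/\ 0 < r, r <= r0 &
    forall s, null_harmonic_in (nframe R c t s) f p r].
Proof.
move=> r00 hf eqs [v v0].
have pp : nrm (p - p) < r0 by rewrite subrr nrm0.
have [c [t nz]] : exists c t, dv f p (nullv R c t) != 0.
  apply: contrapT => none.
  have z c t : dv f p (nullv R c t) = 0.
    by apply/eqP; apply: contraT => nz; exfalso; apply: none; exists c, t.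
  by move: v0; rewrite (null_dec v) !dvDr !dvZr !z !mulr0 !addr0 eqxx.
have [d d0 hd] := diff_neq0_near (hol_on_dv (nullv R c t) hf pp) nz.
have m0 : 0 < Num.min d r0 by rewrite lt_min d0.
have m1 : Num.min d r0 <= r0 by rewrite ge_min lexx orbT.
exists c, t, (Num.min d r0); split=> // s.
have hf' : hol_on f p (Num.min d r0) by move=> x xr; apply: hf; exact: lt_le_trans m1.
have xr0 x : nrm (x - p) < Num.min d r0 -> nrm (x - p) < r0 by move=> h; exact: lt_le_trans m1.
rewrite /null_harmonic_in /=; split=> // x xm.
- have [l _] := harmonic_null hf eqs (if c then t (+) s else t) (if c then t else t (+) s) (xr0 _ xm).
  by move: l; case: (c) => // /eqP; rewrite addrC => /eqP.
- have [_ n] := harmonic_null hf eqs (if c then t (+) s else t) (if c then t else t (+) s) (xr0 _ xm).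
  by move: n; case: (c) => // /eqP; rewrite addrC => /eqP.
- by apply: hd; move: xm; rewrite lt_min => /andP[].
Qed.

Definition frame_slope (e : frame V) f := slope f (fu1 e) (fut2 e).

(* Vanishes iff [frame_slope e f] is constant along the planes it defines. *)
Definition frame_shear (e : frame V) f x :=
  dv (frame_slope e f) x (fut2 e) + frame_slope e f x * dv (frame_slope e f) x (fu1 e).

Lemma hol_on_frame_slope e f p r : null_harmonic_in e f p r -> hol_on (frame_slope e f) p r.
Proof. by move=> [hf _ _ nz]; exact: hol_on_slope. Qed.

Lemma hol_on_frame_shear e f p r : null_harmonic_in e f p r -> hol_on (frame_shear e f) p r.
Proof.
move=> /hol_on_frame_slope hm x xr; apply: differentiableD; first exact: hol_on_dv hm x xr.
apply: differentiableM; [exact: hm x xr|exact: hol_on_dv hm x xr].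
Qed.

(** In the second alternative the alpha factor vanishes on no open subset of the ball; this is what
    excludes alpha type at every point of it. *)
Lemma frame_dichotomy c t f p r : 0 < r ->
  (forall s, null_harmonic_in (nframe R c t s) f p r) ->
  (forall x, nrm (x - p) < r -> frame_shear (nframe R c t false) f x = 0) \/
  (forall x, nrm (x - p) < r -> frame_shear (nframe R c t true) f x = 0) /\
  (forall x0, nrm (x0 - p) < r -> ~ (\forall x \near x0, frame_shear (nframe R c t false) f x = 0)).
Proof.
move=> r0 H.
(* Exchanging [s] swaps the two vectors of the second pair, so the slope [nu] of one frame is the
   slope [mu] of the other. *)
have prod x : nrm (x - p) < r ->
    frame_shear (nframe R c t false) f x * frame_shear (nframe R c t true) f x = 0.
  move=> xr; have := shear_product (H false) xr; rewrite /frame_shear /frame_slope /=.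
  by rewrite addbF addbT negbK.
have hs s := hol_on_frame_shear (H s).
have [[x0 x0r x0z]|none] := pselect (exists2 x0, nrm (x0 - p) < r &
    \forall x \near x0, frame_shear (nframe R c t false) f x = 0).
  by left; exact: identity_theorem (hs false) x0r x0z.
right; split; last by move=> x0 x0r x0z; apply: none; exists x0.
have [x1 x1r x1n] : exists2 x1, nrm (x1 - p) < r & frame_shear (nframe R c t false) f x1 != 0.
  apply: contrapT => no; apply: none; exists p; first by rewrite subrr nrm0.
  apply/near_nrmP; exists r => // y yr; apply/eqP; apply: contraT => nz.
  by exfalso; apply: no; exists y.
have [d d0 hd] := diff_neq0_near (hs false x1 x1r) x1n.
apply: (identity_theorem (hs true) x1r); apply/near_nrmP.
exists (Num.min d (r - nrm (x1 - p))); first by rewrite lt_min d0 subr_gt0.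
move=> y; rewrite lt_min => /andP[/hd nz yx].
have yr : nrm (y - p) < r by have := nrm_tri y x1 p; lra.
by have /eqP := prod y yr; rewrite mulf_eq0 (negbTE nz) => /eqP.
Qed.

Lemma plane_inj (e : frame V) m m' : plane e m = plane e m' ->
  fkt1 e (fut2 e) = 0 -> fkt2 e (fut2 e) = 1 -> fk1 e (fut2 e) = 0 -> fk2 e (fut2 e) = 0 -> m = m'.
Proof.
move=> E d1 d2 d3 d4; have [l1 l2 l3 l4] := frame_lin e; have [a1 a2 a3 a4] := frame_dual1 e.
have : plane e m (fut2 e + m *: fu1 e).
  rewrite /plane /= !(formD l1, formD l2, formD l3, formD l4) !(formZ l1, formZ l2, formZ l3, formZ l4).
  by rewrite d1 d2 d3 d4 a1 a2 a3 a4; split; ring.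
rewrite E /plane /= !(formD l1, formD l2, formD l3, formD l4) !(formZ l1, formZ l2, formZ l3, formZ l4).
by rewrite d1 d2 d3 d4 a1 a2 a3 a4 => -[+ _]; rewrite add0r !mulr1 mulr0 addr0 mulr1.
Qed.

Lemma plane_nframe_inj c t s m m' :
  plane (nframe R c t s) m = plane (nframe R c t s) m' -> m = m'.
Proof. by move/plane_inj; apply; rewrite /= nullq_dual; case: c; case: t; case: s. Qed.

End LocalFrames.

(** * The foliation of a harmonic morphism *)

Lemma nrm_lt_tri (R : realType) (W : normedModType (Cx R)) (x y p : W) (d : R) :
  nrm (y - x) < d - nrm (x - p) -> nrm (y - p) < d.
Proof. by move=> h; apply: le_lt_trans (nrm_tri y x p) _; rewrite -ltrBrDr. Qed.

Section HarmonicMorphism.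
Variables (R : realType) (N : topologicalType) (atlas : set (chart R N)).
Variables (A : set 'rV[Cx R]_4) (phi : 'rV[Cx R]_4 -> N).
Hypothesis hN : riemann_surface atlas.
Hypothesis hA : open A.
Hypothesis hphi : complex_harmonic_morphism atlas A phi.
Hypothesis hdphi : forall p, A p -> differential_nonzero atlas phi p.
Local Notation V := ('rV[Cx R]_4).
Implicit Types (p x v : V) (r : R) (k : chart R N).

Lemma atlas_local k : atlas k -> local_coordinate atlas k.
Proof. by case: hN => _ _ h1 _ h2 kA; split=> [|d dA]; [exact: h1|split; exact: h2]. Qed.

Lemma atlas_chart y : exists2 k, atlas k & cdom k y.
Proof. by case: hN. Qed.

Lemma chart_ball k p : atlas k -> A p -> cdom k (phi p) ->
  exists2 r, 0 < r & forall x, nrm (x - p) < r -> A x /\ cdom k (phi x).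
Proof.
move=> kA Ap kp; have [[ok _ _ _ _] _] := atlas_local kA.
have [cp _] := hphi Ap.
have h1 : \forall x \near p, A x by exact: open_nbhs_nbhs (conj hA Ap).
have h2 : \forall x \near p, cdom k (phi x) by apply: cp; exact: open_nbhs_nbhs (conj ok kp).
have /near_nrmP[r r0 hr] : \forall x \near p, A x /\ cdom k (phi x) by near=> x; split; near: x.
by exists r.
Unshelve. all: by end_near. Qed.

Lemma chart_diff k p : atlas k -> A p -> cdom k (phi p) -> differentiable (cmap k \o phi) p.
Proof. by move=> kA Ap kp; have [_ h] := hphi Ap; have [] := h k (atlas_local kA) kp. Qed.

Lemma chart_harmonic k p : atlas k -> A p -> cdom k (phi p) ->
  harmonic_morphism_equations (cmap k \o phi) p.
Proof. by move=> kA Ap kp; have [_ h] := hphi Ap; have [] := h k (atlas_local kA) kp. Qed.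

Lemma chart_dv k p : atlas k -> A p -> cdom k (phi p) -> exists v, dv (cmap k \o phi) p v != 0.
Proof.
by move=> kA Ap kp; have [v v0] := hdphi Ap (atlas_local kA) kp; exists v; rewrite dvE.
Qed.

Lemma chart_change k k' p : atlas k -> atlas k' -> A p -> cdom k (phi p) -> cdom k' (phi p) ->
  exists2 h : Cx R, h != 0 & forall v, dv (cmap k' \o phi) p v = h * dv (cmap k \o phi) p v.
Proof.
move=> kA kA' Ap kp kp'; have [[_ _ kK _ _] _] := atlas_local kA.
have dtau : differentiable (cmap k' \o cinv k) (cmap k (phi p)).
  by have [_ /(_ k' kA')[+ _]] := atlas_local kA; apply.
have [dc cE] := dv_comp (chart_diff kA Ap kp) dtau.
have [r r0 hr] := chart_ball kA Ap kp.
have e : \forall x \near p, (cmap k' \o cinv k) ((cmap k \o phi) x) = (cmap k' \o phi) x.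
  by apply/near_nrmP; exists r => // x /hr[_ kx]; rewrite /= kK.
have [_ dE] := eq_near_diff e dc.
set h := dv (cmap k' \o cinv k) (cmap k (phi p)) 1.
have hE v : dv (cmap k' \o phi) p v = h * dv (cmap k \o phi) p v.
  rewrite dE cE -[dv (cmap k \o phi) p v]mulr1 -[_ * 1]/(_ *: (1 : Cx R)) dvZr mulrC.
  by rewrite -[_ *: (1 : Cx R)]/(_ * 1) mulr1.
exists h => //; have [v] := chart_dv kA' Ap kp'.
by rewrite hE; apply: contra => /eqP ->; rewrite mul0r.
Qed.

Definition tang (s : bool) p : set V :=
  [set v | exists k, [/\ atlas k, cdom k (phi p) & tangent_plane s (dv (cmap k \o phi) p) v]].

Lemma tangE s k p : atlas k -> A p -> cdom k (phi p) ->
  tang s p = tangent_plane s (dv (cmap k \o phi) p).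
Proof.
move=> kA Ap kp; apply/seteqP; split=> [v [k' [kA' kp' h]]|v h]; last by exists k.
have [b b0 hb] := chart_change kA kA' Ap kp kp'.
by rewrite -(tangent_plane_scale s b0 hb).
Qed.

Lemma tang_plane c t s k p r : atlas k -> null_harmonic_in (nframe R c t s) (cmap k \o phi) p r ->
  forall x, nrm (x - p) < r -> A x -> cdom k (phi x) ->
  tang s x = plane (nframe R c t s) (frame_slope (nframe R c t s) (cmap k \o phi) x).
Proof.
move=> kA [_ _ nul nz] x xr Ax kx; rewrite (tangE s kA Ax kx).
apply/seteqP; split=> v; first by move/(null_eqs_nframe c t)/(null_eqs_plane _ (nz x xr) (nul x xr)).
by move/(null_eqs_plane _ (nz x xr) (nul x xr))/null_eqs_nframe.
Qed.

(* The self-dual planes are locally constant along the fibres; where this fails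
   on a dense set the anti-self-dual ones are. *)
Definition alpha_type p : Prop := exists2 d : R, 0 < d & forall x y,
  nrm (x - p) < d -> nrm (y - p) < d -> phi x = phi y -> tang false x = tang false y.

Definition beta_type p : bool := ~~ `[< alpha_type p >].

Definition null_dist p : set V := tang (beta_type p) p.

Lemma null_harmonic_in_sub e f p r d : d <= r ->
  null_harmonic_in e f p r -> null_harmonic_in e f p d.
Proof.
move=> dr [h1 h2 h3 h4]; have sub x : nrm (x - p) < d -> nrm (x - p) < r by move=> /lt_le_trans; apply.
by split=> x /sub xr; [exact: h1|exact: h2|exact: h3|exact: h4].
Qed.

(** If the alpha factor vanishes near [p], the alpha slope is a function of [phi] and all nearby
    points have alpha type. Otherwise an alpha point in the ball would make that factor vanish
    around it, which the dichotomy excludes. *)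
Lemma local_type p : A p -> exists (k : chart R N) (c t s : bool) (r : R),
  [/\ atlas k, 0 < r,
      (forall x, nrm (x - p) < r -> [/\ A x, cdom k (phi x) & beta_type x = s]),
      null_harmonic_in (nframe R c t s) (cmap k \o phi) p r &
      (forall x, nrm (x - p) < r -> frame_shear (nframe R c t s) (cmap k \o phi) x = 0)].
Proof.
move=> Ap; have [k kA kp] := atlas_chart (phi p).
have [r0 r00 hr0] := chart_ball kA Ap kp.
set f := cmap k \o phi.
have hf : hol_on f p r0 by move=> x /hr0[Ax kx]; exact: chart_diff.
have heq x : nrm (x - p) < r0 -> harmonic_morphism_equations f x.
  by move=> /hr0[Ax kx]; exact: chart_harmonic.
have [c [t [r [r1 rr0 H]]]] := local_frame r00 hf heq (chart_dv kA Ap kp).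
have inA x : nrm (x - p) < r -> A x /\ cdom k (phi x) by move=> xr; apply: hr0; exact: lt_le_trans rr0.
have tE s x (xr : nrm (x - p) < r) := let: conj a b := inA x xr in tang_plane kA (H s) xr a b.
have [z|[z nz]] := frame_dichotomy r1 H.
  have [rho [d [eps [[d0 dr e0 _] muE _ _]]]] := chart_exists r1 (H false) z.
  exists k, c, t, false, d; split=> //.
  - move=> x xd; have [Ax kx] := inA x (lt_le_trans xd dr); split=> //.
    apply/negbF/asboolP; exists (d - nrm (x - p)); first by rewrite subr_gt0.
    move=> y y' yx yx' e.
    have yd : nrm (y - p) < d := nrm_lt_tri yx.
    have yd' : nrm (y' - p) < d := nrm_lt_tri yx'.
    rewrite (tE _ _ (lt_le_trans yd dr)) (tE _ _ (lt_le_trans yd' dr)).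
    have [_ m1] := muE y yd; have [_ m2] := muE y' yd'.
    by rewrite /frame_slope m1 m2 /f /= e.
  - exact: null_harmonic_in_sub (H false).
  - by move=> x xd; apply: z; exact: lt_le_trans dr.
exists k, c, t, true, r; split=> // x xr; have [Ax kx] := inA x xr; split=> //.
apply/negP => /asboolP[d d0 hd]; apply: (nz x xr).
have m0 : 0 < Num.min d (r - nrm (x - p)) by rewrite lt_min d0 subr_gt0.
apply/near_nrmP; exists (Num.min d (r - nrm (x - p))) => // y.
rewrite lt_min => /andP[yd yx].
have yr : nrm (y - p) < r := nrm_lt_tri yx.
have m1 : 0 < Num.min (d - nrm (y - x)) (r - nrm (y - p)) by rewrite lt_min !subr_gt0 yd.
have [[_ _ kK _ _] _] := atlas_local kA.
have [hf' _ _ nzf] := H false.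
have inr w : nrm (w - y) < Num.min (d - nrm (y - x)) (r - nrm (y - p)) -> nrm (w - x) < d /\ nrm (w - p) < r.
  rewrite lt_min => /andP[w1 w2]; split; [exact: nrm_lt_tri w1|exact: nrm_lt_tri w2].
(* Alpha type makes the planes, and by injectivity the slopes, constant on the level sets of [f]
   near [y]; hence the differential of the slope vanishes on the kernel of df, which contains the
   direction of [frame_shear]. *)
have key v : dv f y v = 0 -> dv (frame_slope (nframe R c t false) f) y v = 0.
  apply: (level_const_dv (hol_on_hol hf' yr) (nzf y yr) m1 (hol_on_frame_slope (H false) yr)).
  move=> w w' /inr[w1 w2] /inr[w1' w2'] fw.
  have e : phi w = phi w'.
    by rewrite -(kK _ (inA w w2).2) -(kK _ (inA w' w2').2) [cmap k (phi w)]fw.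
  by apply: (@plane_nframe_inj R c t false); rewrite -(tE _ _ w2) -(tE _ _ w2'); exact: hd.
by rewrite /frame_shear /frame_slope -slope_shear_dv; apply: key; case: (slope_tangent (H false) yr).
Qed.

(** Stated through [null_dist] alone, so that any two such charts are comparable. Levels are the
    full traces on [U] of affine planes, and the local sections of the last clause produce the
    transition maps. *)
Definition plaque_chart (U : set V) (g : V -> 'rV[Cx R]_2) : Prop :=
  [/\ open U /\ U `<=` A,
      (forall x, U x -> [/\ differentiable g x, (forall w, exists v, dv g x v = w) &
         (forall v, dv g x v = 0 <-> null_dist x v)]),
      (forall x y, U x -> U y -> g x = g y <-> null_dist x (y - x)),
      (forall x y, U x -> U y -> g x = g y -> phi x = phi y /\ null_dist x = null_dist y) &
      (forall x, U x -> exists s : 'rV[Cx R]_2 -> V, s (g x) = x /\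
         \forall y \near g x, differentiable s y /\ g (s y) = y)].

Definition cball p (d : R) : set V := [set x | nrm (x - p) < d].

Lemma local_chart p : A p -> exists (k : chart R N) (c t s : bool) (rho : Cx R -> Cx R)
    (d eps : R) (g : V -> 'rV[Cx R]_2),
  [/\ [/\ atlas k, cdom k (phi p), 0 < d, 0 < eps &
         forall z, nrm (z - cmap k (phi p)) < eps -> differentiable rho z],
      (forall x, cball p d x -> [/\ A x, cdom k (phi x), beta_type x = s,
         nrm (cmap k (phi x) - cmap k (phi p)) < eps &
         null_dist x = spanb s (slope_sphere c t s (rho (cmap k (phi x))))]) &
      plaque_chart (cball p d) g].
Proof.
move=> Ap; have [k [c [t [s [r [kA r0 inA H z]]]]]] := local_type Ap.
have [rho [d [eps [[d0 dr e0 drho] muE gE sec]]]] := chart_exists r0 H z.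
have sub x : cball p d x -> nrm (x - p) < r by move=> xd; exact: lt_le_trans xd dr.
have pd : cball p d p by rewrite /cball /= subrr nrm0.
have TE x : cball p d x -> null_dist x = plane (nframe R c t s) (rho (cmap k (phi x))).
  move=> xd; have [Ax kx bx] := inA x (sub x xd); rewrite /null_dist bx.
  by rewrite (tang_plane kA H (sub x xd) Ax kx); congr plane; have [_ <-] := muE x xd.
have TE' x : cball p d x -> null_dist x =
    plane (nframe R c t s) (frame_slope (nframe R c t s) (cmap k \o phi) x).
  by move=> xd; rewrite TE //; congr plane; have [_ <-] := muE x xd.
have kP x y : cball p d x -> cball p d y -> cmap k (phi x) = cmap k (phi y) -> phi x = phi y.
  move=> xd yd e; have [[_ _ kK _ _] _] := atlas_local kA.
  have [_ kx _] := inA x (sub x xd); have [_ ky _] := inA y (sub y yd).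
  by rewrite -(kK _ kx) -(kK _ ky) e.
exists k, c, t, s, rho, d, eps, (chart_fun (nframe R c t s) (cmap k \o phi) p); split.
- by split=> //; case: (inA p (sub p pd)).
- move=> x xd; have [Ax kx bx] := inA x (sub x xd); have [e1 _] := muE x xd.
  by split=> //; rewrite TE // plane_nframe.
- split.
  + split=> [|x xd]; last by case: (inA x (sub x xd)).
    exact: ball_open.
  + move=> x xd; rewrite (TE' x xd).
    by have [h1 h2 h3] := chart_submersion H z (sub x xd); split.
  + by move=> x y xd yd; rewrite (TE' x xd); exact: gE.
  + move=> x y xd yd /pair2_inj[e _]; have e' := kP x y xd yd e.
    by split; [exact: e'|rewrite (TE x xd) (TE y yd) e'].
  + by move=> x xd; exact: sec.
Qed.

Lemma null_dist_spanb p : A p -> exists m, null_dist p = spanb (beta_type p) m.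
Proof.
move=> Ap; have [k [c [t [s [rho [d [eps [g [[_ _ d0 _ _] h _]]]]]]]]] := local_chart Ap.
have pd : cball p d p by rewrite /cball /= subrr nrm0.
by have [_ _ -> _ ->] := h p pd; eexists.
Qed.

Lemma null_dist_lin p (a : Cx R) u v : A p -> null_dist p u -> null_dist p v ->
  null_dist p (a *: u + v).
Proof.
move=> Ap; have [[m|] ->] := null_dist_spanb Ap; have l c t := @nullq_linear R c t.
  rewrite spanb_some /plane /= !(formD (l _ _)) !(formZ (l _ _)).
  by move=> -[-> ->] [-> ->]; split; ring.
rewrite spanb_none /= !(formD (l _ _)) !(formZ (l _ _)).
by move=> -[-> ->] [-> ->]; split; ring.
Qed.

Lemma null_dist0 p : A p -> null_dist p 0.
Proof.
move=> Ap.
have [k [c [t [s [rho [d [eps [g [[_ _ d0 _ _] _ [_ _ h _ _]]]]]]]]]] := local_chart Ap.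
have pd : cball p d p by rewrite /cball /= subrr nrm0.
by rewrite -(subrr p); apply/(h p p pd pd).
Qed.

Lemma null_distD p u v : A p -> null_dist p u -> null_dist p v -> null_dist p (u + v).
Proof. by move=> Ap hu hv; rewrite -[u]scale1r; exact: null_dist_lin. Qed.

Lemma null_distB p u v : A p -> null_dist p u -> null_dist p v -> null_dist p (u - v).
Proof. by move=> Ap hu hv; rewrite -scaleN1r addrC; exact: null_dist_lin. Qed.

Lemma null_dist_fibre p : A p -> \forall x \near p, A x /\ (phi x = phi p -> null_dist x = null_dist p) /\
  beta_type x = beta_type p.
Proof.
move=> Ap; have [k [c [t [s [rho [d [eps [g [[_ _ d0 _ _] h _]]]]]]]]] := local_chart Ap.
have pd : cball p d p by rewrite /cball /= subrr nrm0.
have [_ _ e2 _ e1] := h p pd.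
apply/near_nrmP; exists d; [exact: d0|move=> x xd]; have [Ax _ e2' _ e1'] := h x xd.
by rewrite e1 e2 e1' e2'; split=> //; split=> // ->.
Qed.

Definition null_foliation : foliation_atlas R := [set Ug | plaque_chart Ug.1 Ug.2].
Local Notation F := null_foliation.

Lemma null_foliation_cover p : A p -> exists U g, F (U, g) /\ U p.
Proof.
move=> Ap; have [k [c [t [s [rho [d [eps [g [[_ _ d0 _ _] _ h]]]]]]]]] := local_chart Ap.
by exists (cball p d), g; split=> //; rewrite /cball /= subrr nrm0.
Qed.

Lemma null_foliation_holomorphic : holomorphic_foliation A F.
Proof.
split.
- by move=> U f [].
- exact: null_foliation_cover.
- by move=> U f p [_ h _ _ _] Up; have [h1 h2 _] := h p Up; split=> // w; have [v] := h2 w; rewrite dv.unlock; exists v.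
- move=> U f W g p [[oU _] hf iff_f _ sec] [[oW _] hg iff_g _ _] Up Wp.
  (* The transition map is [g] after a local section of [f]. The points [x] and [s (f x)] have the
     same value of [f], so they differ by a vector of the null plane and have the same value of
     [g]. *)
  have [s [sp ds]] := sec p Up; exists (g \o s).
  have cs : {for f p, continuous s}.
    by apply: differentiable_continuous; have [] := nbhs_singleton ds.
  have cf : {for p, continuous f} by apply: differentiable_continuous; have [] := hf p Up.
  have UWp : nbhs p (U `&` W).
    by apply: filterI; [exact: open_nbhs_nbhs (conj oU Up)|exact: open_nbhs_nbhs (conj oW Wp)].
  have sUW : nbhs (f p) [set y | U (s y) /\ W (s y)].
    have UWs : nbhs (s (f p)) (U `&` W) by rewrite sp.
    exact: (cs _ UWs).
  split.
    move: ds sUW; apply: filterS2 => y [dsy _] [_ Wy].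
    have [dg _ _] := hg _ Wy.
    exact: (differentiable_comp dsy dg).
  have h1 : nbhs p [set x | (differentiable s (f x) /\ f (s (f x)) = f x) /\ (U (s (f x)) /\ W (s (f x)))].
    exact: (cf _ (filterI ds sUW)).
  have h2 : \forall x \near p, U x /\ W x by exact: UWp.
  move: h1 h2; apply: filterS2 => x [[_ e] [Us Ws]] [Ux Wx] /=.
  by apply/iff_g => //; apply/iff_f.
Qed.

Lemma tangent_null_foliation p : A p -> tangent_space F p = null_dist p.
Proof.
move=> Ap; apply/seteqP; split=> v.
  by move=> [U [f [[_ h _ _ _] Up e]]]; have [_ _ hv] := h p Up; apply/hv; rewrite dv.unlock.
have [U [g [UF Up]]] := null_foliation_cover Ap.
by have [_ h _ _ _] := UF; have [_ _ hv] := h p Up => /hv; rewrite dv.unlock => e; exists U, g.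
Qed.

Lemma fibre_component_refl p : A p -> fibre_component A phi p p.
Proof. by move=> Ap; apply: connected_component_refl; split. Qed.

Lemma leaf_refl p : leaf F p p.
Proof. by move=> S [_]; apply. Qed.

(** The set on the right contains [p] and is saturated: along a plaque the direction and [phi] are
    constant, the point moves within its affine plane, and the plaque, being connected, stays in the
    fibre component. *)
Lemma leaf_sub p : A p ->
  leaf F p `<=` [set x | [/\ A x, null_dist x = null_dist p, null_dist p (x - p) & fibre_component A phi p x]].
Proof.
move=> Ap; apply: smallest_sub; last first.
  by move=> _ ->; split=> //; [rewrite subrr; exact: null_dist0|exact: fibre_component_refl].
move=> U f q [[_ UA] _ iff_f par _] Uq [Aq eT qT qK] x xC.
have [Ux fx] : (U `&` f @^-1` [set f q]) x by exact: connected_component_sub xC.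
have [ephi eT'] := par q x Uq Ux (esym fx).
split; [exact: UA|by rewrite -eT'| |].
  rewrite -[x](subrK q) -addrA; apply: (null_distD Ap _ qT).
  by rewrite -eT; apply/(iff_f q x Uq Ux).
have qf : (phi q = phi p) by have [] := connected_component_sub qK.
have -> : fibre_component A phi p = connected_component (A `&` phi @^-1` [set phi p]) q.
  exact: same_connected_component.
apply: (@connected_component_max _ _ (connected_component (U `&` f @^-1` [set f q]) q)) xC.
- apply: connected_component_refl; split; [exact: Uq|reflexivity].
- move=> y /connected_component_sub[Uy fy]; split; first exact: UA.
  by have [e _] := par q y Uq Uy (esym fy); rewrite /= -e.
- exact: component_connected.
Qed.

(** A ball cut by the affine null plane through its centre is convex, hence connected, and so lies
    in a single plaque. *)
Lemma leaf_near p q : A p -> leaf F p q -> exists2 d : R, 0 < d &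
  forall x, nrm (x - q) < d -> null_dist p (x - q) -> leaf F p x.
Proof.
move=> Ap Lq; have [Aq eT _ _] := leaf_sub Ap Lq.
have [k [c [t [s [rho [d [eps [g [[_ _ d0 _ _] _ gF]]]]]]]]] := local_chart Aq.
exists d; [exact: d0|move=> x xd]; rewrite -eT => xT S [sat pS].
have qd : cball q d q by rewrite /cball /= subrr nrm0.
have [_ _ iff_g _ _] := gF.
apply: (sat _ g q gF qd (Lq S (conj sat pS))).
apply: (@connected_component_max _ _ (cball q d `&` [set y | null_dist q (y - q)])).
- by split; [exact: qd|rewrite /= subrr; exact: null_dist0].
- by move=> y [yd yT]; split; [exact: yd|apply/esym/(iff_g q y qd yd)].
- apply: convex_connected => y z u [yd yT] [zd zT] u01; split; first exact: seg_near.
  rewrite /=.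
  have -> : y + CC u *: (z - y) - q = CC u *: ((z - q) - (y - q)) + (y - q).
    by rewrite opprB [z - q + _]addrA subrK [RHS]addrA (addrC y).
  exact: (null_dist_lin _ Aq (null_distB Aq zT yT) yT).
- by split; [exact: xd|exact: xT].
Qed.

Lemma leaf_null_plane p : A p -> null_plane_of A F (null_dist p) (leaf F p).
Proof.
move=> Ap; split; first by exists p.
(* The open set is the union, over the points [q] of the leaf, of the balls in which the affine
   plane belongs to the leaf. *)
exists p, [set x | exists q (d : R), [/\ leaf F p q, nrm (x - q) < d &
  forall y, nrm (y - q) < d -> null_dist p (y - q) -> leaf F p y]]; split.
  apply/open_nrmP => x [q [d [Lq xd h]]]; exists (d - nrm (x - q)); first by rewrite subr_gt0.
  by move=> y yx; exists q, d; split; [exact: Lq|exact: nrm_lt_tri yx|exact: h].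
apply/seteqP; split=> x.
  move=> Lx; split; last first.
    by have [_ _ h _] := leaf_sub Ap Lx; exists (x - p); [exact: h|rewrite subrKC].
  have [d d0 h] := leaf_near Ap Lx.
  by exists x, d; split; [exact: Lx|rewrite subrr nrm0|exact: h].
move=> [[q [d [Lq xd h]]] [v vT xE]]; apply: (h x xd).
have [_ _ qT _] := leaf_sub Ap Lq.
have -> : x - q = v - (q - p) by rewrite -xE opprB addrA [v + p]addrC.
exact: null_distB.
Qed.

Lemma null_dist_plane p : A p ->
  if beta_type p then beta_plane (null_dist p) else alpha_plane (null_dist p).
Proof. by move=> Ap; have [m ->] := null_dist_spanb Ap; exact: spanb_is_plane. Qed.

(** On a fibre the direction is locally constant by [null_dist_fibre], and a component is connected.
    This gives the parallelism of its leaves. *)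
Lemma null_dist_component p q : A p -> fibre_component A phi p q -> null_dist q = null_dist p.
Proof.
move=> Ap qK.
apply: (@locally_const_connected _ (fibre_component A phi p) (fun x => null_dist x = null_dist p) _ _ p q).
- exact: component_connected.
- move=> x /connected_component_sub[Ax ex]; have := null_dist_fibre Ax.
  apply: filterS => y [_ [h _]] /connected_component_sub[_ ey].
  rewrite (h (etrans ey (esym ex))); exact: iff_refl.
- exact: fibre_component_refl.
- exact: qK.
- by [].
Qed.

Lemma fibre_component_union p : A p ->
  union_of_parallel_null_planes A F (fibre_component A phi p).
Proof.
move=> Ap; exists (null_dist p), [set L | exists2 q, fibre_component A phi p q & L = leaf F q].
have inA q : fibre_component A phi p q -> A q by move=> /connected_component_sub[].
split.
- by have := null_dist_plane Ap; case: (beta_type p); [right|left].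
- move=> L [q qK ->]; rewrite -(null_dist_component Ap qK).
  by apply: leaf_null_plane; exact: inA.
- apply/seteqP; split=> [q qK|x [L [q qK ->] Lx]].
    by exists (leaf F q); [exists q|exact: leaf_refl].
  have [_ _ _] := leaf_sub (inA q qK) Lx.
  have [_ eq] := connected_component_sub qK.
  rewrite /fibre_component (same_connected_component qK); congr (_ x).
  by congr (connected_component (A `&` phi @^-1` [set _]) q).
Qed.

Lemma null_foliation_type : by_alpha_or_by_beta_planes A F.
Proof.
move=> B BA cB; have [[p Bp]|none] := pselect (B !=set0); last first.
  by left=> p Bp; exfalso; apply: none; exists p.
have tyE x : B x -> beta_type x = beta_type p.
  move=> Bx.
  apply: (@locally_const_connected _ B (fun x => beta_type x = beta_type p) cB _ p x) => // y By.
  by have := null_dist_fibre (BA y By); apply: filterS => z [_ [_ ->]].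
case e : (beta_type p); [right|left] => x Bx; have := null_dist_plane (BA x Bx);
  by rewrite tyE // e (tangent_null_foliation (BA x Bx)).
Qed.

(** The same one of the two standard charts of the sphere serves for all slopes in a given frame. *)
Lemma slope_sphere_cases c t s : exists b : Cx R,
  (forall m, slope_sphere c t s m = Some (b * m)) \/
  (forall m, slope_sphere c t s m = sphere_inv (Some (b * m))).
Proof.
exists (if (if s then t else c (+) t) then -1 else 1); rewrite /slope_sphere.
have e m (b : bool) : (if b then - m else m) = (if b then -1 else 1) * m :> Cx R.
  by case: b; rewrite ?mulN1r ?mul1r.
by case: (if s then c (+) t else t); [right|left] => m; rewrite e.
Qed.

Lemma null_foliation_represented p : A p ->
  exists (A1 : set V) (W : set N) (rho : N -> sphere R),
    [/\ open A1 /\ A1 p, A1 `<=` A, open W /\ phi @` A1 `<=` W,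
        holomorphic_to_sphere atlas W rho & represents A1 F (rho \o phi)].
Proof.
move=> Ap; have [k [c [t [s [rho [d [eps [g [[kA kp d0 e0 drho] h _]]]]]]]]] := local_chart Ap.
have [[ok _ kK ck _] kl] := atlas_local kA.
(* The part of the coordinate domain whose image lies in the disc where [rho] is holomorphic. *)
pose W := [set y | cdom k y /\ nrm (cmap k y - cmap k (phi p)) < eps].
exists (cball p d), W, (fun y => slope_sphere c t s (rho (cmap k y))); split.
- by split; [exact: ball_open|rewrite /cball /= subrr nrm0].
- by move=> x xd; have [] := h x xd.
- split; last by move=> _ [x xd <-]; have [] := h x xd.
  rewrite openE => y [ky yeps]; rewrite /interior.
  apply: filterI; first exact: open_nbhs_nbhs (conj ok ky).
  have : nbhs (cmap k y) [set z | nrm (z - cmap k (phi p)) < eps].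
    by apply: open_nbhs_nbhs; split; [exact: ball_open|exact: yeps].
  by move=> /(ck y ky).
- move=> y Wy; have [b hb] := slope_sphere_cases c t s.
  exists W, (fun y => b * rho (cmap k y)); split.
  + rewrite openE => z [kz zeps]; rewrite /interior.
    apply: filterI; first exact: open_nbhs_nbhs (conj ok kz).
    have : nbhs (cmap k z) [set w | nrm (w - cmap k (phi p)) < eps].
      by apply: open_nbhs_nbhs; split; [exact: ball_open|exact: zeps].
    by move=> /(ck z kz).
  + exact: Wy.
  + by [].
  + move=> z k' [kz zeps] [[_ _ kK' _ _] loc] kz'.
    have [dk _] := loc k kA.
    have dr : differentiable (fun w => b * rho w) ((cmap k \o cinv k') (cmap k' z)).
      by apply: differentiableZ; apply: drho; rewrite /= kK'.
    exact: (differentiable_comp (dk z kz' kz) dr).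
  + by case: hb => hb; [left|right] => z _; exact: hb.
- have rE x : cball p d x -> [/\ tangent_space F x = spanb s (slope_sphere c t s (rho (cmap k (phi x)))) &
      if s then beta_plane (tangent_space F x) else alpha_plane (tangent_space F x)].
    move=> xd; have [Ax _ bx _ E] := h x xd; rewrite tangent_null_foliation //.
    by split; [exact: E|rewrite -bx; exact: null_dist_plane].
  by case: s {h} rE => rE; [right|left] => x /rE[h1 h2]; split.
Qed.
End HarmonicMorphism.

Unset Implicit Arguments.

Theorem theoremS8p2 (R : realType) (N : topologicalType)
    (atlas : set (chart R N)) (A : set (C4 R)) (phi : C4 R -> N)
    (hN : riemann_surface atlas) (hA : open A)
    (hphi : complex_harmonic_morphism atlas A phi)
    (hdphi : forall p, A p -> differential_nonzero atlas phi p) :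
  exists F : foliation_atlas R,
    [/\ holomorphic_foliation A F,
        by_alpha_or_by_beta_planes A F,
        (forall p, A p ->
           union_of_parallel_null_planes A F (fibre_component A phi p)) &
        (forall p, A p ->
           exists (A1 : set (C4 R)) (V : set N) (rho : N -> sphere R),
             [/\ open A1 /\ A1 p, A1 `<=` A,
                 open V /\ phi @` A1 `<=` V,
                 holomorphic_to_sphere atlas V rho &
                 represents A1 F (rho \o phi)])].
Proof.
exists (null_foliation atlas A phi); split.
- exact: null_foliation_holomorphic hN hA hphi hdphi.
- exact: null_foliation_type hN hA hphi hdphi.
- exact: fibre_component_union hN hA hphi hdphi.
- exact: null_foliation_represented hN hA hphi hdphi.
Qed.
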